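(* Let $\mu$ be a probability measure on $\mathbb{Z}$ supported on $\mathbb{N}$ such that $(\mu(n))_{n\in\mathbb{N}}$ is completely monotone. Then: (i) $\mu$ has BAR if and only if there exists $C>0$ such that $$\sum_{k=1}^n k\mu(k)\le C\,n\sum_{k\ge n}\mu(k)\qquad\text{for all } n\ge1.$$ (ii) Assume that $\mu$ has BAR. Let $\sigma$ be a probability measure on $\mathbb{Z}$ such that $\sum_{n\in\mathbb{Z}}n^2\sigma(n)<\infty$. Then $\mu*\sigma\in\mathcal{H}\cap\mathcal{R}$, and for every $\alpha\in(0,1]$, $\alpha\mu+(1-\alpha)\sigma\in\mathcal{H}\cap\mathcal{R}$. In particular (taking $\sigma=\delta_0$), $\mu\in\mathcal{H}\cap\mathcal{R}$.
   Context: $\mathbb{N}=\{0,1,2,\ldots\}$. For a finite measure $\mu$ on $\mathbb{Z}$, $\hat\mu(\theta)=\sum_{n\in\mathbb{Z}}\mu(n)e^{in\theta}$; $*$ is convolution on $\mathbb{Z}$, $\mu^{*n}$ is the $n$-th convolution power, and $\delta_0$ is the Dirac mass at $0$. A real sequence $(t_n)_{n\in\mathbb{N}}$ is completely monotone if, with $\Delta t_n=t_n-t_{n+1}$ and $\Delta^0=\mathrm{Id}$, one has $\Delta^m t_n\ge0$ for all $m,n\ge0$. A probability measure $\mu$ on $\mathbb{Z}$ is strictly aperiodic if $|\hat\mu(\theta)|<1$ for every $\theta\in(0,2\pi)$; it has BAR (bounded angular ratio) if it is strictly aperiodic and $\sup_{\theta\in(0,2\pi)}\frac{|1-\hat\mu(\theta)|}{1-|\hat\mu(\theta)|}<\infty$.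 Hypothesis (H): a probability measure $\mu$ on $\mathbb{Z}$ satisfies (H) if $\hat\mu$ is twice continuously differentiable on $[-\pi,\pi]\setminus\{0\}$ and there exist an even continuous function $\psi$ on $[-\pi,\pi]$, vanishing at $0$ and continuously differentiable on $[-\pi,\pi]\setminus\{0\}$, and constants $c,C>0$ such that for every $\theta\in(0,\pi]$: $|\hat\mu(\theta)|\le 1-c\psi(\theta)$; $|\theta\hat\mu'(\theta)|\le C\psi(\theta)$; $|\hat\mu'(\theta)|\le C\psi'(\theta)$; $|\theta\hat\mu''(\theta)|\le C\psi'(\theta)$. $\mathcal{H}$ denotes the set of probability measures satisfying (H). Ritt: $\mu$ is Ritt if $\sup_{n\ge1}n\|\mu^{*n}-\mu^{*(n+1)}\|_{\ell^1(\mathbb{Z})}<\infty$. $\mathcal{R}$ denotes the set of Ritt probability measures on $\mathbb{Z}$.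
   Formalization: The equivalence in (i) is stated for μ ≠ δ₀ only: δ₀ is supported on ℕ and completely monotone and satisfies the inequality (0 ≤ 0), but its Fourier transform is identically 1, so it does not have BAR; part (ii) is unchanged. *)

(* Defs.v *)
From Stdlib Require Export Reals ZArith.
From Coquelicot Require Export Coquelicot.
Open Scope R_scope.

(* Measures on Z are represented by their mass functions [Z -> R]. *)

(* [sumZ a] is the sum of the family [a] only when [summableZ a] holds:
   [Series] is a total function, with an arbitrary value otherwise. *)
Definition summableZ (a : Z -> R) : Prop :=
  ex_series (fun n : nat => Rabs (a (Z.of_nat n))) /\
  ex_series (fun n : nat => Rabs (a (- Z.of_nat (S n))%Z)).

Definition sumZ (a : Z -> R) : R :=
  Series (fun n : nat => a (Z.of_nat n)) +
  Series (fun n : nat => a (- Z.of_nat (S n))%Z).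

Definition is_prob (mu : Z -> R) : Prop :=
  (forall n : Z, 0 <= mu n) /\ summableZ mu /\ sumZ mu = 1.

Definition supported_on_N (mu : Z -> R) : Prop :=
  forall n : Z, (n < 0)%Z -> mu n = 0.

Definition dirac0 : Z -> R := fun n => if Z.eq_dec n 0 then 1 else 0.

Definition conv (mu nu : Z -> R) : Z -> R :=
  fun n => sumZ (fun k => mu k * nu (n - k)%Z).

Definition conv_pow (mu : Z -> R) (n : nat) : Z -> R :=
  Nat.iter n (conv mu) dirac0.

Definition l1norm (a : Z -> R) : R := sumZ (fun n => Rabs (a n)).

(* The sum of mu n * exp (i n theta), by real and imaginary parts. *)
Definition fourier (mu : Z -> R) (theta : R) : C :=
  (sumZ (fun n => mu n * cos (IZR n * theta)),
   sumZ (fun n => mu n * sin (IZR n * theta))).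

Definition Delta (t : nat -> R) : nat -> R := fun n => t n - t (S n).

Definition completely_monotone (t : nat -> R) : Prop :=
  forall m n : nat, 0 <= Nat.iter m Delta t n.

Definition strictly_aperiodic (mu : Z -> R) : Prop :=
  forall theta : R, 0 < theta < 2 * PI -> Cmod (fourier mu theta) < 1.

Definition BAR (mu : Z -> R) : Prop :=
  strictly_aperiodic mu /\
  exists M : R, forall theta : R, 0 < theta < 2 * PI ->
    Cmod (1 - fourier mu theta)%C / (1 - Cmod (fourier mu theta)) <= M.

(* [f] is continuously differentiable on [D] with derivative [f'].  The limits
   are taken within [D], so they are one-sided at an endpoint of [D]. *)
Definition C1_on {V : NormedModule R_AbsRing} (D : R -> Prop)
    (f f' : R -> V) : Prop :=
  (forall x : R, D x ->
     filterdiff f (within D (locally x)) (fun h : R => scal h (f' x))) /\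
  continuous_on D f'.

Definition circle (theta : R) : Prop := - PI <= theta <= PI.

Definition punctured_circle (theta : R) : Prop := circle theta /\ theta <> 0.

(* [mu1] and [mu2] are the first two derivatives of the Fourier transform of
   [mu], and [dpsi] is the derivative of [psi]. *)
Definition hypothesis_H (mu : Z -> R) : Prop :=
  exists mu1 mu2 : R -> C,
    C1_on (V := C_R_NormedModule) punctured_circle (fourier mu) mu1 /\
    C1_on (V := C_R_NormedModule) punctured_circle mu1 mu2 /\
  exists psi dpsi : R -> R,
    (forall theta : R, circle theta -> psi (- theta) = psi theta) /\
    continuous_on circle psi /\
    psi 0 = 0 /\
    C1_on (V := R_NormedModule) punctured_circle psi dpsi /\
  exists c K : R, 0 < c /\ 0 < K /\
    forall theta : R, 0 < theta <= PI ->
      Cmod (fourier mu theta) <= 1 - c * psi theta /\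
      Cmod (RtoC theta * mu1 theta)%C <= K * psi theta /\
      Cmod (mu1 theta) <= K * dpsi theta /\
      Cmod (RtoC theta * mu2 theta)%C <= K * dpsi theta.

Definition class_H (mu : Z -> R) : Prop := is_prob mu /\ hypothesis_H mu.

Definition Ritt (mu : Z -> R) : Prop :=
  exists M : R, forall n : nat, (1 <= n)%nat ->
    INR n * l1norm (fun k => conv_pow mu n k - conv_pow mu (S n) k) <= M.

Definition class_R (mu : Z -> R) : Prop := is_prob mu /\ Ritt mu.

(* Main.v *)
Require Import Defs.
From Stdlib Require Import Lra Lia FunctionalExtensionality.

(** Write [t k] for the mass at [k], [f] for the Fourier transform, [T n] for the tail
    from [n] on, and [S n] for the truncated mean, the sum of [k t_k] for [k <= n].
    Everything is compared with [T] at the scale [1 / theta].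

    Equivalence of BAR with the tail condition. At a frequency that is a small multiple of
    [1 / n], the imaginary part of [f] is at least a multiple of [S n / n], up to the tail,
    while [1 - Re f] is smaller than that, again up to the tail; BAR then bounds
    [S n / n] by [T n] ([tail_of_BAR]). Conversely [|1 - f|] is at most the sum of
    [t_k min (k theta, 2)], which the tail condition bounds by [T] at [1 / theta]; since [t]
    decreases, a translation of the series by a half period shows that [1 - Re f] is at
    least a quarter of that tail ([tail_le_cos_defect]); and [1 - |f| >= t_0 (1 - Re f)]
    because of the atom at 0 ([Cmod_fourier_gap]).

    Hypothesis (H). The function [psi] is the sum of [t_k (1 - exp (- k |theta|))]. It is bounded by
    the sum of [t_k min (k theta, 2)], hence by a multiple of [1 - |f|]. Its derivative is at least a
    multiple of [S (3 N)] for [N] of order [1 / theta]. The derivatives of [f] are estimated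
    by cutting the power series at [3 N]: the head is bounded termwise by [S (3 N)], and
    three summations by parts express the tail through the first three differences of
    [t] at [3 N] and an absolutely convergent series ([fourier_derivative_bounds]). A law with a second
    moment only adds bounded derivatives, and [psi'] is bounded below.

    Ritt property. A decreasing law is a mixture of the uniform laws on [0, L]. In the
    n-th convolution power, [mu^n * (dirac0 - nu)] is small because of the widest of the n
    intervals drawn: if its length is [L], the norm is at most a multiple of the
    mass beyond [L], by the tail condition, and the expected mass beyond the largest of n
    independent draws is at most [1 / (n + 1)] ([Ritt_of_layers]). The same layers serve for
    the convolution with [sigma] and for the mixture. *)

(** * Series of real numbers *)

Lemma sum_n_Sn_R (a : nat -> R) (n : nat) : sum_n a (S n) = sum_n a n + a (S n).
Proof. rewrite sum_Sn. reflexivity. Qed.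

Lemma sum_n_le (a b : nat -> R) (n : nat) :
  (forall k, (k <= n)%nat -> a k <= b k) -> sum_n a n <= sum_n b n.
Proof.
  induction n as [|n IH]; intros H.
  - rewrite !sum_O. apply H; lia.
  - rewrite !sum_n_Sn_R. apply Rplus_le_compat; [apply IH; intros; apply H; lia | apply H; lia].
Qed.

Lemma sum_n_nonneg (a : nat -> R) (n : nat) : (forall k, 0 <= a k) -> 0 <= sum_n a n.
Proof.
  intros H; induction n as [|n IH].
  - rewrite sum_O; apply H.
  - rewrite sum_n_Sn_R. specialize (H (S n)); lra.
Qed.

Lemma is_lim_seq_sum_n (a : nat -> R) :
  ex_series a -> is_lim_seq (sum_n a) (Series a).
Proof. intros H. exact (Series_correct a H). Qed.

Lemma Series_le_of_sums (a : nat -> R) (M : R) :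
  ex_series a -> (forall n, sum_n a n <= M) -> Series a <= M.
Proof.
  intros H HM.
  apply (is_lim_seq_le (sum_n a) (fun _ => M) (Series a) M HM).
  - now apply is_lim_seq_sum_n.
  - apply is_lim_seq_const.
Qed.

Lemma ex_series_bounded (a : nat -> R) (M : R) :
  (forall n, 0 <= a n) -> (forall n, sum_n a n <= M) -> ex_series a.
Proof.
  intros H0 HM.
  destruct (ex_finite_lim_seq_incr (sum_n a) M) as [l Hl].
  - intros n. rewrite sum_n_Sn_R. specialize (H0 (S n)); lra.
  - exact HM.
  - exists l. exact Hl.
Qed.

Lemma sum_n_le_Series (a : nat -> R) (n : nat) :
  (forall n, 0 <= a n) -> ex_series a -> sum_n a n <= Series a.
Proof.
  intros H0 H.
  apply (is_lim_seq_incr_compare (sum_n a)).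
  - now apply is_lim_seq_sum_n.
  - intros k. rewrite sum_n_Sn_R. specialize (H0 (S k)); lra.
Qed.

Lemma term_le_Series (a : nat -> R) (n : nat) :
  (forall n, 0 <= a n) -> ex_series a -> a n <= Series a.
Proof.
  intros H0 H. eapply Rle_trans; [|apply (sum_n_le_Series a n H0 H)].
  destruct n as [|n]; [rewrite sum_O; lra|].
  rewrite sum_n_Sn_R. assert (0 <= sum_n a n) by now apply sum_n_nonneg. lra.
Qed.

Lemma Series_mono (a b : nat -> R) :
  (forall n, a n <= b n) -> ex_series a -> ex_series b -> Series a <= Series b.
Proof.
  intros H Ha Hb.
  apply (is_lim_seq_le (sum_n a) (sum_n b) (Series a) (Series b)).
  - intros n. apply sum_n_le; auto.
  - now apply is_lim_seq_sum_n.
  - now apply is_lim_seq_sum_n.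
Qed.

Lemma Series_nonneg (a : nat -> R) :
  (forall n, 0 <= a n) -> ex_series a -> 0 <= Series a.
Proof.
  intros H Ha. eapply Rle_trans; [|apply (sum_n_le_Series a 0 H Ha)].
  rewrite sum_O; apply H.
Qed.

Lemma ex_series_dom (a b : nat -> R) :
  (forall n, Rabs (a n) <= b n) -> ex_series b -> ex_series a.
Proof. intros H Hb. exact (ex_series_le a b H Hb). Qed.

Lemma ex_series_plusR (a b : nat -> R) :
  ex_series a -> ex_series b -> ex_series (fun n => a n + b n).
Proof. intros; now apply (ex_series_plus a b). Qed.

Lemma ex_series_minusR (a b : nat -> R) :
  ex_series a -> ex_series b -> ex_series (fun n => a n - b n).
Proof. intros; now apply (ex_series_minus a b). Qed.

Lemma ex_series_scalR (c : R) (a : nat -> R) :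
  ex_series a -> ex_series (fun n => c * a n).
Proof. intros; now apply (ex_series_scal_l c a). Qed.

Lemma ex_series_abs_of_nonneg (a : nat -> R) :
  (forall n, 0 <= a n) -> ex_series a -> ex_series (fun n => Rabs (a n)).
Proof.
  intros H. apply ex_series_ext. intros n. now rewrite Rabs_pos_eq.
Qed.

Lemma ex_series_mult_bounded (a g : nat -> R) :
  (forall n, 0 <= a n) -> ex_series a -> (forall n, Rabs (g n) <= 1) ->
  ex_series (fun n => a n * g n).
Proof.
  intros H0 H Hg. apply (ex_series_dom _ a); auto. intros n.
  rewrite Rabs_mult, (Rabs_pos_eq (a n)) by auto. specialize (Hg n). specialize (H0 n). nra.
Qed.

Lemma Series_zero (a : nat -> R) : (forall n, a n = 0) -> is_series a 0.
Proof.
  intros H. change (is_lim_seq (sum_n a) 0).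
  apply (is_lim_seq_ext (fun _ => 0)); [|apply is_lim_seq_const].
  intros n. induction n as [|n IH].
  - now rewrite sum_O.
  - rewrite sum_n_Sn_R, <- IH, H. lra.
Qed.

Lemma Series_0 (a : nat -> R) : (forall n, a n = 0) -> Series a = 0.
Proof. intros H. apply is_series_unique, Series_zero, H. Qed.

Lemma sum_n_Series (u : nat -> nat -> R) (n : nat) :
  (forall i, ex_series (u i)) ->
  ex_series (fun j => sum_n (fun i => u i j) n) /\
  Series (fun j => sum_n (fun i => u i j) n) = sum_n (fun i => Series (u i)) n.
Proof.
  intros H; induction n as [|n [IH1 IH2]].
  - split.
    + apply (ex_series_ext (u 0%nat)); [intros; now rewrite sum_O | apply H].
    + rewrite sum_O. apply Series_ext. intros; now rewrite sum_O.
  - split.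
    + apply (ex_series_ext (fun j => sum_n (fun i => u i j) n + u (S n) j)).
      * intros; now rewrite sum_n_Sn_R.
      * now apply ex_series_plusR.
    + rewrite sum_n_Sn_R, <- IH2, <- Series_plus; auto.
      apply Series_ext. intros; now rewrite sum_n_Sn_R.
Qed.

(** Each finite block of the column sums is a finite sum of truncated row
    sums, hence at most the total; this one-sided bound, used in both
    directions, gives the equality. *)
Lemma Tonelli_half (u : nat -> nat -> R) :
  (forall i j, 0 <= u i j) ->
  (forall i, ex_series (u i)) -> ex_series (fun i => Series (u i)) ->
  (forall j, ex_series (fun i => u i j)) /\
  ex_series (fun j => Series (fun i => u i j)) /\
  Series (fun j => Series (fun i => u i j)) <= Series (fun i => Series (u i)).
Proof.
  intros H0 H1 H2.
  assert (Hcol : forall j, ex_series (fun i => u i j)).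
  { intros j. apply (ex_series_dom _ (fun i => Series (u i))); [|exact H2].
    intros i. rewrite Rabs_pos_eq by auto. apply (term_le_Series (u i) j); auto. }
  assert (Hb : forall n, sum_n (fun j => Series (fun i => u i j)) n
                         <= Series (fun i => Series (u i))).
  { intros n.
    destruct (sum_n_Series (fun j i => u i j) n Hcol) as [E1 E2].
    rewrite <- E2. apply Series_mono; auto.
    intros i. apply sum_n_le_Series; auto. }
  assert (Hex : ex_series (fun j => Series (fun i => u i j))).
  { apply (ex_series_bounded _ (Series (fun i => Series (u i)))); auto.
    intros j. apply Series_nonneg; auto. }
  repeat split; auto. apply Series_le_of_sums; auto.
Qed.

Lemma Tonelli_nat (u : nat -> nat -> R) :
  (forall i j, 0 <= u i j) ->
  (forall i, ex_series (u i)) -> ex_series (fun i => Series (u i)) ->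
  (forall j, ex_series (fun i => u i j)) /\
  ex_series (fun j => Series (fun i => u i j)) /\
  Series (fun j => Series (fun i => u i j)) = Series (fun i => Series (u i)).
Proof.
  intros H0 H1 H2.
  destruct (Tonelli_half u H0 H1 H2) as [A [B D]].
  destruct (Tonelli_half (fun j i => u i j)) as [A' [B' D']]; auto.
  repeat split; auto. now apply Rle_antisym.
Qed.

(** Tannery's theorem: dominated convergence for series. *)
Lemma Tannery {T : Type} (F : (T -> Prop) -> Prop) {FF : Filter F}
  (u : nat -> T -> R) (l : nat -> R) (B : nat -> R) :
  ex_series B ->
  (forall n, filterlim (u n) F (locally (l n))) ->
  F (fun y => forall n, Rabs (u n y) <= B n) ->
  (forall n, Rabs (l n) <= B n) ->
  filterlim (fun y => Series (fun n => u n y)) F (locally (Series l)).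
Proof.
  intros HB Hl Hu Hlb. apply filterlim_locally. intros eps.
  assert (HB0 : forall n, 0 <= B n).
  { intros n. eapply Rle_trans; [apply Rabs_pos|apply Hlb]. }
  (* Cut the series at an index N beyond which the majorant sums to at most
     a quarter of eps; finitely many terms remain. *)
  assert (HN : exists N, Series (fun k => B (S N + k)%nat) < eps / 4).
  { pose proof (is_lim_seq_sum_n B HB) as HL.
    apply is_lim_seq_spec in HL.
    assert (He : 0 < eps / 4) by (destruct eps; simpl; lra).
    destruct (HL (mkposreal _ He)) as [N HN].
    exists N. specialize (HN N (le_n N)). simpl in HN.
    rewrite (Series_incr_n B (S N)) in HN by (auto; lia).
    rewrite <- sum_n_Reals in HN. simpl pred in HN.
    apply Rabs_def2 in HN. lra. }
  destruct HN as [N HN].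
  assert (Hfin : F (fun y => Rabs (sum_n (fun n => u n y - l n) N) < eps / 4)).
  { clear HN. assert (He : 0 < eps / 4) by (destruct eps; simpl; lra).
    revert He. generalize (eps / 4). induction N as [|N IH]; intros e He.
    - pose proof (proj1 (filterlim_locally (u 0%nat) (l 0%nat)) (Hl 0%nat)
        (mkposreal e He)) as H.
      revert H. apply filter_imp. intros y Hy. rewrite sum_O. exact Hy.
    - assert (He2 : 0 < e / 2) by lra.
      pose proof (proj1 (filterlim_locally (u (S N)) (l (S N))) (Hl (S N))
        (mkposreal _ He2)) as H.
      generalize (filter_and _ _ H (IH _ He2)). apply filter_imp.
      intros y [Hy1 Hy2]. rewrite sum_n_Sn_R.
      assert (Hy1' : Rabs (u (S N) y - l (S N)) < e / 2) by exact Hy1.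
      eapply Rle_lt_trans; [apply Rabs_triang|]. lra. }
  generalize (filter_and _ _ Hu Hfin). apply filter_imp.
  intros y [Hy1 Hy2].
  assert (Eu : ex_series (fun n => u n y)) by now apply (ex_series_dom _ B).
  assert (El : ex_series l) by now apply (ex_series_dom _ B).
  assert (Ed : ex_series (fun n => u n y - l n)) by now apply ex_series_minusR.
  change (Rabs (Series (fun n => u n y) - Series l) < eps).
  rewrite <- Series_minus by auto.
  rewrite (Series_incr_n _ (S N)) by (auto; lia).
  rewrite <- sum_n_Reals. simpl pred.
  eapply Rle_lt_trans; [apply Rabs_triang|].
  assert (Htail : Rabs (Series (fun k => u (S N + k)%nat y - l (S N + k)%nat))
                  <= 2 * Series (fun k => B (S N + k)%nat)).
  { assert (EB : ex_series (fun k => B (S N + k)%nat))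
      by now apply (proj1 (ex_series_incr_n B (S N))).
    assert (Hd : forall k, Rabs (Rabs (u (S N + k)%nat y - l (S N + k)%nat))
                   <= 2 * B (S N + k)%nat).
    { intros k. rewrite Rabs_Rabsolu.
      specialize (Hy1 (S N + k)%nat). specialize (Hlb (S N + k)%nat).
      unfold Rminus. eapply Rle_trans; [apply Rabs_triang|].
      rewrite Rabs_Ropp. lra. }
    assert (Ea : ex_series (fun k => Rabs (u (S N + k)%nat y - l (S N + k)%nat))).
    { apply (ex_series_dom _ (fun k => 2 * B (S N + k)%nat)); auto.
      now apply ex_series_scalR. }
    eapply Rle_trans; [apply Series_Rabs; exact Ea|].
    rewrite <- Series_scal_l. apply Series_mono; auto.
    - intros k. eapply Rle_trans; [apply Rle_abs|apply Hd].
    - now apply ex_series_scalR. }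
  assert (0 < eps) by (destruct eps; simpl; lra). lra.
Qed.

(** * Sums over the integers *)

(** The two half-line series of [sumZ] folded into one series over [nat]. *)
Definition pairZ (a : Z -> R) (n : nat) : R :=
  a (Z.of_nat n) + a (- Z.of_nat (S n))%Z.

Lemma summableZ_right (a : Z -> R) :
  summableZ a -> ex_series (fun n => a (Z.of_nat n)).
Proof. intros [H _]. now apply ex_series_Rabs. Qed.

Lemma summableZ_left (a : Z -> R) :
  summableZ a -> ex_series (fun n => a (- Z.of_nat (S n))%Z).
Proof. intros [_ H]. now apply ex_series_Rabs. Qed.

Lemma ex_series_pairZ (a : Z -> R) : summableZ a -> ex_series (pairZ a).
Proof.
  intros H. apply ex_series_plusR; [now apply summableZ_right|now apply summableZ_left].
Qed.

Lemma sumZ_pairZ (a : Z -> R) : summableZ a -> sumZ a = Series (pairZ a).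
Proof.
  intros H. unfold sumZ, pairZ. rewrite Series_plus; auto.
  - now apply summableZ_right.
  - now apply summableZ_left.
Qed.

Lemma summableZ_dom (a b : Z -> R) :
  (forall n, Rabs (a n) <= b n) -> summableZ b -> summableZ a.
Proof.
  intros H Hb. split.
  - apply (ex_series_dom _ (fun n => b (Z.of_nat n))); [|now apply summableZ_right].
    intros n. rewrite Rabs_Rabsolu. apply H.
  - apply (ex_series_dom _ (fun n => b (- Z.of_nat (S n))%Z)); [|now apply summableZ_left].
    intros n. rewrite Rabs_Rabsolu. apply H.
Qed.

Lemma summableZ_abs (a : Z -> R) : summableZ a -> summableZ (fun n => Rabs (a n)).
Proof.
  intros [H1 H2]. split.
  - eapply ex_series_ext; [|exact H1]. intros n; now rewrite Rabs_Rabsolu.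
  - eapply ex_series_ext; [|exact H2]. intros n; now rewrite Rabs_Rabsolu.
Qed.

Lemma summableZ_of_pairZ (a : Z -> R) :
  (forall n, 0 <= a n) -> ex_series (pairZ a) -> summableZ a.
Proof.
  intros H0 H. split; apply (ex_series_dom _ (pairZ a)); auto;
    intros n; rewrite Rabs_Rabsolu, Rabs_pos_eq by auto; unfold pairZ;
    [specialize (H0 (- Z.of_nat (S n))%Z)|specialize (H0 (Z.of_nat n))]; lra.
Qed.

Lemma summableZ_plus (a b : Z -> R) :
  summableZ a -> summableZ b -> summableZ (fun n => a n + b n).
Proof.
  intros Ha Hb. apply (summableZ_dom _ (fun n => Rabs (a n) + Rabs (b n))).
  - intros n. apply Rabs_triang.
  - assert (Habs : forall x y, Rabs (x) + Rabs y = Rabs (Rabs x + Rabs y)).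
    { intros x y. rewrite (Rabs_pos_eq (_ + _)); auto.
      apply Rplus_le_le_0_compat; apply Rabs_pos. }
    destruct Ha as [A1 A2], Hb as [B1 B2]. split.
    + eapply ex_series_ext; [intros n; apply Habs|]. now apply ex_series_plusR.
    + eapply ex_series_ext; [intros n; apply Habs|]. now apply ex_series_plusR.
Qed.

Lemma summableZ_scal (c : R) (a : Z -> R) :
  summableZ a -> summableZ (fun n => c * a n).
Proof.
  intros [A1 A2]. split.
  - eapply ex_series_ext; [intros n; symmetry; apply Rabs_mult|]. now apply ex_series_scalR.
  - eapply ex_series_ext; [intros n; symmetry; apply Rabs_mult|]. now apply ex_series_scalR.
Qed.

Lemma summableZ_minus (a b : Z -> R) :
  summableZ a -> summableZ b -> summableZ (fun n => a n - b n).
Proof.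
  intros Ha Hb. replace (fun n => a n - b n) with (fun n => a n + (-1) * b n).
  - apply summableZ_plus; auto. now apply summableZ_scal.
  - extensionality n; ring.
Qed.

Lemma sumZ_plus (a b : Z -> R) :
  summableZ a -> summableZ b -> sumZ (fun n => a n + b n) = sumZ a + sumZ b.
Proof.
  intros Ha Hb. unfold sumZ. rewrite !Series_plus;
    auto using summableZ_left, summableZ_right. ring.
Qed.

Lemma sumZ_scal (c : R) (a : Z -> R) : sumZ (fun n => c * a n) = c * sumZ a.
Proof. unfold sumZ. rewrite !Series_scal_l. ring. Qed.

Lemma sumZ_minus (a b : Z -> R) :
  summableZ a -> summableZ b -> sumZ (fun n => a n - b n) = sumZ a - sumZ b.
Proof.
  intros Ha Hb. unfold sumZ. rewrite !Series_minus;
    auto using summableZ_left, summableZ_right. ring.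
Qed.

Lemma sumZ_ext (a b : Z -> R) : (forall n, a n = b n) -> sumZ a = sumZ b.
Proof. intros H. unfold sumZ. f_equal; apply Series_ext; intros; apply H. Qed.

Lemma summableZ_ext (a b : Z -> R) :
  (forall n, a n = b n) -> summableZ a -> summableZ b.
Proof. intros H. apply functional_extensionality in H. now subst. Qed.

Lemma sumZ_le (a b : Z -> R) :
  (forall n, a n <= b n) -> summableZ a -> summableZ b -> sumZ a <= sumZ b.
Proof.
  intros H Ha Hb. apply Rplus_le_compat; apply Series_mono;
    auto using summableZ_left, summableZ_right.
Qed.

Lemma sumZ_nonneg (a : Z -> R) : (forall n, 0 <= a n) -> summableZ a -> 0 <= sumZ a.
Proof.
  intros H Ha. apply Rplus_le_le_0_compat; apply Series_nonneg;
    auto using summableZ_left, summableZ_right.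
Qed.

Lemma sumZ_abs_le (a : Z -> R) : summableZ a -> Rabs (sumZ a) <= l1norm a.
Proof.
  intros [H1 H2]. eapply Rle_trans; [apply Rabs_triang|].
  apply Rplus_le_compat; now apply Series_Rabs.
Qed.

Lemma sumZ_shift1 (a : Z -> R) :
  summableZ a ->
  summableZ (fun n => a (n + 1)%Z) /\ sumZ (fun n => a (n + 1)%Z) = sumZ a.
Proof.
  intros Ha.
  assert (E1 : forall n, a (Z.of_nat n + 1)%Z = a (Z.of_nat (S n))).
  { intros n; f_equal; lia. }
  assert (E2 : forall n, a (- Z.of_nat (S n) + 1)%Z = a (- Z.of_nat n)%Z).
  { intros n; f_equal; lia. }
  destruct Ha as [H1 H2].
  assert (H3 : ex_series (fun n => Rabs (a (- Z.of_nat n)%Z))).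
  { now apply (proj2 (ex_series_incr_1 (fun n => Rabs (a (- Z.of_nat n)%Z)))). }
  split; [split|].
  - apply (ex_series_ext (fun n => Rabs (a (Z.of_nat (S n))))).
    + intros; now rewrite E1.
    + now apply (proj1 (ex_series_incr_1 (fun n => Rabs (a (Z.of_nat n))))).
  - apply (ex_series_ext (fun n => Rabs (a (- Z.of_nat n)%Z))); [|exact H3].
    intros; now rewrite E2.
  - unfold sumZ. rewrite (Series_ext _ _ E1), (Series_ext _ _ E2).
    rewrite (Series_incr_1 (fun n => a (Z.of_nat n))) by now apply ex_series_Rabs.
    rewrite (Series_incr_1 (fun n => a (- Z.of_nat n)%Z)) by now apply ex_series_Rabs.
    simpl Z.of_nat at 2. simpl (- 0)%Z. simpl (a (Z.of_nat 0)). ring.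
Qed.

Lemma sumZ_opp (a : Z -> R) :
  summableZ a ->
  summableZ (fun n => a (- n)%Z) /\ sumZ (fun n => a (- n)%Z) = sumZ a.
Proof.
  intros [H1 H2].
  assert (E2 : forall n, a (- - Z.of_nat (S n))%Z = a (Z.of_nat (S n))).
  { intros n; f_equal; lia. }
  assert (H3 : ex_series (fun n => Rabs (a (- Z.of_nat n)%Z))).
  { now apply (proj2 (ex_series_incr_1 (fun n => Rabs (a (- Z.of_nat n)%Z)))). }
  split; [split|].
  - exact H3.
  - apply (ex_series_ext (fun n => Rabs (a (Z.of_nat (S n))))).
    + intros; now rewrite E2.
    + now apply (proj1 (ex_series_incr_1 (fun n => Rabs (a (Z.of_nat n))))).
  - unfold sumZ. rewrite (Series_ext _ _ E2).
    rewrite (Series_incr_1 (fun n => a (Z.of_nat n))) by now apply ex_series_Rabs.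
    rewrite (Series_incr_1 (fun n => a (- Z.of_nat n)%Z)) by now apply ex_series_Rabs.
    simpl (- Z.of_nat 0)%Z. simpl (Z.of_nat 0). ring.
Qed.

Lemma sumZ_shift (a : Z -> R) (k : Z) :
  summableZ a ->
  summableZ (fun n => a (n + k)%Z) /\ sumZ (fun n => a (n + k)%Z) = sumZ a.
Proof.
  revert a. assert (Hnat : forall m a, summableZ a ->
    summableZ (fun n => a (n + Z.of_nat m)%Z) /\
    sumZ (fun n => a (n + Z.of_nat m)%Z) = sumZ a).
  { induction m as [|m IH]; intros a Ha.
    - replace (fun n => a (n + Z.of_nat 0)%Z) with a; auto.
      extensionality i; f_equal; lia.
    - destruct (IH a Ha) as [I1 I2]. destruct (sumZ_shift1 _ I1) as [J1 J2].
      replace (fun n => a (n + Z.of_nat (S m))%Z)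
        with (fun n => a (n + 1 + Z.of_nat m)%Z).
      + split; auto. now rewrite J2.
      + extensionality i; f_equal; lia. }
  intros a Ha. destruct (Z_le_gt_dec 0 k) as [Hk|Hk].
  - rewrite <- (Z2Nat.id k Hk). now apply Hnat.
  - (* A shift to the left is a shift to the right of the reflected family. *)
    destruct (sumZ_opp a Ha) as [O1 O2].
    destruct (Hnat (Z.to_nat (- k)) _ O1) as [S1 S2].
    rewrite Z2Nat.id in S1, S2 by lia.
    destruct (sumZ_opp _ S1) as [P1 P2].
    replace (fun n => a (n + k)%Z) with (fun n => a (- (- n + - k))%Z).
    + split; auto. now rewrite P2, S2.
    + extensionality i; f_equal; lia.
Qed.

Lemma sumZ_reflect (a : Z -> R) (k : Z) :
  summableZ a ->
  summableZ (fun n => a (k - n)%Z) /\ sumZ (fun n => a (k - n)%Z) = sumZ a.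
Proof.
  intros Ha. destruct (sumZ_shift a k Ha) as [S1 S2].
  destruct (sumZ_opp _ S1) as [O1 O2].
  replace (fun n => a (k - n)%Z) with (fun n => a (- n + k)%Z).
  - split; auto. now rewrite O2.
  - extensionality i; f_equal; lia.
Qed.

Lemma Tonelli_Z (u : Z -> Z -> R) :
  (forall i j, 0 <= u i j) ->
  (forall i, summableZ (u i)) -> summableZ (fun i => sumZ (u i)) ->
  (forall j, summableZ (fun i => u i j)) /\
  summableZ (fun j => sumZ (fun i => u i j)) /\
  sumZ (fun j => sumZ (fun i => u i j)) = sumZ (fun i => sumZ (u i)).
Proof.
  intros H0 H1 H2.
  set (U := fun i j : nat => pairZ (fun k => pairZ (u k) j) i).
  assert (HU0 : forall i j, 0 <= U i j).
  { intros i j; unfold U, pairZ. repeat apply Rplus_le_le_0_compat; auto. }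
  assert (HUs : forall i, ex_series (U i) /\
    Series (U i) = pairZ (fun k => sumZ (u k)) i).
  { intros i. unfold U at 1 2. unfold pairZ at 1 3 5.
    rewrite Series_plus by (apply ex_series_pairZ; auto).
    rewrite <- !sumZ_pairZ by auto. split; auto.
    apply ex_series_plusR; apply ex_series_pairZ; auto. }
  assert (HU1 : forall i, ex_series (U i)) by apply HUs.
  assert (HU2 : ex_series (fun i => Series (U i))).
  { eapply ex_series_ext; [intros i; symmetry; apply (proj2 (HUs i))|].
    now apply ex_series_pairZ. }
  destruct (Tonelli_nat U HU0 HU1 HU2) as [A [B D]].
  assert (Hpart : forall n j, 0 <= pairZ (fun i => u i j) n).
  { intros; unfold pairZ; apply Rplus_le_le_0_compat; auto. }
  assert (HUeq : forall i j, U i j = pairZ (fun i => u i (Z.of_nat j)) i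
      + pairZ (fun i => u i (- Z.of_nat (S j))%Z) i).
  { intros; unfold U, pairZ; ring. }
  assert (Hc : forall j, summableZ (fun i => u i (Z.of_nat j)) /\
                         summableZ (fun i => u i (- Z.of_nat (S j))%Z)).
  { intros j. split; apply summableZ_of_pairZ; auto;
    apply (ex_series_dom _ (fun i => U i j)); auto; intros i;
    rewrite Rabs_pos_eq by auto; rewrite HUeq.
    - specialize (Hpart i (- Z.of_nat (S j))%Z); lra.
    - specialize (Hpart i (Z.of_nat j)); lra. }
  assert (Hcol : forall j, summableZ (fun i => u i j)).
  { intros j. destruct (Z_le_gt_dec 0 j) as [Hj|Hj].
    - rewrite <- (Z2Nat.id j Hj). apply Hc.
    - replace j with (- Z.of_nat (S (Z.to_nat (- j - 1))))%Z by lia. apply Hc. }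
  assert (HUc : forall j, Series (fun i => U i j)
                = pairZ (fun k => sumZ (fun i => u i k)) j).
  { intros j. rewrite (Series_ext _ _ (fun i => HUeq i j)).
    rewrite Series_plus by (apply ex_series_pairZ; auto).
    rewrite <- !sumZ_pairZ by auto. reflexivity. }
  assert (Hrow : summableZ (fun j => sumZ (fun i => u i j))).
  { apply summableZ_of_pairZ; [intros; now apply sumZ_nonneg|].
    eapply ex_series_ext; [exact HUc|exact B]. }
  repeat split; auto; try apply Hcol; try apply Hrow.
  rewrite (sumZ_pairZ _ Hrow), (sumZ_pairZ _ H2).
  rewrite <- (Series_ext _ _ HUc), D. apply Series_ext. intros; apply HUs.
Qed.

Lemma Fubini_Z (u : Z -> Z -> R) :
  (forall i, summableZ (u i)) -> summableZ (fun i => l1norm (u i)) ->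
  (forall j, summableZ (fun i => u i j)) /\
  summableZ (fun j => sumZ (fun i => u i j)) /\
  sumZ (fun j => sumZ (fun i => u i j)) = sumZ (fun i => sumZ (u i)).
Proof.
  intros H1 H2.
  set (p := fun i j => Rabs (u i j)). set (q := fun i j => Rabs (u i j) - u i j).
  assert (Hp0 : forall i j, 0 <= p i j) by (intros; apply Rabs_pos).
  assert (Hq0 : forall i j, 0 <= q i j).
  { intros; unfold q. generalize (Rle_abs (u i j)); lra. }
  assert (Hp1 : forall i, summableZ (p i)) by (intros; now apply summableZ_abs).
  assert (Hq1 : forall i, summableZ (q i)) by (intros; apply summableZ_minus; auto; now apply summableZ_abs).
  assert (Hq2 : summableZ (fun i => sumZ (q i))).
  { apply (summableZ_dom _ (fun i => 2 * l1norm (u i))); [|now apply summableZ_scal].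
    intros i. rewrite Rabs_pos_eq by now apply sumZ_nonneg.
    unfold l1norm. rewrite <- sumZ_scal. apply sumZ_le; auto.
    - intros n. unfold q. generalize (Rle_abs (- u i n)). rewrite Rabs_Ropp. lra.
    - apply summableZ_scal. now apply summableZ_abs. }
  destruct (Tonelli_Z p Hp0 Hp1 H2) as [P1 [P2 P3]].
  destruct (Tonelli_Z q Hq0 Hq1 Hq2) as [Q1 [Q2 Q3]].
  assert (Hu : forall i j, u i j = p i j - q i j) by (intros; unfold p, q; ring).
  assert (U1 : forall j, summableZ (fun i => u i j)).
  { intros j. eapply summableZ_ext; [intros i; symmetry; apply Hu|].
    now apply summableZ_minus. }
  assert (U2 : forall j, sumZ (fun i => u i j)
      = sumZ (fun i => p i j) - sumZ (fun i => q i j)).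
  { intros j. rewrite <- sumZ_minus by auto. apply sumZ_ext. auto. }
  split; [exact U1|]. split.
  - eapply summableZ_ext; [intros j; symmetry; apply U2|]. now apply summableZ_minus.
  - rewrite (sumZ_ext _ _ U2), sumZ_minus by auto. rewrite P3, Q3.
    rewrite <- sumZ_minus by auto. apply sumZ_ext. intros i.
    rewrite <- sumZ_minus by auto. apply sumZ_ext. intros; symmetry; apply Hu.
Qed.

(** * The convolution algebra of summable functions on the integers *)

Lemma l1norm_nonneg (a : Z -> R) : summableZ a -> 0 <= l1norm a.
Proof. intros H. apply sumZ_nonneg; [intros; apply Rabs_pos|now apply summableZ_abs]. Qed.

Lemma l1norm_of_nonneg (a : Z -> R) : (forall n, 0 <= a n) -> l1norm a = sumZ a.
Proof. intros H. apply sumZ_ext. intros; now apply Rabs_pos_eq. Qed.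

Lemma l1norm_plus (a b : Z -> R) : summableZ a -> summableZ b ->
  l1norm (fun n => a n + b n) <= l1norm a + l1norm b.
Proof.
  intros Ha Hb. unfold l1norm. rewrite <- sumZ_plus by now apply summableZ_abs.
  apply sumZ_le.
  - intros; apply Rabs_triang.
  - apply summableZ_abs. now apply summableZ_plus.
  - apply summableZ_plus; now apply summableZ_abs.
Qed.

Lemma l1norm_scal (c : R) (a : Z -> R) :
  l1norm (fun n => c * a n) = Rabs c * l1norm a.
Proof. unfold l1norm. rewrite <- sumZ_scal. apply sumZ_ext. intros; apply Rabs_mult. Qed.

Lemma l1norm_minus (a b : Z -> R) : summableZ a -> summableZ b ->
  l1norm (fun n => a n - b n) <= l1norm a + l1norm b.
Proof.
  intros Ha Hb.
  replace (fun n => a n - b n) with (fun n => a n + (-1) * b n)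
    by (extensionality i; ring).
  eapply Rle_trans; [apply l1norm_plus; auto; now apply summableZ_scal|].
  rewrite l1norm_scal, (Rabs_left (-1)) by lra. lra.
Qed.

Lemma term_le_l1norm (a : Z -> R) (n : Z) : summableZ a -> Rabs (a n) <= l1norm a.
Proof.
  intros Ha. destruct (sumZ_shift (fun n => Rabs (a n)) n (summableZ_abs a Ha)) as [S1 S2].
  unfold l1norm. rewrite <- S2. unfold sumZ.
  replace (Rabs (a n)) with (Rabs (a (Z.of_nat 0 + n)%Z)) by (do 2 f_equal; lia).
  assert (0 <= Series (fun n0 => Rabs (a (- Z.of_nat (S n0) + n)%Z))).
  { apply Series_nonneg; [intros; apply Rabs_pos|]. now apply summableZ_left in S1. }
  pose proof (term_le_Series (fun n0 => Rabs (a (Z.of_nat n0 + n)%Z)) 0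
    (fun _ => Rabs_pos _) (summableZ_right _ S1)). simpl in *. lra.
Qed.

Lemma summableZ_mult_bounded (a g : Z -> R) (B : R) :
  summableZ a -> (forall n, Rabs (g n) <= B) -> summableZ (fun n => a n * g n).
Proof.
  intros Ha Hg. apply (summableZ_dom _ (fun n => B * Rabs (a n))).
  - intros n. rewrite Rabs_mult, Rmult_comm.
    apply Rmult_le_compat_r; [apply Rabs_pos|apply Hg].
  - apply summableZ_scal. now apply summableZ_abs.
Qed.

(** Testing a convolution against a bounded function: total mass, Fourier
    coefficients and associativity are the cases where [g] is constant,
    trigonometric and a translate of a third factor. *)
Lemma conv_test (a b g : Z -> R) (B : R) :
  summableZ a -> summableZ b -> (forall n, Rabs (g n) <= B) ->
  summableZ (fun n => conv a b n * g n) /\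
  sumZ (fun n => conv a b n * g n)
  = sumZ (fun k => a k * sumZ (fun j => b j * g (j + k)%Z)).
Proof.
  intros Ha Hb Hg.
  set (u := fun k n => a k * (b (n - k)%Z * g n)).
  assert (Hin : forall k, summableZ (fun n => b (n - k)%Z * g n) /\
    sumZ (fun n => b (n - k)%Z * g n) = sumZ (fun j => b j * g (j + k)%Z) /\
    l1norm (fun n => b (n - k)%Z * g n) <= B * l1norm b).
  { intros k.
    assert (Hs : summableZ (fun j => b j * g (j + k)%Z)).
    { apply (summableZ_mult_bounded _ _ B); auto. }
    destruct (sumZ_shift _ (- k) Hs) as [S1 S2].
    replace (fun n => b (n - k)%Z * g n)
      with (fun n => b (n + - k)%Z * g (n + - k + k)%Z)
      by (extensionality i; do 2 f_equal; lia).
    repeat split; auto; try apply S1.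
    destruct (sumZ_shift _ (- k) (summableZ_abs _ Hs)) as [T1 T2].
    unfold l1norm. rewrite T2, <- sumZ_scal. apply sumZ_le.
    - intros n. rewrite Rabs_mult, Rmult_comm.
      apply Rmult_le_compat_r; [apply Rabs_pos|apply Hg].
    - now apply summableZ_abs.
    - apply summableZ_scal. now apply summableZ_abs. }
  assert (H1 : forall k, summableZ (u k)).
  { intros k. apply summableZ_scal. apply Hin. }
  assert (H2 : summableZ (fun k => l1norm (u k))).
  { apply (summableZ_dom _ (fun k => (B * l1norm b) * Rabs (a k))).
    - intros k. rewrite Rabs_pos_eq by now apply l1norm_nonneg.
      unfold u. rewrite l1norm_scal, Rmult_comm.
      apply Rmult_le_compat_r; [apply Rabs_pos|apply Hin].
    - apply summableZ_scal. now apply summableZ_abs. }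
  destruct (Fubini_Z u H1 H2) as [F1 [F2 F3]].
  assert (E : forall n, sumZ (fun k => u k n) = conv a b n * g n).
  { intros n. unfold conv. rewrite Rmult_comm, <- sumZ_scal.
    apply sumZ_ext. intros k. unfold u. ring. }
  split.
  - eapply summableZ_ext; [exact E|exact F2].
  - rewrite <- (sumZ_ext _ _ E), F3. apply sumZ_ext. intros k.
    unfold u. rewrite sumZ_scal. f_equal. apply Hin.
Qed.

Lemma conv_summable (a b : Z -> R) : summableZ a -> summableZ b -> summableZ (conv a b).
Proof.
  intros Ha Hb.
  destruct (conv_test a b (fun _ => 1) 1 Ha Hb) as [H _].
  - intros; rewrite Rabs_R1; lra.
  - eapply summableZ_ext; [|exact H]. intros; simpl; ring.
Qed.

Lemma sumZ_conv (a b : Z -> R) :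
  summableZ a -> summableZ b -> sumZ (conv a b) = sumZ a * sumZ b.
Proof.
  intros Ha Hb.
  destruct (conv_test a b (fun _ => 1) 1 Ha Hb) as [_ H].
  - intros; rewrite Rabs_R1; lra.
  - rewrite (sumZ_ext (conv a b) (fun n => conv a b n * 1)) by (intros; ring).
    rewrite H, Rmult_comm, <- sumZ_scal. apply sumZ_ext. intros k.
    rewrite Rmult_comm. f_equal. apply sumZ_ext. intros; ring.
Qed.

Lemma summable_conv_integrand (a b : Z -> R) (n : Z) :
  summableZ a -> summableZ b -> summableZ (fun k => a k * b (n - k)%Z).
Proof.
  intros Ha Hb. apply (summableZ_mult_bounded _ _ (l1norm b) Ha).
  intros; now apply term_le_l1norm.
Qed.

Lemma conv_nonneg (a b : Z -> R) : summableZ a -> summableZ b ->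
  (forall n, 0 <= a n) -> (forall n, 0 <= b n) -> forall n, 0 <= conv a b n.
Proof.
  intros Ha Hb A0 B0 n. apply sumZ_nonneg.
  - intros; now apply Rmult_le_pos.
  - now apply summable_conv_integrand.
Qed.

Lemma l1norm_conv (a b : Z -> R) :
  summableZ a -> summableZ b -> l1norm (conv a b) <= l1norm a * l1norm b.
Proof.
  intros Ha Hb. unfold l1norm at 2 3.
  rewrite <- sumZ_conv by now apply summableZ_abs.
  apply sumZ_le.
  - intros n. eapply Rle_trans; [apply sumZ_abs_le; now apply summable_conv_integrand|].
    right. apply sumZ_ext. intros; apply Rabs_mult.
  - apply summableZ_abs. now apply conv_summable.
  - apply conv_summable; now apply summableZ_abs.
Qed.

Lemma conv_comm (a b : Z -> R) : summableZ a -> summableZ b -> conv a b = conv b a.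
Proof.
  intros Ha Hb. extensionality n. unfold conv.
  destruct (sumZ_reflect _ n (summable_conv_integrand a b n Ha Hb)) as [_ E].
  rewrite <- E. apply sumZ_ext. intros k. rewrite Rmult_comm. do 2 f_equal. lia.
Qed.

Lemma conv_assoc (a b c : Z -> R) : summableZ a -> summableZ b -> summableZ c ->
  conv (conv a b) c = conv a (conv b c).
Proof.
  intros Ha Hb Hc. extensionality m.
  destruct (conv_test a b (fun n => c (m - n)%Z) (l1norm c) Ha Hb) as [_ E].
  - intros; now apply term_le_l1norm.
  - unfold conv at 1. rewrite E. unfold conv. apply sumZ_ext. intros k. f_equal.
    apply sumZ_ext. intros j. do 2 f_equal. lia.
Qed.

Lemma conv_plus_l (a b c : Z -> R) : summableZ a -> summableZ b -> summableZ c ->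
  conv (fun n => a n + b n) c = (fun n => conv a c n + conv b c n).
Proof.
  intros Ha Hb Hc. extensionality n. unfold conv.
  rewrite <- sumZ_plus by now apply summable_conv_integrand.
  apply sumZ_ext; intros; ring.
Qed.

Lemma conv_minus_l (a b c : Z -> R) : summableZ a -> summableZ b -> summableZ c ->
  conv (fun n => a n - b n) c = (fun n => conv a c n - conv b c n).
Proof.
  intros Ha Hb Hc. extensionality n. unfold conv.
  rewrite <- sumZ_minus by now apply summable_conv_integrand.
  apply sumZ_ext; intros; ring.
Qed.

Lemma conv_minus_r (a b c : Z -> R) : summableZ a -> summableZ b -> summableZ c ->
  conv c (fun n => a n - b n) = (fun n => conv c a n - conv c b n).
Proof.
  intros Ha Hb Hc. extensionality n. unfold conv.
  rewrite <- sumZ_minus by now apply summable_conv_integrand.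
  apply sumZ_ext; intros; ring.
Qed.

Lemma conv_plus_r (a b c : Z -> R) : summableZ a -> summableZ b -> summableZ c ->
  conv c (fun n => a n + b n) = (fun n => conv c a n + conv c b n).
Proof.
  intros Ha Hb Hc. extensionality n. unfold conv.
  rewrite <- sumZ_plus by now apply summable_conv_integrand.
  apply sumZ_ext; intros; ring.
Qed.

Lemma conv_scal_l (c : R) (a b : Z -> R) :
  conv (fun n => c * a n) b = (fun n => c * conv a b n).
Proof.
  extensionality n. unfold conv.
  rewrite <- sumZ_scal. apply sumZ_ext; intros; ring.
Qed.

Lemma conv_scal_r (c : R) (a b : Z -> R) :
  conv a (fun n => c * b n) = (fun n => c * conv a b n).
Proof.
  extensionality n. unfold conv.
  rewrite <- sumZ_scal. apply sumZ_ext; intros; ring.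
Qed.

Lemma sumZ_single (m : Z) (c : R) :
  summableZ (fun n => if Z.eq_dec n m then c else 0) /\
  sumZ (fun n => if Z.eq_dec n m then c else 0) = c.
Proof.
  set (d := fun n : Z => if Z.eq_dec n 0 then c else 0).
  assert (Hr : is_series (fun n => d (Z.of_nat n)) c).
  { apply (is_series_decr_1 (fun n => d (Z.of_nat n))).
    match goal with |- is_series _ ?l => replace l with 0 end.
    - apply Series_zero. intros n. unfold d. destruct (Z.eq_dec _ _); [lia|auto].
    - unfold d, plus, opp; simpl. ring. }
  assert (Hl : forall n, d (- Z.of_nat (S n))%Z = 0).
  { intros n. unfold d. destruct (Z.eq_dec _ _); [lia|auto]. }
  assert (Hd : summableZ d /\ sumZ d = c).
  { split; [split|].
    - apply (proj2 (ex_series_incr_1 (fun n => Rabs (d (Z.of_nat n))))).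
      exists 0. apply Series_zero. intros n. unfold d.
      destruct (Z.eq_dec _ _); [lia|apply Rabs_R0].
    - exists 0. apply Series_zero. intros n. rewrite Hl. apply Rabs_R0.
    - unfold sumZ. rewrite (is_series_unique _ _ Hr), (Series_0 _ Hl). ring. }
  destruct Hd as [D1 D2]. destruct (sumZ_shift d (- m) D1) as [S1 S2].
  replace (fun n => if Z.eq_dec n m then c else 0) with (fun n => d (n + - m)%Z).
  - split; auto. now rewrite S2.
  - extensionality n. unfold d.
    destruct (Z.eq_dec (n + - m) 0), (Z.eq_dec n m); auto; lia.
Qed.

Lemma dirac0_summable : summableZ dirac0.
Proof. apply sumZ_single. Qed.

Lemma dirac0_minus_summable (a : Z -> R) : summableZ a ->
  summableZ (fun n => dirac0 n - a n).
Proof. intros Ha. apply summableZ_minus; auto using dirac0_summable. Qed.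

Lemma sumZ_dirac0 : sumZ dirac0 = 1.
Proof. apply sumZ_single. Qed.

Lemma dirac0_nonneg (n : Z) : 0 <= dirac0 n.
Proof. unfold dirac0. destruct (Z.eq_dec n 0); lra. Qed.

Lemma conv_dirac0_l (a : Z -> R) : conv dirac0 a = a.
Proof.
  extensionality n. unfold conv.
  transitivity (sumZ (fun k => if Z.eq_dec k 0 then a n else 0));
    [|apply sumZ_single]. apply sumZ_ext. intros k.
  unfold dirac0. destruct (Z.eq_dec k 0) as [->|_]; [rewrite Z.sub_0_r; ring|ring].
Qed.

Lemma conv_dirac0_r (a : Z -> R) : summableZ a -> conv a dirac0 = a.
Proof.
  intros Ha. rewrite conv_comm; auto using dirac0_summable. apply conv_dirac0_l.
Qed.

Lemma is_prob_conv (a b : Z -> R) : is_prob a -> is_prob b -> is_prob (conv a b).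
Proof.
  intros [A0 [A1 A2]] [B0 [B1 B2]]. split; [|split].
  - now apply conv_nonneg.
  - now apply conv_summable.
  - rewrite sumZ_conv, A2, B2 by auto. ring.
Qed.

Lemma is_prob_mix (a b : Z -> R) (s : R) : 0 <= s <= 1 -> is_prob a -> is_prob b ->
  is_prob (fun n => s * a n + (1 - s) * b n).
Proof.
  intros Hs [A0 [A1 A2]] [B0 [B1 B2]]. split; [|split].
  - intros n. apply Rplus_le_le_0_compat; apply Rmult_le_pos; auto; lra.
  - apply summableZ_plus; now apply summableZ_scal.
  - rewrite sumZ_plus, !sumZ_scal, A2, B2 by now apply summableZ_scal. ring.
Qed.

Lemma l1norm_prob (a : Z -> R) : is_prob a -> l1norm a = 1.
Proof. intros [A0 [A1 A2]]. now rewrite l1norm_of_nonneg. Qed.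

(** * Powers of convolution operators and the Ritt property *)

Lemma iter_conv_summable (a d : Z -> R) (n : nat) :
  summableZ a -> summableZ d -> summableZ (Nat.iter n (conv a) d).
Proof. intros Ha Hd; induction n; simpl; auto. now apply conv_summable. Qed.

Lemma iter_conv_comm (a b d : Z -> R) (n : nat) :
  summableZ a -> summableZ b -> summableZ d ->
  conv b (Nat.iter n (conv a) d) = Nat.iter n (conv a) (conv b d).
Proof.
  intros Ha Hb Hd; induction n as [|n IH]; simpl; auto.
  rewrite <- IH, <- !conv_assoc by auto using iter_conv_summable.
  now rewrite (conv_comm b a).
Qed.

Lemma iter_conv_minus (a d e : Z -> R) (n : nat) :
  summableZ a -> summableZ d -> summableZ e ->
  Nat.iter n (conv a) (fun k => d k - e k)
  = (fun k => Nat.iter n (conv a) d k - Nat.iter n (conv a) e k).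
Proof.
  intros Ha Hd He; induction n as [|n IH]; simpl; auto.
  rewrite IH. apply conv_minus_r; auto using iter_conv_summable.
Qed.

Lemma l1norm_iter_conv (a d : Z -> R) (q : R) (n : nat) :
  summableZ a -> summableZ d -> l1norm a <= q ->
  l1norm (Nat.iter n (conv a) d) <= q ^ n * l1norm d.
Proof.
  intros Ha Hd Hq; induction n as [|n IH]; simpl; [lra|].
  eapply Rle_trans; [apply l1norm_conv; auto using iter_conv_summable|].
  rewrite Rmult_assoc. apply Rmult_le_compat; auto using l1norm_nonneg, iter_conv_summable.
Qed.

Lemma conv_pow_diff (nu : Z -> R) (n : nat) : summableZ nu ->
  (fun k => conv_pow nu n k - conv_pow nu (S n) k)
  = Nat.iter n (conv nu) (fun k => dirac0 k - nu k).
Proof.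
  intros H. rewrite iter_conv_minus by auto using dirac0_summable.
  unfold conv_pow. rewrite Nat.iter_succ_r, conv_dirac0_r; auto.
Qed.

Lemma l1norm_diff_0 (a : Z -> R) : l1norm (fun k => a k - a k) = 0.
Proof.
  replace (fun k => a k - a k) with (fun k => 0 * dirac0 k)
    by (extensionality i; ring).
  rewrite l1norm_scal, Rabs_R0. ring.
Qed.

Lemma iter_conv_perturb (a b d : Z -> R) (n : nat) :
  summableZ a -> summableZ b -> summableZ d -> l1norm a <= 1 -> l1norm b <= 1 ->
  l1norm (fun k => Nat.iter n (conv a) d k - Nat.iter n (conv b) d k)
  <= INR n * l1norm (fun k => a k - b k) * l1norm d.
Proof.
  intros Ha Hb Hd Na Nb.
  assert (Hab : summableZ (fun k => a k - b k)) by now apply summableZ_minus.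
  induction n as [|n IH].
  - simpl. rewrite l1norm_diff_0. lra.
  - set (x := Nat.iter n (conv a) d). set (y := Nat.iter n (conv b) d).
    assert (Hx : summableZ x) by now apply iter_conv_summable.
    assert (Hy : summableZ y) by now apply iter_conv_summable.
    assert (Hxy : summableZ (fun k => x k - y k)) by now apply summableZ_minus.
    replace (fun k => Nat.iter (S n) (conv a) d k - Nat.iter (S n) (conv b) d k)
      with (fun k => conv a (fun k => x k - y k) k + conv (fun k => a k - b k) y k).
    2:{ rewrite conv_minus_r, conv_minus_l by auto.
        extensionality k. simpl. fold x y. ring. }
    eapply Rle_trans; [apply l1norm_plus; now apply conv_summable|].
    assert (E1 : l1norm (conv a (fun k => x k - y k)) <= l1norm (fun k => x k - y k)).
    { eapply Rle_trans; [now apply l1norm_conv|].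
      rewrite <- (Rmult_1_l (l1norm (fun k => x k - y k))) at 2.
      apply Rmult_le_compat_r; auto. now apply l1norm_nonneg. }
    assert (E2 : l1norm (conv (fun k => a k - b k) y)
                 <= l1norm (fun k => a k - b k) * l1norm d).
    { eapply Rle_trans; [now apply l1norm_conv|].
      apply Rmult_le_compat_l; [now apply l1norm_nonneg|].
      eapply Rle_trans; [apply (l1norm_iter_conv b d 1 n); auto|].
      rewrite pow1. lra. }
    rewrite S_INR. fold x y in IH. lra.
Qed.

Lemma layer_step (a b v d : Z -> R) (p w : R) (n : nat) :
  summableZ a -> summableZ v -> summableZ d ->
  b = (fun k => a k + w * v k) -> 0 <= w -> l1norm a <= p -> l1norm b <= p + w ->
  l1norm (fun k => Nat.iter n (conv b) d k - Nat.iter n (conv a) d k)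
  <= ((p + w) ^ n - p ^ n) * l1norm (conv v d).
Proof.
  intros Ha Hv Hd Eb Hw Na Nb.
  assert (Hp : 0 <= p) by (eapply Rle_trans; [apply (l1norm_nonneg a Ha)|exact Na]).
  assert (Hwv : summableZ (fun k => w * v k)) by now apply summableZ_scal.
  assert (Hb : summableZ b) by (rewrite Eb; now apply summableZ_plus).
  induction n as [|n IH].
  - simpl. rewrite l1norm_diff_0. lra.
  - set (x := Nat.iter n (conv b) d). set (y := Nat.iter n (conv a) d).
    assert (Hx : summableZ x) by now apply iter_conv_summable.
    assert (Hy : summableZ y) by now apply iter_conv_summable.
    assert (Hxy : summableZ (fun k => x k - y k)) by now apply summableZ_minus.
    assert (Hvd : summableZ (conv v d)) by now apply conv_summable.
    replace (fun k => Nat.iter (S n) (conv b) d k - Nat.iter (S n) (conv a) d k)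
      with (fun k => conv b (fun k => x k - y k) k + w * conv v y k).
    2:{ rewrite conv_minus_r by auto.
        extensionality k. simpl. fold x y.
        rewrite Eb, !conv_plus_l, !conv_scal_l by auto. ring. }
    eapply Rle_trans; [apply l1norm_plus; [|apply summableZ_scal]; now apply conv_summable|].
    assert (E1 : l1norm (conv b (fun k => x k - y k))
                 <= (p + w) * (((p + w) ^ n - p ^ n) * l1norm (conv v d))).
    { eapply Rle_trans; [now apply l1norm_conv|].
      apply Rmult_le_compat; auto; now apply l1norm_nonneg. }
    assert (E2 : l1norm (fun k => w * conv v y k) <= w * (p ^ n * l1norm (conv v d))).
    { rewrite l1norm_scal, Rabs_pos_eq by auto. apply Rmult_le_compat_l; auto.
      unfold y. rewrite iter_conv_comm by auto. now apply l1norm_iter_conv. }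
    simpl pow. lra.
Qed.

(** The graph of [x^(n+1)] lies above its tangent at [a]. *)
Lemma pow_tangent (a b : R) (n : nat) : 0 <= a -> 0 <= b ->
  INR (S n) * a ^ n * b <= b ^ S n + INR n * a ^ S n.
Proof.
  intros Ha Hb; induction n as [|n IH].
  - simpl. lra.
  - apply (Rmult_le_compat_r b) in IH; auto.
    assert (H : 0 <= INR (S n) * (a ^ n * (b - a) ^ 2)).
    { apply Rmult_le_pos; [apply pos_INR|].
      apply Rmult_le_pos; [now apply pow_le|apply pow2_ge_0]. }
    rewrite !S_INR in *. simpl pow in *. lra.
Qed.

(** Comparison with the integral of [n s^(n-1) (1 - s)] between [a] and [b],
    whose primitive is [s^n - n/(n+1) s^(n+1)]. *)
Lemma pow_integral (a b : R) (n : nat) : 0 <= a -> 0 <= b ->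
  (b ^ n - a ^ n) * (1 - b)
  <= (b ^ n - INR n / INR (S n) * b ^ S n) - (a ^ n - INR n / INR (S n) * a ^ S n).
Proof.
  intros Ha Hb. pose proof (pow_tangent a b n Ha Hb) as H.
  pose proof (pos_INR n) as Hn. rewrite S_INR in *.
  apply Rmult_le_reg_l with (INR n + 1); [lra|].
  replace ((INR n + 1) * (b ^ n - INR n / (INR n + 1) * b ^ S n -
      (a ^ n - INR n / (INR n + 1) * a ^ S n)))
    with ((INR n + 1) * (b ^ n - a ^ n) - INR n * (b ^ S n - a ^ S n)) by (field; lra).
  simpl pow in *. lra.
Qed.

Lemma mult_pow_bound (q : R) (n : nat) : 0 <= q < 1 -> INR n * q ^ n <= / (1 - q).
Proof.
  intros Hq.
  assert (H : INR n * q ^ n * (1 - q) <= 1 - q ^ n).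
  { induction n as [|n IH]; [simpl; lra|].
    assert (Hp : 0 <= q ^ n) by (apply pow_le; lra).
    assert (Hp1 : q ^ n <= 1).
    { rewrite <- (pow1 n). apply pow_incr. lra. }
    apply (Rmult_le_compat_r q) in IH; [|lra].
    assert (H0 : 0 <= (1 - q) * (1 - q * q ^ n)) by (apply Rmult_le_pos; nra).
    rewrite S_INR. simpl pow. lra. }
  assert (Hp : 0 <= q ^ n) by (apply pow_le; lra).
  apply Rmult_le_reg_r with (1 - q); [lra|]. rewrite Rinv_l by lra. lra.
Qed.

(** A convolution power of the limit of the [B L] is a telescopic sum of the differences
    between the powers of [B (S L)] and [B L]. Such a difference contains a factor [V L],
    so that applied to [dirac0 - nu] it has norm at most a multiple of
    [(q (S L) ^ n - q L ^ n) * (1 - q (S L))], and these add up to at most the integral of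
    [n s^(n-1) (1 - s)] over [0, 1], which is [1 / (n + 1)]. In probabilistic terms, the
    smoothness comes from the widest of the n layers drawn independently, and the
    expected mass beyond the maximum of n independent draws is at most [1 / (n + 1)]. *)
Lemma Ritt_of_layers (nu : Z -> R) (B V : nat -> Z -> R) (q w : nat -> R) (K : R) :
  is_prob nu -> 0 <= K ->
  (forall L, summableZ (B L)) -> (forall L, l1norm (B L) <= q L) ->
  (forall L, q L <= 1) -> q 0%nat < 1 ->
  (forall L, summableZ (V L)) -> (forall L, 0 <= w L) ->
  (forall L, B (S L) = fun n => B L n + w L * V L n) ->
  (forall L, q (S L) = q L + w L) ->
  (forall L, l1norm (conv (V L) (fun k => dirac0 k - nu k)) <= K * (1 - q (S L))) ->
  is_lim_seq (fun L => l1norm (fun k => nu k - B L k)) 0 ->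
  Ritt nu.
Proof.
  intros Hnu HK HB Nq Hq1 Hq0 HV Hw EB Eq HVd Hlim.
  pose proof (l1norm_prob nu Hnu) as Nnu.
  destruct Hnu as [_ [Hnu _]].
  set (d := fun k => dirac0 k - nu k).
  assert (Hd : summableZ d) by now apply dirac0_minus_summable.
  assert (Nd : l1norm d <= 2).
  { eapply Rle_trans; [apply l1norm_minus; auto using dirac0_summable|].
    rewrite Nnu, l1norm_of_nonneg, sumZ_dirac0 by apply dirac0_nonneg. lra. }
  assert (Hq : forall L, 0 <= q L).
  { intros L. eapply Rle_trans; [|apply Nq]. apply l1norm_nonneg, HB. }
  assert (HL : forall n L, l1norm (Nat.iter n (conv (B L)) d)
    <= 2 * q 0%nat ^ n + K * ((q L ^ n - INR n / INR (S n) * q L ^ S n)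
         - (q 0%nat ^ n - INR n / INR (S n) * q 0%nat ^ S n))).
  { intros n L; induction L as [|L IH].
    - eapply Rle_trans; [now apply (l1norm_iter_conv _ d (q 0%nat))|].
      pose proof (pow_le _ n (Hq 0%nat)). nra.
    - set (y := Nat.iter n (conv (B L)) d) in *.
      set (x := Nat.iter n (conv (B (S L))) d).
      assert (Hx : summableZ x) by now apply iter_conv_summable.
      assert (Hy : summableZ y) by now apply iter_conv_summable.
      replace x with (fun k => y k + (x k - y k))
        by (extensionality i; ring).
      eapply Rle_trans; [apply l1norm_plus; auto; now apply summableZ_minus|].
      assert (Hs : l1norm (fun k => x k - y k)
                   <= (q (S L) ^ n - q L ^ n) * l1norm (conv (V L) d)).
      { rewrite Eq. apply layer_step; auto. rewrite <- Eq. apply Nq. }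
      assert (Hmono : 0 <= q (S L) ^ n - q L ^ n).
      { enough (q L ^ n <= q (S L) ^ n) by lra. apply pow_incr.
        split; auto. rewrite Eq. specialize (Hw L). lra. }
      pose proof (Rmult_le_compat_l _ _ _ Hmono (HVd L)) as H1. fold d in H1.
      pose proof (Rmult_le_compat_l K _ _ HK
        (pow_integral (q L) (q (S L)) n (Hq L) (Hq (S L)))) as H2.
      lra. }
  assert (Hfin : forall n, l1norm (Nat.iter n (conv nu) d)
                 <= 2 * q 0%nat ^ n + K / INR (S n)).
  { intros n.
    assert (HLim : is_lim_seq (fun L => 2 * q 0%nat ^ n + K / INR (S n)
        + 2 * INR n * l1norm (fun k => nu k - B L k)) (2 * q 0%nat ^ n + K / INR (S n))).
    { replace (Finite (2 * q 0%nat ^ n + K / INR (S n))) with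
        (Finite (2 * q 0%nat ^ n + K / INR (S n) + 2 * INR n * 0)) by (f_equal; ring).
      apply is_lim_seq_plus'; [apply is_lim_seq_const|].
      apply (is_lim_seq_scal_l _ (2 * INR n) 0). exact Hlim. }
    refine (is_lim_seq_le (fun _ => l1norm (Nat.iter n (conv nu) d)) _ _ _ _
      (is_lim_seq_const _) HLim).
    intros L.
    set (x := Nat.iter n (conv nu) d). set (y := Nat.iter n (conv (B L)) d).
    assert (Hx : summableZ x) by now apply iter_conv_summable.
    assert (Hy : summableZ y) by now apply iter_conv_summable.
    replace x with (fun k => y k + (x k - y k))
      by (extensionality i; ring).
    eapply Rle_trans; [apply l1norm_plus; auto; now apply summableZ_minus|].
    assert (Hp : l1norm (fun k => x k - y k)
        <= INR n * l1norm (fun k => nu k - B L k) * l1norm d).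
    { apply iter_conv_perturb; auto; [lra|].
      eapply Rle_trans; [apply Nq|apply Hq1]. }
    assert (Hs : 0 <= INR n * l1norm (fun k => nu k - B L k)).
    { apply Rmult_le_pos; [apply pos_INR|]. apply l1norm_nonneg.
      now apply summableZ_minus. }
    pose proof (Rmult_le_compat_l _ _ _ Hs Nd) as Hs2.
    (* At b = 1 the comparison says that the primitive is largest there on [0, 1]. *)
    pose proof (pow_integral (q L) 1 n (Hq L) Rle_0_1) as HG1.
    pose proof (pow_integral 0 (q 0%nat) n (Rle_refl 0) (Hq 0%nat)) as HG0.
    assert (HG : (q L ^ n - INR n / INR (S n) * q L ^ S n)
         - (q 0%nat ^ n - INR n / INR (S n) * q 0%nat ^ S n) <= 1 / INR (S n)).
    { assert (Hn1 : 0 <= q 0%nat ^ n - INR n / INR (S n) * q 0%nat ^ S n).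
      { pose proof (pow_le _ n (Hq 0%nat)) as Hpn. pose proof (Hq1 0%nat).
        pose proof (Hq 0%nat). pose proof (pos_INR n).
        assert (INR n / INR (S n) <= 1).
        { rewrite S_INR. apply Rmult_le_reg_r with (INR n + 1); [lra|].
          unfold Rdiv. rewrite Rmult_assoc, Rinv_l by lra. lra. }
        assert (0 <= INR n / INR (S n)).
        { apply Rle_div_r; [rewrite S_INR; lra|]. lra. }
        simpl pow. assert (q 0%nat * q 0%nat ^ n <= q 0%nat ^ n) by nra.
        assert (0 <= q 0%nat * q 0%nat ^ n) by nra. nra. }
      assert (E1 : 1 ^ n - INR n / INR (S n) * 1 ^ S n = 1 / INR (S n)).
      { rewrite !pow1, S_INR. pose proof (pos_INR n). field. lra. }
      rewrite E1 in HG1. lra. }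
    apply (Rmult_le_compat_l K) in HG; auto.
    pose proof (HL n L) as HLn. fold y in HLn.
    replace (K * (1 / INR (S n))) with (K / INR (S n)) in HG
      by (unfold Rdiv; ring). lra. }
  exists (2 * / (1 - q 0%nat) + K). intros n _.
  rewrite conv_pow_diff by auto. fold d.
  eapply Rle_trans; [apply Rmult_le_compat_l; [apply pos_INR|apply Hfin]|].
  pose proof (mult_pow_bound (q 0%nat) n (conj (Hq 0%nat) Hq0)).
  assert (INR n * (K / INR (S n)) <= K).
  { rewrite S_INR. pose proof (pos_INR n).
    replace (INR n * (K / (INR n + 1))) with (K * (INR n / (INR n + 1))) by (field; lra).
    rewrite <- (Rmult_1_r K) at 2. apply Rmult_le_compat_l; auto.
    apply Rmult_le_reg_r with (INR n + 1); [lra|].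
    unfold Rdiv. rewrite Rmult_assoc, Rinv_l by lra. lra. }
  lra.
Qed.

(** * Smoothing by uniform laws *)

Lemma conv_dirac0_minus (a nu : Z -> R) : summableZ a -> is_prob nu ->
  l1norm (conv a (fun k => dirac0 k - nu k))
  <= sumZ (fun k => nu k * l1norm (fun n => a n - a (n - k)%Z)) /\
  summableZ (fun k => nu k * l1norm (fun n => a n - a (n - k)%Z)).
Proof.
  intros Ha [N0 [N1 N2]].
  assert (Hs : forall k, summableZ (fun n => a (n - k)%Z)) by
    (intros k; exact (proj1 (sumZ_shift a (- k) Ha))).
  assert (Hd : forall k, summableZ (fun n => a n - a (n - k)%Z))
    by (intros; now apply summableZ_minus).
  assert (Hd2 : forall k, l1norm (fun n => a n - a (n - k)%Z) <= 2 * l1norm a).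
  { intros k. eapply Rle_trans; [now apply l1norm_minus|].
    replace (l1norm (fun n => a (n - k)%Z)) with (l1norm a); [lra|].
    symmetry. exact (proj2 (sumZ_shift (fun n => Rabs (a n)) (- k) (summableZ_abs a Ha))). }
  assert (Hsum : summableZ (fun k => nu k * l1norm (fun n => a n - a (n - k)%Z))).
  { apply (summableZ_mult_bounded _ _ (2 * l1norm a)); auto.
    intros k. rewrite Rabs_pos_eq; auto. now apply l1norm_nonneg. }
  split; [|exact Hsum].
  set (u := fun k n => nu k * Rabs (a n - a (n - k)%Z)).
  destruct (Tonelli_Z u) as [T1 [T2 T3]].
  - intros k n. apply Rmult_le_pos; auto. apply Rabs_pos.
  - intros k. apply summableZ_scal. now apply summableZ_abs.
  - eapply summableZ_ext; [|exact Hsum]. intros k. unfold u. now rewrite sumZ_scal.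
  - rewrite (sumZ_ext (fun k => nu k * l1norm (fun n => a n - a (n - k)%Z))
      (fun k => sumZ (u k))) by (intros; unfold u; now rewrite sumZ_scal).
    rewrite <- T3. apply sumZ_le; auto.
    + intros n. rewrite conv_minus_r, conv_dirac0_r, (conv_comm a nu)
        by auto using dirac0_summable.
      replace (a n - conv nu a n) with (sumZ (fun k => nu k * (a n - a (n - k)%Z))).
      * assert (Hn : summableZ (fun k => nu k * (a n - a (n - k)%Z))).
        { eapply summableZ_ext; [|apply (summableZ_minus _ _ (summableZ_scal (a n) _ N1)
            (summable_conv_integrand nu a n N1 Ha))]. intros; simpl; ring. }
        eapply Rle_trans; [now apply sumZ_abs_le|]. right. apply sumZ_ext. intros k.
        unfold u. rewrite Rabs_mult, (Rabs_pos_eq (nu k)); auto.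
      * rewrite (sumZ_ext _ (fun k => a n * nu k - nu k * a (n - k)%Z))
          by (intros; ring).
        rewrite sumZ_minus, sumZ_scal, N2; [unfold conv; ring| |].
        -- now apply summableZ_scal.
        -- now apply summable_conv_integrand.
    + apply summableZ_abs. apply conv_summable; auto.
      apply summableZ_minus; auto using dirac0_summable.
Qed.

Lemma translate_diff (a : Z -> R) (k : Z) : summableZ a ->
  l1norm (fun n => a n - a (n - k)%Z)
  <= IZR (Z.abs k) * l1norm (fun n => a n - a (n - 1)%Z).
Proof.
  intros Ha.
  assert (Hs : forall k, summableZ (fun n => a (n - k)%Z)) by
    (intros j; exact (proj1 (sumZ_shift a (- j) Ha))).
  assert (Hd : forall k, summableZ (fun n => a n - a (n - k)%Z))
    by (intros; now apply summableZ_minus).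
  assert (Hnat : forall m, l1norm (fun n => a n - a (n - Z.of_nat m)%Z)
    <= INR m * l1norm (fun n => a n - a (n - 1)%Z)).
  { induction m as [|m IH].
    - replace (fun n => a n - a (n - Z.of_nat 0)%Z) with (fun n => a n - a n).
      + rewrite l1norm_diff_0. simpl; lra.
      + apply functional_extensionality; intros. do 2 f_equal. simpl. lia.
    - rewrite S_INR.
      set (e := fun n => a n - a (n - 1)%Z) in *.
      assert (He : summableZ e) by apply Hd.
      destruct (sumZ_shift (fun n => Rabs (e n)) (- Z.of_nat m) (summableZ_abs e He))
        as [S1 S2].
      replace (fun n => a n - a (n - Z.of_nat (S m))%Z) with
        (fun n => (a n - a (n - Z.of_nat m)%Z) + e (n + - Z.of_nat m)%Z).
      + eapply Rle_trans; [apply l1norm_plus; auto; apply (proj1 (sumZ_shift e _ He))|].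
        replace (l1norm (fun n => e (n + - Z.of_nat m)%Z)) with (l1norm e)
          by (symmetry; exact S2). lra.
      + extensionality n. unfold e.
        replace (n - Z.of_nat (S m))%Z with (n + - Z.of_nat m - 1)%Z by lia.
        replace (n - Z.of_nat m)%Z with (n + - Z.of_nat m)%Z by lia. ring. }
  destruct (Z_le_gt_dec 0 k) as [Hk|Hk].
  - rewrite Z.abs_eq by auto.
    specialize (Hnat (Z.to_nat k)). rewrite INR_IZR_INZ, Z2Nat.id in Hnat by lia.
    exact Hnat.
  - rewrite Z.abs_neq by lia.
    specialize (Hnat (Z.to_nat (- k))). rewrite INR_IZR_INZ, Z2Nat.id in Hnat by lia.
    eapply Rle_trans; [|exact Hnat]. right.
    destruct (sumZ_shift (fun n => Rabs (a n - a (n - - k)%Z)) (- k)) as [_ E].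
    + apply summableZ_abs. apply Hd.
    + unfold l1norm. rewrite <- E. apply sumZ_ext. intros n.
      rewrite Rabs_minus_sym. f_equal. f_equal; f_equal; lia.
Qed.

Definition unif (L : nat) : Z -> R :=
  fun n => if Z_le_dec 0 n then if Z_le_dec n (Z.of_nat L) then / INR (S L) else 0 else 0.

Lemma unif_prob (L : nat) : is_prob (unif L).
Proof.
  assert (HL : 0 < / INR (S L)) by (apply Rinv_0_lt_compat, lt_0_INR; lia).
  assert (H : forall c m,
    summableZ (fun n => if Z_le_dec 0 n then if Z_le_dec n (Z.of_nat m) then c else 0 else 0)
    /\ sumZ (fun n => if Z_le_dec 0 n then if Z_le_dec n (Z.of_nat m) then c else 0 else 0)
       = INR (S m) * c).
  { intros c; induction m as [|m [I1 I2]].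
    - destruct (sumZ_single 0 c) as [S1 S2].
      replace (fun n => if Z_le_dec 0 n then if Z_le_dec n (Z.of_nat 0) then c else 0 else 0)
        with (fun n => if Z.eq_dec n 0 then c else 0).
      + split; auto. rewrite S2. simpl; ring.
      + extensionality n. simpl Z.of_nat.
        destruct (Z.eq_dec n 0), (Z_le_dec 0 n), (Z_le_dec n 0); auto; lia.
    - destruct (sumZ_single (Z.of_nat (S m)) c) as [S1 S2].
      match goal with |- summableZ ?f /\ _ => replace f with (fun n =>
        (if Z_le_dec 0 n then if Z_le_dec n (Z.of_nat m) then c else 0 else 0)
        + (if Z.eq_dec n (Z.of_nat (S m)) then c else 0)) end.
      + split; [now apply summableZ_plus|]. rewrite sumZ_plus, S2, I2 by auto.
        rewrite (S_INR (S m)). ring.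
      + extensionality n.
        destruct (Z_le_dec 0 n), (Z_le_dec n (Z.of_nat m)),
          (Z_le_dec n (Z.of_nat (S m))), (Z.eq_dec n (Z.of_nat (S m))); try lia; ring. }
  destruct (H (/ INR (S L)) L) as [H1 H2]. split; [|split].
  - intros n. unfold unif. destruct (Z_le_dec 0 n), (Z_le_dec n (Z.of_nat L)); lra.
  - exact H1.
  - unfold unif. rewrite H2. apply Rinv_r. apply not_0_INR. lia.
Qed.

Lemma unif_translate (L : nat) :
  l1norm (fun n => unif L n - unif L (n - 1)%Z) <= 2 / INR (S L).
Proof.
  set (c := / INR (S L)).
  assert (Hc : 0 < c) by (apply Rinv_0_lt_compat, lt_0_INR; lia).
  replace (fun n => unif L n - unif L (n - 1)%Z) with
    (fun n => (if Z.eq_dec n 0 then c else 0)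
              - (if Z.eq_dec n (Z.of_nat (S L)) then c else 0)).
  - eapply Rle_trans; [apply l1norm_minus; apply sumZ_single|].
    rewrite !l1norm_of_nonneg, !(proj2 (sumZ_single _ c)).
    + unfold Rdiv. fold c. lra.
    + intros n; destruct (Z.eq_dec _ _); lra.
    + intros n; destruct (Z.eq_dec _ _); lra.
  - extensionality n. unfold unif. fold c.
    destruct (Z.eq_dec n 0), (Z.eq_dec n (Z.of_nat (S L))), (Z_le_dec 0 n),
      (Z_le_dec n (Z.of_nat L)), (Z_le_dec 0 (n - 1)), (Z_le_dec (n - 1) (Z.of_nat L));
      try lia; ring.
Qed.

(** A translation by [k] moves a uniform law by at most [|k|] unit translations, each of
    which changes only its two ends. *)
Lemma unif_smoothing (L : nat) (nu : Z -> R) : is_prob nu ->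
  l1norm (conv (unif L) (fun k => dirac0 k - nu k))
  <= sumZ (fun k => nu k * Rmin (IZR (Z.abs k) * (2 / INR (S L))) 2).
Proof.
  intros Hnu. destruct (unif_prob L) as [U0 [U1 U2]].
  destruct (conv_dirac0_minus (unif L) nu U1 Hnu) as [H1 H2].
  pose proof (l1norm_prob _ (unif_prob L)) as NU.
  destruct Hnu as [N0 [N1 N2]].
  assert (HL : 0 < / INR (S L)) by (apply Rinv_0_lt_compat, lt_0_INR; lia).
  eapply Rle_trans; [exact H1|]. apply sumZ_le; auto.
  - intros k. apply Rmult_le_compat_l; auto. apply Rmin_glb.
    + eapply Rle_trans; [now apply translate_diff|].
      apply Rmult_le_compat_l; [apply IZR_le; lia|apply unif_translate].
    + eapply Rle_trans; [apply l1norm_minus; auto|].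
      * apply (proj1 (sumZ_shift _ (- k) U1)).
      * replace (l1norm (fun n => unif L (n - k)%Z)) with (l1norm (unif L)); [lra|].
        symmetry. exact (proj2 (sumZ_shift (fun n => Rabs (unif L n)) (- k)
          (summableZ_abs _ U1))).
  - apply (summableZ_mult_bounded _ _ 2); auto. intros k.
    rewrite Rabs_pos_eq; [apply Rmin_r|]. apply Rmin_glb; [|lra].
    apply Rmult_le_pos; [apply IZR_le; lia|unfold Rdiv; lra].
Qed.

(** * Decreasing laws on the natural numbers *)

Lemma sumZ_half (a : Z -> R) : (forall n, a (- Z.of_nat (S n))%Z = 0) ->
  sumZ a = Series (fun n => a (Z.of_nat n)).
Proof. intros H. unfold sumZ. rewrite (Series_0 _ H). ring. Qed.

Lemma summableZ_half (a : Z -> R) : (forall n, a (- Z.of_nat (S n))%Z = 0) ->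
  ex_series (fun n => Rabs (a (Z.of_nat n))) -> summableZ a.
Proof.
  intros H Ha. split; auto. exists 0. apply Series_zero.
  intros n. rewrite H. apply Rabs_R0.
Qed.

Definition ext (v : nat -> R) : Z -> R :=
  fun n => if Z_lt_dec n 0 then 0 else v (Z.to_nat n).

Lemma ext_nat (v : nat -> R) (n : nat) : ext v (Z.of_nat n) = v n.
Proof. unfold ext. destruct (Z_lt_dec _ _); [lia|]. now rewrite Nat2Z.id. Qed.

Lemma ext_neg (v : nat -> R) (n : nat) : ext v (- Z.of_nat (S n)) = 0.
Proof. unfold ext. destruct (Z_lt_dec _ _); [auto|lia]. Qed.

Lemma ext_supported (mu : Z -> R) : supported_on_N mu ->
  mu = ext (fun n => mu (Z.of_nat n)).
Proof.
  intros H. extensionality n. unfold ext.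
  destruct (Z_lt_dec n 0); [now apply H|]. now rewrite Z2Nat.id by lia.
Qed.

Lemma ext_summable (v : nat -> R) :
  ex_series (fun n => Rabs (v n)) -> summableZ (ext v).
Proof.
  intros H. apply summableZ_half; [apply ext_neg|].
  eapply ex_series_ext; [|exact H]. intros; simpl; now rewrite ext_nat.
Qed.

Lemma sumZ_ext_mult (v : nat -> R) (g : Z -> R) :
  sumZ (fun n => ext v n * g n) = Series (fun n => v n * g (Z.of_nat n)).
Proof.
  rewrite sumZ_half by (intros; rewrite ext_neg; ring).
  apply Series_ext. intros; now rewrite ext_nat.
Qed.

Lemma sumZ_ext_nat (v : nat -> R) : sumZ (ext v) = Series v.
Proof.
  rewrite sumZ_half by apply ext_neg. apply Series_ext. intros; now rewrite ext_nat.
Qed.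

Definition decreasing_law (t : nat -> R) : Prop :=
  (forall n, 0 <= t n) /\ ex_series t /\ Series t = 1 /\ (forall n, t (S n) <= t n).

Definition tail (t : nat -> R) (n : nat) : R := Series (fun k => t (n + k)%nat).

Definition truncated_mean (t : nat -> R) (n : nat) : R :=
  sum_n_m (fun k => INR k * t k) 1 n.

Definition tail_condition (t : nat -> R) (K : R) : Prop :=
  forall n, (1 <= n)%nat -> truncated_mean t n <= K * INR n * tail t n.

Lemma tail_nonneg (t : nat -> R) (n : nat) :
  (forall n, 0 <= t n) -> ex_series t -> 0 <= tail t n.
Proof.
  intros H0 H. apply Series_nonneg; auto. now apply (proj1 (ex_series_incr_n t n)).
Qed.

Lemma decreasing_le (t : nat -> R) (m n : nat) :
  (forall n, t (S n) <= t n) -> (m <= n)%nat -> t n <= t m.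
Proof. intros H Hmn. induction Hmn; [lra|]. eapply Rle_trans; [apply H|auto]. Qed.

Lemma sum_n_truncated_mean (t : nat -> R) (n : nat) :
  sum_n (fun k => INR k * t k) n = truncated_mean t n.
Proof.
  unfold truncated_mean, sum_n. rewrite sum_Sn_m by lia.
  change (INR 0 * t 0%nat + sum_n_m (fun k => INR k * t k) 1 n
    = sum_n_m (fun k => INR k * t k) 1 n). simpl INR. ring.
Qed.

(** Split at [n]: below it the first argument of the minimum is used, above it the second. *)
Lemma min_moment_le (t : nat -> R) (theta : R) (n : nat) :
  (forall n, 0 <= t n) -> ex_series t -> 0 <= theta -> (1 <= n)%nat ->
  ex_series (fun k => t k * Rmin (INR k * theta) 2) /\
  Series (fun k => t k * Rmin (INR k * theta) 2)
  <= theta * truncated_mean t n + 2 * tail t n.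
Proof.
  intros H0 H Hth Hn.
  assert (Hm : forall k, 0 <= t k * Rmin (INR k * theta) 2 <= 2 * t k).
  { intros k. pose proof (Rmin_r (INR k * theta) 2).
    assert (0 <= Rmin (INR k * theta) 2).
    { apply Rmin_glb; [|lra]. apply Rmult_le_pos; auto using pos_INR. }
    specialize (H0 k). split; nra. }
  assert (E : ex_series (fun k => t k * Rmin (INR k * theta) 2)).
  { apply (ex_series_dom _ (fun k => 2 * t k)); [|now apply ex_series_scalR].
    intros k. rewrite Rabs_pos_eq; apply Hm. }
  split; auto.
  rewrite (Series_incr_n _ n) by (auto; lia).
  rewrite <- sum_n_Reals. apply Rplus_le_compat.
  - rewrite <- sum_n_truncated_mean.
    assert (E1 : theta * sum_n (fun k => INR k * t k) n
            = sum_n (fun k => theta * (INR k * t k)) n).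
    { symmetry. apply (sum_n_mult_l theta (fun k => INR k * t k)). }
    rewrite E1. destruct n as [|n]; [lia|]. simpl pred.
    rewrite sum_n_Sn_R.
    assert (0 <= theta * (INR (S n) * t (S n))).
    { apply Rmult_le_pos; auto. apply Rmult_le_pos; auto using pos_INR. }
    enough (sum_n (fun k => t k * Rmin (INR k * theta) 2) n
      <= sum_n (fun k => theta * (INR k * t k)) n) by lra.
    apply sum_n_le. intros k _. pose proof (Rmin_l (INR k * theta) 2).
    specialize (H0 k). nra.
  - unfold tail. rewrite <- Series_scal_l. apply Series_mono.
    + intros k. apply Hm.
    + now apply (proj1 (ex_series_incr_n (fun k => t k * Rmin (INR k * theta) 2) n)).
    + apply ex_series_scalR. now apply (proj1 (ex_series_incr_n t n)).
Qed.

Lemma tail_lower (t : nat -> R) (K : R) (n : nat) :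
  (forall n, 0 <= t n) -> 0 < K -> tail_condition t K -> (1 <= n)%nat ->
  t 1%nat <= K * INR n * tail t n.
Proof.
  intros H0 HK HT Hn. eapply Rle_trans; [|now apply HT].
  rewrite <- sum_n_truncated_mean. destruct n as [|n]; [lia|].
  eapply Rle_trans; [|apply (sum_n_le (fun k => if Nat.eq_dec k 1 then t 1%nat else 0))].
  - clear Hn. induction n as [|n IH].
    + rewrite sum_n_Sn_R, sum_O. simpl. lra.
    + rewrite sum_n_Sn_R. destruct (Nat.eq_dec _ _); [specialize (H0 1%nat)|]; lra.
  - intros k _. destruct (Nat.eq_dec k 1) as [->|]; [simpl; lra|].
    apply Rmult_le_pos; auto using pos_INR.
Qed.

(** * The layers of a decreasing law *)

(** A decreasing law is the mixture of the uniform laws [unif L] with weights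
    [(L + 1) (t L - t (L + 1))]; this is the part coming from the first [L] of them. *)
Definition layers (t : nat -> R) (L : nat) : Z -> R := ext (fun k => Rmax (t k - t L) 0).

Definition layer_mass (t : nat -> R) (L : nat) : R := sumZ (layers t L).

Definition layer_weight (t : nat -> R) (L : nat) : R := INR (S L) * (t L - t (S L)).

Lemma layers_S (t : nat -> R) (L : nat) : (forall n, t (S n) <= t n) ->
  layers t (S L) = fun n => layers t L n + layer_weight t L * unif L n.
Proof.
  intros Hd. extensionality n.
  unfold layers, ext, layer_weight, unif.
  destruct (Z_lt_dec n 0) as [Hn|Hn], (Z_le_dec 0 n) as [Hn'|Hn']; try lia; [ring|].
  assert (HL : INR (S L) <> 0) by (apply not_0_INR; lia).
  pose proof (Hd L). destruct (Z_le_dec n (Z.of_nat L)) as [HnL|HnL].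
  - assert (t L <= t (Z.to_nat n)) by (apply decreasing_le; auto; lia).
    rewrite !Rmax_left by lra. field; auto.
  - assert (t (Z.to_nat n) <= t (S L)) by (apply decreasing_le; auto; lia).
    rewrite !Rmax_right by lra. ring.
Qed.

Lemma layers_bounds (t : nat -> R) (L k : nat) : (forall n, 0 <= t n) ->
  0 <= Rmax (t k - t L) 0 <= t k.
Proof.
  intros H0. pose proof (H0 k). pose proof (H0 L).
  split; [apply Rmax_r|apply Rmax_lub; lra].
Qed.

Lemma layers_ex_series (t : nat -> R) (L : nat) : (forall n, 0 <= t n) -> ex_series t ->
  ex_series (fun k => Rmax (t k - t L) 0).
Proof.
  intros H0 H. apply (ex_series_dom _ t); auto. intros k.
  rewrite Rabs_pos_eq; now apply layers_bounds.
Qed.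

Lemma layers_summable (t : nat -> R) (L : nat) : (forall n, 0 <= t n) -> ex_series t ->
  summableZ (layers t L).
Proof.
  intros H0 H. apply ext_summable, ex_series_abs_of_nonneg.
  - intros k. now apply layers_bounds.
  - now apply layers_ex_series.
Qed.

Lemma layers_nonneg (t : nat -> R) (L : nat) (n : Z) : 0 <= layers t L n.
Proof. unfold layers, ext. destruct (Z_lt_dec n 0); [lra|apply Rmax_r]. Qed.

Lemma layer_mass_Series (t : nat -> R) (L : nat) :
  layer_mass t L = Series (fun k => Rmax (t k - t L) 0).
Proof. apply sumZ_ext_nat. Qed.

Lemma layer_mass_S (t : nat -> R) (L : nat) : decreasing_law t ->
  layer_mass t (S L) = layer_mass t L + layer_weight t L.
Proof.
  intros [H0 [H1 [_ Hd]]]. unfold layer_mass. rewrite layers_S by auto.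
  destruct (unif_prob L) as [_ [U1 U2]].
  rewrite sumZ_plus, sumZ_scal, U2; [ring|now apply layers_summable|now apply summableZ_scal].
Qed.

Lemma layer_mass_0 (t : nat -> R) : decreasing_law t -> layer_mass t 0 = 0.
Proof.
  intros [_ [_ [_ Hd]]]. rewrite layer_mass_Series. apply Series_0. intros k.
  apply Rmax_right. pose proof (decreasing_le t 0 k Hd (Nat.le_0_l k)). lra.
Qed.

Lemma layer_defect (t : nat -> R) (L : nat) : decreasing_law t -> (1 <= L)%nat ->
  tail t L <= 1 - layer_mass t L.
Proof.
  intros [H0 [H1 [H2 Hd]]] HL.
  assert (HE := layers_ex_series t L H0 H1).
  rewrite <- H2, layer_mass_Series, <- Series_minus by auto.
  rewrite (Series_incr_n (fun n => t n - _) L) by (try lia; now apply ex_series_minusR).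
  rewrite <- sum_n_Reals.
  assert (0 <= sum_n (fun k => t k - Rmax (t k - t L) 0) (pred L)).
  { apply sum_n_nonneg. intros k. pose proof (layers_bounds t L k H0). lra. }
  enough (tail t L = Series (fun k => t (L + k)%nat - Rmax (t (L + k)%nat - t L) 0)) by lra.
  apply Series_ext. intros k. rewrite Rmax_right; [ring|].
  assert (t (L + k)%nat <= t L) by (apply decreasing_le; auto; lia). lra.
Qed.

Lemma layer_mass_le_1 (t : nat -> R) (L : nat) : decreasing_law t -> layer_mass t L <= 1.
Proof.
  intros [H0 [H1 [H2 Hd]]]. rewrite <- H2, layer_mass_Series.
  apply Series_mono; auto; [intros k; now apply layers_bounds|now apply layers_ex_series].
Qed.

Lemma layers_approx (t : nat -> R) (L : nat) : decreasing_law t ->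
  l1norm (fun n => ext t n - layers t L n) = 1 - layer_mass t L.
Proof.
  intros [H0 [H1 [H2 Hd]]]. rewrite l1norm_of_nonneg.
  - rewrite sumZ_minus, sumZ_ext_nat, H2; auto.
    + apply ext_summable. now apply ex_series_abs_of_nonneg.
    + now apply layers_summable.
  - intros n. unfold layers, ext. destruct (Z_lt_dec n 0); [lra|].
    pose proof (layers_bounds t L (Z.to_nat n) H0). lra.
Qed.

Lemma layer_mass_lim (t : nat -> R) : decreasing_law t ->
  is_lim_seq (layer_mass t) 1.
Proof.
  intros [H0 [H1 [H2 Hd]]].
  apply (is_lim_seq_ext (fun L => Series (fun k => Rmax (t k - t L) 0))).
  { intros L. now rewrite layer_mass_Series. }
  rewrite <- H2. unfold is_lim_seq.
  apply (Tannery eventually (fun k L => Rmax (t k - t L) 0) t t H1).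
  - intros k. assert (Ht : is_lim_seq t 0) by now apply ex_series_lim_0.
    assert (Hk : is_lim_seq (fun L => t k - t L) (t k - 0)).
    { apply is_lim_seq_minus'; auto. apply is_lim_seq_const. }
    rewrite Rminus_0_r in Hk.
    change (is_lim_seq (fun L => Rmax (t k - t L) 0) (t k)).
    apply (is_lim_seq_le_le_loc (fun L => t k - t L) _ (fun _ => t k)).
    + exists 0%nat. intros L _. split; [apply Rmax_l|].
      now apply layers_bounds.
    + exact Hk.
    + apply is_lim_seq_const.
  - exists 0%nat. intros L _ k. rewrite Rabs_pos_eq; now apply layers_bounds.
  - intros k. rewrite Rabs_pos_eq; auto. lra.
Qed.

Lemma is_prob_ext (t : nat -> R) : decreasing_law t -> is_prob (ext t).
Proof.
  intros [H0 [H1 [H2 Hd]]]. split; [|split].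
  - intros n. unfold ext. destruct (Z_lt_dec n 0); [lra|auto].
  - apply ext_summable. now apply ex_series_abs_of_nonneg.
  - now rewrite sumZ_ext_nat.
Qed.

(** The bound required of the layers in [Ritt_of_layers]. *)
Definition smoothed (t : nat -> R) (nu : Z -> R) : Prop :=
  exists C, 0 <= C /\ forall L,
    l1norm (conv (unif L) (fun k => dirac0 k - nu k)) <= C * (1 - layer_mass t (S L)).

Lemma smoothed_self (t : nat -> R) (K : R) : decreasing_law t -> 0 < K ->
  tail_condition t K -> smoothed t (ext t).
Proof.
  intros Hlaw HK HT. exists (2 * K + 2). split; [lra|]. intros L.
  pose proof (layer_defect t (S L) Hlaw ltac:(lia)) as HD.
  pose proof (is_prob_ext t Hlaw) as Hp.
  destruct Hlaw as [H0 [H1 _]].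
  eapply Rle_trans; [now apply unif_smoothing|].
  rewrite sumZ_ext_mult.
  assert (HL : 0 < INR (S L)) by (apply lt_0_INR; lia).
  destruct (min_moment_le t (2 / INR (S L)) (S L) H0 H1) as [_ HM].
  - apply Rlt_le, Rdiv_lt_0_compat; lra.
  - lia.
  - rewrite (Series_ext _ (fun k => t k * Rmin (INR k * (2 / INR (S L))) 2)).
    2:{ intros k. rewrite Z.abs_eq by lia. now rewrite <- INR_IZR_INZ. }
    eapply Rle_trans; [exact HM|].
    pose proof (HT (S L) ltac:(lia)) as HTL.
    apply (Rmult_le_compat_l (2 / INR (S L))) in HTL;
      [|apply Rlt_le, Rdiv_lt_0_compat; lra].
    replace (2 / INR (S L) * (K * INR (S L) * tail t (S L)))
      with (2 * K * tail t (S L)) in HTL by (field; lra).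
    apply (Rmult_le_compat_l (2 * K + 2)) in HD; lra.
Qed.

(** A law with finite first moment [m] is moved by at most [2 m / (L + 1)], which
    is of the order of the tail since [t 1 > 0]. *)
Lemma smoothed_first_moment (t : nat -> R) (K : R) (sigma : Z -> R) :
  decreasing_law t -> 0 < K -> tail_condition t K -> 0 < t 1%nat ->
  is_prob sigma -> summableZ (fun n => sigma n * IZR (Z.abs n)) -> smoothed t sigma.
Proof.
  intros Hlaw HK HT Ht1 Hs Hm.
  set (m := sumZ (fun n => sigma n * IZR (Z.abs n))).
  assert (Hm0 : 0 <= m).
  { apply sumZ_nonneg; auto. intros n. apply Rmult_le_pos; [apply Hs|apply IZR_le; lia]. }
  assert (HC : 0 <= 2 * m * K / t 1%nat).
  { apply Rle_div_r; auto. assert (0 <= m * K) by (apply Rmult_le_pos; lra). lra. }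
  exists (2 * m * K / t 1%nat). split; auto. intros L.
  pose proof (layer_defect t (S L) Hlaw ltac:(lia)) as HD.
  destruct Hlaw as [H0 [H1 _]].
  pose proof (tail_lower t K (S L) H0 HK HT ltac:(lia)) as HTl.
  assert (HL : 0 < INR (S L)) by (apply lt_0_INR; lia).
  eapply Rle_trans; [now apply unif_smoothing|].
  apply Rle_trans with (2 / INR (S L) * m).
  - unfold m. rewrite <- sumZ_scal. apply sumZ_le.
    + intros n. pose proof (Rmin_l (IZR (Z.abs n) * (2 / INR (S L))) 2).
      pose proof (proj1 Hs n). nra.
    + apply (summableZ_mult_bounded _ _ 2); [apply Hs|]. intros n.
      rewrite Rabs_pos_eq; [apply Rmin_r|]. apply Rmin_glb; [|lra].
      apply Rmult_le_pos; [apply IZR_le; lia|]. apply Rlt_le, Rdiv_lt_0_compat; lra.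
    + now apply summableZ_scal.
  - eapply Rle_trans; [|apply Rmult_le_compat_l; [exact HC|exact HD]].
    apply Rmult_le_reg_r with (INR (S L) * t 1%nat); [now apply Rmult_lt_0_compat|].
    replace (2 / INR (S L) * m * (INR (S L) * t 1%nat)) with (2 * m * t 1%nat) by (field; lra).
    replace (2 * m * K / t 1%nat * tail t (S L) * (INR (S L) * t 1%nat))
      with (2 * m * (K * INR (S L) * tail t (S L))) by (field; lra).
    apply Rmult_le_compat_l; lra.
Qed.

(** The law [ext t] is resolved into its layers, each convolved with [sigma]. *)
Lemma Ritt_conv (t : nat -> R) (sigma : Z -> R) : decreasing_law t ->
  is_prob sigma -> smoothed t (ext t) -> smoothed t sigma -> Ritt (conv (ext t) sigma).
Proof.
  intros Hlaw Hs [C1 [HC1 H1]] [C2 [HC2 H2]].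
  pose proof (is_prob_ext t Hlaw) as Hp.
  pose proof (l1norm_prob _ Hs) as Ns. pose proof (l1norm_prob _ Hp) as Np.
  pose proof (is_prob_conv _ _ Hp Hs) as Hps.
  assert (Hsum := proj1 (proj2 Hs)). assert (Hpsum := proj1 (proj2 Hp)).
  assert (HA : forall L, summableZ (layers t L)).
  { intros L. apply layers_summable; apply Hlaw. }
  apply (Ritt_of_layers _ (fun L => conv (layers t L) sigma)
    (fun L => conv (unif L) sigma) (layer_mass t) (layer_weight t) (C1 + C2)); auto.
  - lra.
  - intros L. now apply conv_summable.
  - intros L. eapply Rle_trans; [now apply l1norm_conv|].
    rewrite Ns, Rmult_1_r, l1norm_of_nonneg by apply layers_nonneg. apply Rle_refl.
  - intros L. now apply layer_mass_le_1.
  - rewrite layer_mass_0 by auto. lra.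
  - intros L. apply conv_summable; auto. apply unif_prob.
  - intros L. apply Rmult_le_pos; [apply pos_INR|].
    pose proof (proj2 (proj2 (proj2 Hlaw)) L). lra.
  - intros L. rewrite layers_S by apply Hlaw.
    rewrite conv_plus_l, conv_scal_l; auto. apply summableZ_scal, unif_prob.
  - intros L. now apply layer_mass_S.
  - intros L.
    assert (HU : summableZ (unif L)) by apply unif_prob.
    set (d1 := fun k => dirac0 k - ext t k). set (d2 := fun k => dirac0 k - sigma k).
    assert (Hd1 : summableZ d1) by now apply dirac0_minus_summable.
    assert (Hd2 : summableZ d2) by now apply dirac0_minus_summable.
    (* 1 - p s = (1 - p) + p (1 - s) in the convolution algebra *)
    assert (Ed : (fun k => dirac0 k - conv (ext t) sigma k)
                 = (fun k => d1 k + conv (ext t) d2 k)).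
    { unfold d1, d2. rewrite conv_minus_r, conv_dirac0_r by auto using dirac0_summable.
      extensionality i; ring. }
    rewrite Ed, conv_assoc by auto using summableZ_plus, conv_summable.
    rewrite (conv_comm sigma), <- conv_assoc by auto using summableZ_plus, conv_summable.
    eapply Rle_trans; [apply l1norm_conv; auto using summableZ_plus, conv_summable|].
    rewrite Ns, Rmult_1_r, conv_plus_r by auto using conv_summable.
    eapply Rle_trans; [apply l1norm_plus; auto using conv_summable|].
    rewrite <- (conv_assoc (unif L)), (conv_comm (unif L) (ext t)), conv_assoc by auto.
    pose proof (l1norm_conv (ext t) (conv (unif L) d2) Hpsum
      (conv_summable _ _ HU Hd2)) as E.
    rewrite Np in E. specialize (H1 L). specialize (H2 L). fold d1 in H1. fold d2 in H2.
    lra.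
  - apply (is_lim_seq_le_le (fun _ => 0) _ (fun L => 1 - layer_mass t L)).
    + intros L.
      assert (Hd : summableZ (fun n => ext t n - layers t L n)) by now apply summableZ_minus.
      rewrite <- conv_minus_l by auto. split.
      * apply l1norm_nonneg. now apply conv_summable.
      * eapply Rle_trans; [now apply l1norm_conv|].
        rewrite Ns, Rmult_1_r, layers_approx by auto. apply Rle_refl.
    + apply is_lim_seq_const.
    + replace (Finite 0) with (Finite (1 - 1)) by (f_equal; ring).
      apply is_lim_seq_minus'; [apply is_lim_seq_const|now apply layer_mass_lim].
Qed.

(** The layers of [t], scaled by [alpha], are added to [(1 - alpha) * sigma]; the initial
    mass [1 - alpha] is less than 1, as [Ritt_of_layers] demands. *)
Lemma Ritt_mix (t : nat -> R) (sigma : Z -> R) (alpha : R) : decreasing_law t ->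
  is_prob sigma -> smoothed t (ext t) -> smoothed t sigma -> 0 < alpha <= 1 ->
  Ritt (fun n => alpha * ext t n + (1 - alpha) * sigma n).
Proof.
  intros Hlaw Hs [C1 [HC1 H1]] [C2 [HC2 H2]] Ha.
  pose proof (is_prob_ext t Hlaw) as Hp.
  pose proof (is_prob_mix _ _ alpha (conj (Rlt_le _ _ (proj1 Ha)) (proj2 Ha)) Hp Hs) as Hm.
  assert (Hsum := proj1 (proj2 Hs)). assert (Hpsum := proj1 (proj2 Hp)).
  assert (HA : forall L, summableZ (layers t L)).
  { intros L. apply layers_summable; apply Hlaw. }
  assert (Hw : forall L, 0 <= layer_weight t L).
  { intros L. apply Rmult_le_pos; [apply pos_INR|].
    pose proof (proj2 (proj2 (proj2 Hlaw)) L). lra. }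
  assert (HC : 0 <= (alpha * C1 + (1 - alpha) * C2) / alpha).
  { apply Rle_div_r; [lra|]. assert (0 <= alpha * C1) by (apply Rmult_le_pos; lra).
    assert (0 <= (1 - alpha) * C2) by (apply Rmult_le_pos; lra). lra. }
  apply (Ritt_of_layers _ (fun L n => alpha * layers t L n + (1 - alpha) * sigma n)
    unif (fun L => alpha * layer_mass t L + (1 - alpha))
    (fun L => alpha * layer_weight t L) ((alpha * C1 + (1 - alpha) * C2) / alpha)); auto.
  - intros L. apply summableZ_plus; now apply summableZ_scal.
  - intros L. eapply Rle_trans; [apply l1norm_plus; now apply summableZ_scal|].
    rewrite !l1norm_scal, !Rabs_pos_eq by lra. rewrite (l1norm_prob _ Hs).
    rewrite l1norm_of_nonneg by apply layers_nonneg. unfold layer_mass. lra.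
  - intros L. pose proof (layer_mass_le_1 t L Hlaw). nra.
  - rewrite layer_mass_0 by auto. lra.
  - intros L. apply unif_prob.
  - intros L. apply Rmult_le_pos; auto. lra.
  - intros L. rewrite layers_S by apply Hlaw.
    extensionality i; ring.
  - intros L. rewrite layer_mass_S by auto. ring.
  - intros L.
    assert (HU : summableZ (unif L)) by apply unif_prob.
    set (d1 := fun k => dirac0 k - ext t k). set (d2 := fun k => dirac0 k - sigma k).
    assert (Hd1 : summableZ d1) by now apply dirac0_minus_summable.
    assert (Hd2 : summableZ d2) by now apply dirac0_minus_summable.
    replace (fun k => dirac0 k - (alpha * ext t k + (1 - alpha) * sigma k))
      with (fun k => alpha * d1 k + (1 - alpha) * d2 k)
      by (extensionality i; unfold d1, d2; ring).
    rewrite conv_plus_r, !conv_scal_r by auto using summableZ_scal.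
    eapply Rle_trans; [apply l1norm_plus; auto using summableZ_scal, conv_summable|].
    rewrite !l1norm_scal, !Rabs_pos_eq by lra.
    specialize (H1 L). specialize (H2 L). fold d1 in H1. fold d2 in H2.
    apply (Rmult_le_compat_l alpha) in H1; [|lra].
    apply (Rmult_le_compat_l (1 - alpha)) in H2; [|lra].
    replace ((alpha * C1 + (1 - alpha) * C2) / alpha *
      (1 - (alpha * layer_mass t (S L) + (1 - alpha))))
      with (alpha * (C1 * (1 - layer_mass t (S L)))
            + (1 - alpha) * (C2 * (1 - layer_mass t (S L)))) by (field; lra).
    lra.
  - apply (is_lim_seq_ext (fun L => alpha * (1 - layer_mass t L))).
    + intros L. rewrite <- (layers_approx t L Hlaw).
      rewrite <- (Rabs_pos_eq alpha) at 1 by lra. rewrite <- l1norm_scal.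
      unfold l1norm. apply sumZ_ext. intros n. f_equal. ring.
    + replace (Finite 0) with (Finite (alpha * (1 - 1))) by (f_equal; ring).
      apply (is_lim_seq_scal_l _ alpha (1 - 1)).
      apply is_lim_seq_minus'; [apply is_lim_seq_const|now apply layer_mass_lim].
Qed.

(** * Fourier transforms *)

Lemma abs_cos_le (x : R) : Rabs (cos x) <= 1.
Proof. apply Rabs_le. apply COS_bound. Qed.

Lemma abs_sin_le (x : R) : Rabs (sin x) <= 1.
Proof. apply Rabs_le. apply SIN_bound. Qed.

Lemma summable_cos (a : Z -> R) (theta : R) : summableZ a ->
  summableZ (fun n => a n * cos (IZR n * theta)).
Proof.
  intros Ha. apply (summableZ_mult_bounded a (fun n => cos (IZR n * theta)) 1 Ha).
  intros; apply abs_cos_le.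
Qed.

Lemma summable_sin (a : Z -> R) (theta : R) : summableZ a ->
  summableZ (fun n => a n * sin (IZR n * theta)).
Proof.
  intros Ha. apply (summableZ_mult_bounded a (fun n => sin (IZR n * theta)) 1 Ha).
  intros; apply abs_sin_le.
Qed.

Lemma Cmod_sq (z : C) : Cmod z ^ 2 = fst z ^ 2 + snd z ^ 2.
Proof. unfold Cmod. rewrite <- Rsqr_pow2, Rsqr_sqrt; nra. Qed.

(** The modulus of the sum is its scalar product with its own direction, to which
    each term contributes at most its absolute value. *)
Lemma Cmod_fourier_le (a : Z -> R) (theta : R) : summableZ a ->
  Cmod (fourier a theta) <= l1norm a.
Proof.
  intros Ha. set (m := Cmod (fourier a theta)).
  pose proof (Cmod_ge_0 (fourier a theta)) as Hm. fold m in Hm.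
  destruct (Req_dec m 0) as [->|Hm0]; [now apply l1norm_nonneg|].
  set (A := sumZ (fun n => a n * cos (IZR n * theta))).
  set (B := sumZ (fun n => a n * sin (IZR n * theta))).
  assert (HAB : m ^ 2 = A ^ 2 + B ^ 2) by (unfold m; now rewrite Cmod_sq).
  assert (E : m ^ 2 = sumZ (fun n => A * (a n * cos (IZR n * theta))
                                     + B * (a n * sin (IZR n * theta)))).
  { rewrite sumZ_plus, !sumZ_scal
      by (apply summableZ_scal; auto using summable_cos, summable_sin).
    rewrite HAB. fold A B. ring. }
  assert (Hle : m ^ 2 <= m * l1norm a).
  { rewrite E. unfold l1norm. rewrite <- sumZ_scal. apply sumZ_le.
    - intros n. set (c := cos (IZR n * theta)). set (s := sin (IZR n * theta)).
      assert (Hcs : c ^ 2 + s ^ 2 = 1).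
      { pose proof (sin2_cos2 (IZR n * theta)) as H. unfold Rsqr in H. fold c s in H. lra. }
      assert (Hx : Rabs (A * c + B * s) <= m).
      { apply Rsqr_incr_0_var; auto. rewrite <- Rsqr_abs. unfold Rsqr.
        assert (0 <= (A * s - B * c) ^ 2) by apply pow2_ge_0.
        assert ((A * c + B * s) * (A * c + B * s) + (A * s - B * c) ^ 2
                = (A ^ 2 + B ^ 2) * (c ^ 2 + s ^ 2)) by ring.
        rewrite Hcs, <- HAB in *. lra. }
      replace (A * (a n * c) + B * (a n * s)) with (a n * (A * c + B * s)) by ring.
      eapply Rle_trans; [apply Rle_abs|]. rewrite Rabs_mult, Rmult_comm.
      apply Rmult_le_compat_r; auto. apply Rabs_pos.
    - apply summableZ_plus; apply summableZ_scal; auto using summable_cos, summable_sin.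
    - apply summableZ_scal. now apply summableZ_abs. }
  apply Rmult_le_reg_l with m; [lra|]. lra.
Qed.

Lemma fourier_plus (a b : Z -> R) (theta : R) : summableZ a -> summableZ b ->
  fourier (fun n => a n + b n) theta = (fourier a theta + fourier b theta)%C.
Proof.
  intros Ha Hb. unfold fourier, Cplus; simpl. f_equal.
  - rewrite <- sumZ_plus by now apply summable_cos. apply sumZ_ext; intros; ring.
  - rewrite <- sumZ_plus by now apply summable_sin. apply sumZ_ext; intros; ring.
Qed.

Lemma fourier_scal (c : R) (a : Z -> R) (theta : R) :
  fourier (fun n => c * a n) theta = (RtoC c * fourier a theta)%C.
Proof.
  unfold fourier, Cmult; simpl. f_equal.
  - rewrite Rmult_0_l, Rminus_0_r, <- sumZ_scal. apply sumZ_ext; intros; ring.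
  - rewrite Rmult_0_l, Rplus_0_r, <- sumZ_scal. apply sumZ_ext; intros; ring.
Qed.

Lemma fourier_dirac0 (theta : R) : fourier dirac0 theta = RtoC 1.
Proof.
  unfold fourier, RtoC. f_equal.
  - rewrite <- sumZ_dirac0. apply sumZ_ext. intros n. unfold dirac0.
    destruct (Z.eq_dec n 0) as [->|]; [rewrite Rmult_0_l, cos_0; ring|ring].
  - transitivity (sumZ (fun n => 0 * dirac0 n)).
    + apply sumZ_ext. intros n. unfold dirac0.
      destruct (Z.eq_dec n 0) as [->|]; [rewrite Rmult_0_l, sin_0; ring|ring].
    + rewrite sumZ_scal. ring.
Qed.

Lemma fourier_conv (a b : Z -> R) (theta : R) : summableZ a -> summableZ b ->
  fourier (conv a b) theta = (fourier a theta * fourier b theta)%C.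
Proof.
  intros Ha Hb.
  assert (Hbc := summable_cos b theta Hb). assert (Hbs := summable_sin b theta Hb).
  assert (Hac := summable_cos a theta Ha). assert (Has := summable_sin a theta Ha).
  unfold fourier, Cmult; simpl. f_equal.
  - rewrite (proj2 (conv_test a b (fun n => cos (IZR n * theta)) 1 Ha Hb
      (fun n => abs_cos_le _))).
    set (X := sumZ (fun n => b n * cos (IZR n * theta))).
    set (Y := sumZ (fun n => b n * sin (IZR n * theta))).
    rewrite (sumZ_ext _ (fun k => X * (a k * cos (IZR k * theta))
                                  - Y * (a k * sin (IZR k * theta)))).
    + rewrite sumZ_minus, !sumZ_scal by now apply summableZ_scal. ring.
    + intros k. rewrite (sumZ_ext _ (fun j =>
        cos (IZR k * theta) * (b j * cos (IZR j * theta))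
        - sin (IZR k * theta) * (b j * sin (IZR j * theta)))).
      * rewrite sumZ_minus, !sumZ_scal by now apply summableZ_scal. fold X Y. ring.
      * intros j. rewrite plus_IZR, Rmult_plus_distr_r, cos_plus. ring.
  - rewrite (proj2 (conv_test a b (fun n => sin (IZR n * theta)) 1 Ha Hb
      (fun n => abs_sin_le _))).
    set (X := sumZ (fun n => b n * cos (IZR n * theta))).
    set (Y := sumZ (fun n => b n * sin (IZR n * theta))).
    rewrite (sumZ_ext _ (fun k => Y * (a k * cos (IZR k * theta))
                                  + X * (a k * sin (IZR k * theta)))).
    + rewrite sumZ_plus, !sumZ_scal by now apply summableZ_scal. ring.
    + intros k. rewrite (sumZ_ext _ (fun j =>
        cos (IZR k * theta) * (b j * sin (IZR j * theta))
        + sin (IZR k * theta) * (b j * cos (IZR j * theta)))).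
      * rewrite sumZ_plus, !sumZ_scal by now apply summableZ_scal. fold X Y. ring.
      * intros j. rewrite plus_IZR, Rmult_plus_distr_r, sin_plus. ring.
Qed.

Lemma fourier_ext (t : nat -> R) (theta : R) :
  fourier (ext t) theta = (Series (fun k => t k * cos (INR k * theta)),
                           Series (fun k => t k * sin (INR k * theta))).
Proof.
  unfold fourier.
  rewrite (sumZ_ext_mult t (fun n => cos (IZR n * theta))),
          (sumZ_ext_mult t (fun n => sin (IZR n * theta))).
  f_equal; apply Series_ext; intros; now rewrite INR_IZR_INZ.
Qed.

(** * Elementary trigonometric bounds *)

Lemma one_minus_cos (x : R) : 1 - cos x = 2 * sin (x / 2) ^ 2.
Proof.
  replace (cos x) with (cos (2 * (x / 2))) by (f_equal; field).
  rewrite cos_2a_sin. ring.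
Qed.

Lemma abs_sin_le_abs (x : R) : Rabs (sin x) <= Rabs x.
Proof.
  assert (Hpos : forall y, 0 < y -> Rabs (sin y) <= y).
  { intros y Hy. apply Rabs_le. split; [|left; now apply sin_lt_x].
    destruct (Rle_dec y PI) as [Hp|Hp].
    - pose proof (sin_ge_0 y). lra.
    - pose proof (SIN_bound y). pose proof PI2_1. lra. }
  destruct (Rtotal_order x 0) as [Hx|[->|Hx]].
  - rewrite (Rabs_left x) by auto. rewrite <- Rabs_Ropp, <- sin_neg. apply Hpos. lra.
  - rewrite sin_0, Rabs_R0. lra.
  - rewrite (Rabs_pos_eq x) by lra. auto.
Qed.

Lemma one_minus_cos_nonneg (x : R) : 0 <= 1 - cos x.
Proof. pose proof (COS_bound x). lra. Qed.

Lemma one_minus_cos_le_sq (x : R) : 1 - cos x <= x ^ 2 / 2.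
Proof.
  rewrite one_minus_cos. pose proof (abs_sin_le_abs (x / 2)) as H.
  apply Rsqr_le_abs_1 in H. unfold Rsqr in H. lra.
Qed.

Lemma one_minus_cos_le_min (x : R) : 0 <= x -> 1 - cos x <= Rmin x 2.
Proof.
  intros Hx. apply Rmin_glb; [|pose proof (COS_bound x); lra].
  rewrite one_minus_cos. pose proof (abs_sin_le_abs (x / 2)) as H.
  pose proof (abs_sin_le (x / 2)) as H1. rewrite (Rabs_pos_eq (x / 2)) in H by lra.
  rewrite <- (Rabs_pos_eq (sin (x / 2) ^ 2)) by apply pow2_ge_0.
  rewrite <- RPow_abs. pose proof (Rabs_pos (sin (x / 2))). nra.
Qed.

Lemma abs_sin_le_min (x : R) : 0 <= x -> Rabs (sin x) <= Rmin x 2.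
Proof.
  intros Hx. apply Rmin_glb; [|pose proof (abs_sin_le x); lra].
  pose proof (abs_sin_le_abs x) as H. now rewrite (Rabs_pos_eq x) in H.
Qed.

Lemma sin_cubic_lower (x : R) : 0 <= x <= 4 -> x - x ^ 3 / 6 <= sin x.
Proof.
  intros Hx. destruct (pre_sin_bound x 0 (proj1 Hx) (proj2 Hx)) as [H _].
  eapply Rle_trans; [|exact H]. right.
  unfold sin_approx, sin_term. simpl. field.
Qed.

Lemma cos_lt_1 (theta : R) : 0 < theta < 2 * PI -> cos theta < 1.
Proof.
  intros H. enough (0 < 1 - cos theta) by lra. rewrite one_minus_cos.
  assert (0 < sin (theta / 2)) by (apply sin_gt_0; lra). nra.
Qed.

(** * The tail condition and bounded angular ratio *)

(** At a frequency [1 / (A n)] with [A] large with respect to the angular ratio [M],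
    the terms [k <= n] contribute to [M (1 - Re f) - Im f] at most minus half of [k theta],
    so that positivity of that quantity leaves the truncated mean bounded by the tail. *)
Lemma tail_of_BAR (t : nat -> R) : decreasing_law t -> BAR (ext t) ->
  exists K, 0 < K /\ tail_condition t K.
Proof.
  intros [H0 [H1 [H2 Hd]]] [Hap [M0 HM0]].
  set (M := Rabs M0). set (A := 1 + 2 * M).
  assert (HM : 0 <= M) by apply Rabs_pos.
  exists (2 * A * (2 * M + 1)). split; [apply Rmult_lt_0_compat; unfold A; lra|].
  intros n Hn.
  assert (Hn1 : 1 <= INR n) by (apply (le_INR 1); lia).
  assert (HAn : 1 <= A * INR n) by (unfold A; nra).
  set (theta := / (A * INR n)).
  assert (Hth : 0 < theta) by (apply Rinv_0_lt_compat; lra).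
  assert (Hth1 : theta <= 1).
  { rewrite <- Rinv_1. apply Rinv_le_contravar; lra. }
  assert (HthM : forall k, (k <= n)%nat -> INR k * theta <= 1 /\ 2 * M * (INR k * theta) <= 1).
  { intros k Hk. apply le_INR in Hk.
    assert (E : INR n * theta = / A) by (unfold theta; field; unfold A; lra).
    assert (E2 : INR k * theta <= / A) by (rewrite <- E; apply Rmult_le_compat_r; lra).
    assert (E3 : / A <= 1).
    { rewrite <- Rinv_1. apply Rinv_le_contravar; unfold A; lra. }
    split; [lra|].
    apply Rle_trans with (2 * M * / A); [apply Rmult_le_compat_l; lra|].
    apply Rmult_le_reg_r with A; [unfold A; lra|].
    rewrite Rmult_assoc, Rinv_l by (unfold A; lra). unfold A; lra. }
  assert (Hth2 : 0 < theta < 2 * PI) by (pose proof PI2_1; lra).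
  specialize (Hap theta Hth2). specialize (HM0 theta Hth2).
  assert (Ec : ex_series (fun k => t k * cos (INR k * theta))).
  { apply ex_series_mult_bounded; auto using abs_cos_le. }
  assert (Es : ex_series (fun k => t k * sin (INR k * theta))).
  { apply ex_series_mult_bounded; auto using abs_sin_le. }
  set (u := fun k => t k * (M * (1 - cos (INR k * theta)) - sin (INR k * theta))).
  assert (Eu : ex_series u).
  { apply (ex_series_ext (fun k => (M * t k - M * (t k * cos (INR k * theta)))
      - t k * sin (INR k * theta))); [intros; unfold u; simpl; ring|].
    auto using ex_series_minusR, ex_series_scalR. }
  assert (Hu : 0 <= Series u).
  { assert (E : Series u = M * (1 - Series (fun k => t k * cos (INR k * theta)))
        - Series (fun k => t k * sin (INR k * theta))).
    { rewrite <- H2, <- Series_minus, <- Series_scal_l, <- Series_minus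
        by auto using ex_series_scalR, ex_series_minusR.
      apply Series_ext. intros; unfold u; ring. }
    rewrite E. clear E. rewrite fourier_ext in *.
    set (X := Series (fun k => t k * cos (INR k * theta))) in *.
    set (Y := Series (fun k => t k * sin (INR k * theta))) in *.
    apply (Rmult_le_compat_r (1 - Cmod (X, Y))) in HM0; [|lra].
    unfold Rdiv in HM0. rewrite Rmult_assoc, Rinv_l, Rmult_1_r in HM0 by lra.
    pose proof (Rle_trans _ _ _ (Rmax_r _ _) (Rmax_Cmod (1 - (X, Y))%C)) as HY.
    simpl in HY. replace (0 + - Y) with (- Y) in HY by ring. rewrite Rabs_Ropp in HY.
    pose proof (Rle_trans _ _ _ (Rmax_l _ _) (Rmax_Cmod (X, Y))) as HX. simpl in HX.
    pose proof (Rle_abs X). pose proof (Rle_abs Y). assert (M0 <= M) by apply Rle_abs.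
    assert (M0 * (1 - Cmod (X, Y)) <= M * (1 - X)) by nra. lra. }
  rewrite (Series_incr_n u (S n)) in Hu by (auto; lia).
  rewrite <- sum_n_Reals in Hu. simpl pred in Hu.
  assert (Hlow : sum_n u n <= (- (theta / 2)) * truncated_mean t n).
  { rewrite <- sum_n_truncated_mean.
    replace (- (theta / 2) * sum_n (fun k => INR k * t k) n)
      with (sum_n (fun k => (- (theta / 2)) * (INR k * t k)) n)
      by apply (sum_n_mult_l (- (theta / 2)) (fun k => INR k * t k)).
    apply sum_n_le. intros k Hk. destruct (HthM k Hk) as [Hx1 Hx2].
    unfold u. set (x := INR k * theta) in *.
    assert (Hx : 0 <= x) by (apply Rmult_le_pos; [apply pos_INR|lra]).
    pose proof (one_minus_cos_le_sq x) as Hc. pose proof (sin_cubic_lower x) as Hs.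
    assert (Hneg : M * (1 - cos x) - sin x <= - (x / 2)).
    { assert (M * (1 - cos x) <= M * (x ^ 2 / 2)) by (apply Rmult_le_compat_l; lra).
      assert (M * (x ^ 2 / 2) <= x / 4) by nra.
      assert (x ^ 3 / 6 <= x / 6) by nra. lra. }
    replace (- (theta / 2) * (INR k * t k)) with (t k * (- (x / 2))) by (unfold x; field).
    now apply Rmult_le_compat_l. }
  assert (Hhigh : Series (fun k => u (S n + k)%nat) <= (2 * M + 1) * tail t (S n)).
  { unfold tail. rewrite <- Series_scal_l. apply Series_mono.
    - intros k. unfold u. rewrite Rmult_comm. apply Rmult_le_compat_r; auto.
      set (x := INR (S n + k) * theta).
      pose proof (COS_bound x). pose proof (SIN_bound x). nra.
    - now apply (proj1 (ex_series_incr_n u (S n))).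
    - apply ex_series_scalR. now apply (proj1 (ex_series_incr_n t (S n))). }
  assert (Htl : tail t (S n) <= tail t n).
  { unfold tail. apply Series_mono; [| now apply (proj1 (ex_series_incr_n t _)) ..].
    intros k. apply decreasing_le; auto; lia. }
  apply Rmult_le_reg_l with (theta / 2); [lra|].
  replace (theta / 2 * (2 * A * (2 * M + 1) * INR n * tail t n))
    with ((2 * M + 1) * tail t n).
  - assert ((2 * M + 1) * tail t (S n) <= (2 * M + 1) * tail t n)
      by (apply Rmult_le_compat_l; lra). lra.
  - unfold theta. field. unfold A. split; lra.
Qed.

Definition cos_defect (t : nat -> R) (theta : R) : R :=
  Series (fun k => t k * (1 - cos (INR k * theta))).

Lemma cos_defect_ex (t : nat -> R) (theta : R) : (forall n, 0 <= t n) -> ex_series t ->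
  ex_series (fun k => t k * (1 - cos (INR k * theta))).
Proof.
  intros H0 H1. apply (ex_series_dom _ (fun k => 2 * t k)); [|now apply ex_series_scalR].
  intros k. pose proof (COS_bound (INR k * theta)). specialize (H0 k).
  rewrite Rabs_pos_eq; nra.
Qed.

Lemma fst_fourier_ext (t : nat -> R) (theta : R) : decreasing_law t ->
  fst (fourier (ext t) theta) = 1 - cos_defect t theta.
Proof.
  intros [H0 [H1 [H2 _]]]. rewrite fourier_ext. simpl. unfold cos_defect.
  transitivity (Series t - Series (fun k => t k * (1 - cos (INR k * theta)))).
  - rewrite <- Series_minus; auto using cos_defect_ex.
    apply Series_ext; intros; ring.
  - now rewrite H2.
Qed.

Lemma cos_defect_ge_1 (t : nat -> R) (theta : R) : (forall n, 0 <= t n) -> ex_series t ->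
  t 1%nat * (1 - cos theta) <= cos_defect t theta.
Proof.
  intros H0 H1.
  replace (t 1%nat * (1 - cos theta)) with (t 1%nat * (1 - cos (INR 1 * theta)))
    by (simpl; now rewrite Rmult_1_l).
  apply (term_le_Series (fun k => t k * (1 - cos (INR k * theta))) 1).
  - intros k. apply Rmult_le_pos; auto using one_minus_cos_nonneg.
  - now apply cos_defect_ex.
Qed.

Lemma scale_exists (theta : R) : 0 < theta <= PI ->
  exists N, (1 <= N)%nat /\ PI / 2 <= INR N * theta <= 3 * PI / 2.
Proof.
  intros Hth. set (r := PI / 2 / theta).
  assert (Hr : 0 < r) by (apply Rdiv_lt_0_compat; lra).
  destruct (archimed r) as [A1 A2].
  assert (HN : (0 < up r)%Z) by (apply lt_IZR; lra).
  exists (Z.to_nat (up r)). split; [lia|].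
  rewrite INR_IZR_INZ, Z2Nat.id by lia.
  assert (E : r * theta = PI / 2) by (unfold r; field; lra). nra.
Qed.

(** Among two points at distance [phi], with [phi] between [PI/2] and [3 PI/2], one is far
    from the multiples of [2 PI]; comparing the series with its translate by [N] thus
    recovers the whole tail. *)
Lemma tail_le_cos_defect (t : nat -> R) (theta : R) (N : nat) : decreasing_law t ->
  PI / 2 <= INR N * theta <= 3 * PI / 2 -> tail t N <= 4 * cos_defect t theta.
Proof.
  intros [H0 [H1 [H2 Hd]]] HN.
  assert (Ht : ex_series (fun k => t (N + k)%nat)) by now apply (proj1 (ex_series_incr_n t N)).
  assert (HA : Series (fun k => t (N + k)%nat * (1 - cos (INR k * theta)))
               <= cos_defect t theta).
  { apply Series_mono; [|now apply (cos_defect_ex (fun k => t (N + k)%nat))|now apply cos_defect_ex].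
    intros k. apply Rmult_le_compat_r; [apply one_minus_cos_nonneg|].
    apply decreasing_le; auto; lia. }
  assert (EB := cos_defect_ex t theta H0 H1).
  assert (EB' := proj1 (ex_series_incr_n _ N) EB). simpl in EB'.
  assert (HB : Series (fun k => t (N + k)%nat * (1 - cos (INR (N + k) * theta)))
               <= cos_defect t theta).
  { unfold cos_defect.
    destruct N as [|N]; [right; apply Series_ext; auto|].
    rewrite (Series_incr_n (fun k => t k * (1 - cos (INR k * theta))) (S N)) by (auto; lia).
    rewrite <- sum_n_Reals.
    enough (0 <= sum_n (fun k => t k * (1 - cos (INR k * theta))) (pred (S N))) by lra.
    apply sum_n_nonneg. intros k. apply Rmult_le_pos; auto using one_minus_cos_nonneg. }
  enough (Series (fun k => / 2 * t (N + k)%nat)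
    <= Series (fun k => t (N + k)%nat * (1 - cos (INR k * theta)))
       + Series (fun k => t (N + k)%nat * (1 - cos (INR (N + k) * theta)))) as H.
  { rewrite Series_scal_l in H. unfold tail. lra. }
  rewrite <- Series_plus; [|now apply (cos_defect_ex (fun k => t (N + k)%nat))|exact EB'].
  apply Series_mono.
  - intros k.
    replace (t (N + k)%nat * (1 - cos (INR k * theta))
        + t (N + k)%nat * (1 - cos (INR (N + k) * theta)))
      with ((2 - (cos (INR k * theta) + cos (INR (N + k) * theta))) * t (N + k)%nat) by ring.
    apply Rmult_le_compat_r; auto.
    rewrite plus_INR. set (phi := INR N * theta) in *. set (a := INR k * theta).
    replace ((INR N + INR k) * theta) with (a + phi) by (unfold a, phi; ring).
    set (m := a + phi / 2).
    replace (cos a) with (cos (m - phi / 2)) by (f_equal; unfold m; field).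
    replace (cos (a + phi)) with (cos (m + phi / 2)) by (f_equal; unfold m; field).
    rewrite cos_minus, cos_plus.
    assert (Hphi : cos (phi / 2) ^ 2 <= / 2).
    { pose proof (cos_le_0 phi ltac:(lra) ltac:(lra)) as Hc.
      replace phi with (2 * (phi / 2)) in Hc by field.
      rewrite cos_2a_cos in Hc. lra. }
    assert (Hb : Rabs (cos (phi / 2)) <= 3 / 4).
    { apply Rsqr_incr_0_var; [|lra]. rewrite <- Rsqr_abs. unfold Rsqr. lra. }
    assert (Hp : Rabs (cos m * cos (phi / 2)) <= 3 / 4).
    { rewrite Rabs_mult. pose proof (abs_cos_le m). pose proof (Rabs_pos (cos m)).
      pose proof (Rabs_pos (cos (phi / 2))). nra. }
    pose proof (Rle_abs (cos m * cos (phi / 2))). lra.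
  - now apply ex_series_scalR.
  - apply ex_series_plusR; [now apply (cos_defect_ex (fun k => t (N + k)%nat))|exact EB'].
Qed.

(** Removing the atom at 0 leaves a vector of modulus at most [1 - t 0], so that
    [|f|^2 <= 1 - 2 t0 (1 - Re f)]. *)
Lemma Cmod_fourier_gap (t : nat -> R) (theta : R) : decreasing_law t ->
  t 0%nat * cos_defect t theta <= 1 - Cmod (fourier (ext t) theta).
Proof.
  intros Hlaw. pose proof (is_prob_ext t Hlaw) as Hp.
  pose proof (fst_fourier_ext t theta Hlaw) as Hre.
  pose proof (Cmod_fourier_le (ext t) theta (proj1 (proj2 Hp))) as Hm1.
  rewrite (l1norm_prob _ Hp) in Hm1.
  set (f := fourier (ext t) theta) in *. set (D := cos_defect t theta) in *.
  set (s := t 0%nat).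
  assert (Hs0 : 0 <= s) by apply Hlaw.
  assert (Hg : Cmod (f + RtoC (- s) * 1)%C <= 1 - s).
  { unfold f. rewrite <- (fourier_dirac0 theta), <- fourier_scal, <- fourier_plus
      by (try apply summableZ_scal; auto using dirac0_summable; apply Hp).
    eapply Rle_trans; [apply Cmod_fourier_le;
      apply summableZ_plus; [apply Hp|apply summableZ_scal, dirac0_summable]|].
    rewrite l1norm_of_nonneg.
    - rewrite sumZ_plus, sumZ_scal, sumZ_dirac0, (proj2 (proj2 Hp));
        [lra|apply Hp|apply summableZ_scal, dirac0_summable].
    - intros n. unfold dirac0. destruct (Z.eq_dec n 0) as [->|].
      + change (ext t 0) with (ext t (Z.of_nat 0)). rewrite ext_nat. unfold s. lra.
      + pose proof (proj1 Hp n). lra. }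
  pose proof (Cmod_ge_0 (f + RtoC (- s) * 1)%C) as Hg0.
  pose proof (Cmod_ge_0 f) as Hf0.
  assert (Hsq : Cmod (f + RtoC (- s) * 1)%C ^ 2 <= (1 - s) ^ 2) by (apply pow_incr; lra).
  rewrite Cmod_sq in Hsq. pose proof (Cmod_sq f) as Hf.
  clearbody f D s. simpl in Hsq.
  rewrite Hre in Hsq, Hf. nra.
Qed.

(** The sum is split at a scale [N] of order [1 / theta], where the tail condition
    bounds it by the tail; the tail is bounded by [1 - Re f], and that by [1 - |f|]. *)
Lemma min_moment_le_gap (t : nat -> R) (K : R) : decreasing_law t -> 0 < K ->
  tail_condition t K -> 0 < t 0%nat ->
  exists c, 0 < c /\ forall theta, 0 < theta <= PI ->
    c * Series (fun k => t k * Rmin (INR k * theta) 2)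
    <= 1 - Cmod (fourier (ext t) theta).
Proof.
  intros Hlaw HK HT Ht0. exists (t 0%nat / (4 * (6 * K + 2))).
  split; [apply Rdiv_lt_0_compat; lra|]. intros theta Hth.
  destruct (scale_exists theta Hth) as [N [HN1 HN]].
  pose proof (tail_le_cos_defect t theta N Hlaw HN) as HD.
  pose proof (Cmod_fourier_gap t theta Hlaw) as HG.
  destruct (min_moment_le t theta N (proj1 Hlaw) (proj1 (proj2 Hlaw))
    ltac:(lra) HN1) as [_ Hm].
  pose proof (tail_nonneg t N (proj1 Hlaw) (proj1 (proj2 Hlaw))) as HT0.
  assert (Hm2 : Series (fun k => t k * Rmin (INR k * theta) 2) <= (6 * K + 2) * tail t N).
  { pose proof (HT N HN1) as HTN. apply (Rmult_le_compat_l theta) in HTN; [|lra].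
    assert (INR N * theta <= 6) by (pose proof PI_4; lra).
    assert (INR N * theta * (K * tail t N) <= 6 * (K * tail t N)).
    { apply Rmult_le_compat_r; auto. apply Rmult_le_pos; lra. }
    lra. }
  eapply Rle_trans; [|exact HG].
  apply Rmult_le_reg_r with (4 * (6 * K + 2)); [lra|].
  replace (t 0%nat / (4 * (6 * K + 2)) * Series (fun k => t k * Rmin (INR k * theta) 2)
    * (4 * (6 * K + 2))) with
    (t 0%nat * Series (fun k => t k * Rmin (INR k * theta) 2)) by (field; lra).
  rewrite Rmult_assoc. apply Rmult_le_compat_l; [lra|].
  apply (Rmult_le_compat_l (6 * K + 2)) in HD; lra.
Qed.

Lemma Cmod_1_minus_fourier (t : nat -> R) (theta : R) : decreasing_law t -> 0 <= theta ->
  Cmod (1 - fourier (ext t) theta)%C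
  <= 2 * Series (fun k => t k * Rmin (INR k * theta) 2).
Proof.
  intros Hlaw Hth.
  destruct (min_moment_le t theta 1 (proj1 Hlaw) (proj1 (proj2 Hlaw)) Hth (le_n 1)) as [Em _].
  pose proof (fst_fourier_ext t theta Hlaw) as Hre.
  destruct Hlaw as [H0 [H1 _]].
  assert (Hk : forall k, 0 <= INR k * theta) by (intros; apply Rmult_le_pos; auto using pos_INR).
  set (m := Series (fun k => t k * Rmin (INR k * theta) 2)) in *.
  assert (HD : 0 <= cos_defect t theta <= m).
  { split.
    - apply Series_nonneg; [|now apply cos_defect_ex].
      intros; apply Rmult_le_pos; auto using one_minus_cos_nonneg.
    - apply Series_mono; auto; [|now apply cos_defect_ex].
      intros k. apply Rmult_le_compat_l; auto using one_minus_cos_le_min. }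
  assert (Hsk : forall k, Rabs (t k * sin (INR k * theta)) <= t k * Rmin (INR k * theta) 2).
  { intros k. rewrite Rabs_mult, (Rabs_pos_eq (t k)) by auto.
    apply Rmult_le_compat_l; auto using abs_sin_le_min. }
  assert (Es : ex_series (fun k => Rabs (t k * sin (INR k * theta)))).
  { apply (ex_series_dom _ (fun k => t k * Rmin (INR k * theta) 2)); auto.
    intros k. rewrite Rabs_Rabsolu. apply Hsk. }
  assert (HS : Rabs (snd (fourier (ext t) theta)) <= m).
  { rewrite fourier_ext. simpl. eapply Rle_trans; [now apply Series_Rabs|].
    apply Series_mono; auto. }
  set (f := fourier (ext t) theta) in *. clearbody f.
  unfold Cmod. eapply Rle_trans; [apply sqrt_plus_sqr|].
  simpl. rewrite Hre.
  replace (1 + - (1 - cos_defect t theta)) with (cos_defect t theta) by ring.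
  replace (0 + - snd f) with (- snd f) by ring.
  rewrite Rabs_Ropp, (Rabs_pos_eq (cos_defect t theta)) by lra.
  assert (Hs2 : sqrt 2 <= 2).
  { rewrite <- (sqrt_square 2) at 2 by lra. apply sqrt_le_1; lra. }
  apply Rmult_le_compat; [apply sqrt_pos| |exact Hs2|].
  - eapply Rle_trans; [|apply Rmax_l]. lra.
  - apply Rmax_lub; lra.
Qed.

Lemma fourier_ext_reflect (t : nat -> R) (theta : R) :
  fourier (ext t) (2 * PI - theta) = Cconj (fourier (ext t) theta).
Proof.
  rewrite !fourier_ext. unfold Cconj; simpl.
  assert (E : forall k, INR k * (2 * PI - theta) = - (INR k * theta) + 2 * INR k * PI)
    by (intros; ring).
  f_equal.
  - apply Series_ext. intros k. now rewrite E, cos_period, cos_neg.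
  - rewrite <- Series_opp. apply Series_ext. intros k. rewrite E, sin_period, sin_neg. ring.
Qed.

Lemma BAR_of_tail (t : nat -> R) (K : R) : decreasing_law t -> 0 < K ->
  tail_condition t K -> 0 < t 1%nat -> BAR (ext t).
Proof.
  intros Hlaw HK HT Ht1.
  assert (Ht0 : 0 < t 0%nat).
  { pose proof (proj2 (proj2 (proj2 Hlaw)) 0%nat). lra. }
  assert (Hap : strictly_aperiodic (ext t)).
  { intros theta Hth. pose proof (Cmod_fourier_gap t theta Hlaw).
    pose proof (cos_defect_ge_1 t theta (proj1 Hlaw) (proj1 (proj2 Hlaw))).
    pose proof (cos_lt_1 theta Hth).
    assert (0 < t 1%nat * (1 - cos theta)) by (apply Rmult_lt_0_compat; lra).
    assert (0 < t 0%nat * cos_defect t theta) by (apply Rmult_lt_0_compat; lra). lra. }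
  split; auto.
  destruct (min_moment_le_gap t K Hlaw HK HT Ht0) as [c [Hc Hgap]].
  exists (2 / c).
  assert (Hhalf : forall theta, 0 < theta <= PI ->
    Cmod (1 - fourier (ext t) theta)%C / (1 - Cmod (fourier (ext t) theta)) <= 2 / c).
  { intros theta Hth. specialize (Hgap theta Hth).
    assert (H1 : Cmod (fourier (ext t) theta) < 1) by (apply Hap; pose proof PI_RGT_0; lra).
    pose proof (Cmod_1_minus_fourier t theta Hlaw ltac:(lra)) as H.
    apply Rle_div_l; [lra|].
    apply Rmult_le_reg_l with c; auto.
    replace (c * (2 / c * (1 - Cmod (fourier (ext t) theta))))
      with (2 * (1 - Cmod (fourier (ext t) theta))) by (field; lra).
    apply (Rmult_le_compat_l c) in H; lra. }
  (* Frequencies beyond PI reduce to the others by complex conjugation. *)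
  intros theta Hth. destruct (Rle_dec theta PI) as [Hp|Hp]; [apply Hhalf; lra|].
  specialize (Hhalf (2 * PI - theta) ltac:(lra)).
  rewrite fourier_ext_reflect, Cmod_conj in Hhalf.
  replace (1 - Cconj (fourier (ext t) theta))%C with (Cconj (1 - fourier (ext t) theta)) in Hhalf.
  - now rewrite Cmod_conj in Hhalf.
  - unfold Cconj, Cminus, Cplus, Copp, RtoC; simpl. f_equal; ring.
Qed.

(** * Termwise differentiation *)

Lemma Series_continuous (u : nat -> R -> R) (B : nat -> R) (x : R) :
  ex_series B -> (forall n, continuous (u n) x) ->
  locally x (fun y => forall n, Rabs (u n y) <= B n) ->
  continuous (fun y => Series (fun n => u n y)) x.
Proof.
  intros HB Hc Hb. apply (Tannery (locally x) u (fun n => u n x) B); auto.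
  exact (locally_singleton _ _ Hb).
Qed.

Lemma ball_0_R (d h : R) : ball (0 : R_UniformSpace) d h <-> Rabs h < d.
Proof.
  unfold ball; simpl. unfold AbsRing_ball, abs, minus, plus, opp; simpl.
  now rewrite Ropp_0, Rplus_0_r.
Qed.

(** The difference quotients are dominated by the mean value inequality, so that
    Tannery's theorem applies to them. *)
Lemma Series_derive (u u1 : nat -> R -> R) (A B : nat -> R) (x delta : R) :
  0 < delta -> ex_series A -> ex_series B ->
  (forall n y, Rabs (y - x) < delta ->
     is_derive (u n) y (u1 n y) /\ Rabs (u n y) <= A n /\ Rabs (u1 n y) <= B n) ->
  is_derive (fun y => Series (fun n => u n y)) x (Series (fun n => u1 n x)).
Proof.
  intros Hd HA HB Hu.
  assert (Hx : Rabs (x - x) < delta) by (rewrite Rminus_diag, Rabs_R0; auto).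
  assert (Hlim : filterlim (fun h => Series (fun n => (u n (x + h) - u n x) / h))
            (locally' 0) (locally (Series (fun n => u1 n x)))).
  { apply (Tannery (locally' 0) (fun n h => (u n (x + h) - u n x) / h) _ B HB).
    - intros n. destruct (Hu n x Hx) as [Hn _]. apply is_derive_Reals in Hn.
      apply filterlim_locally. intros eps.
      destruct (Hn eps (cond_pos eps)) as [d Hdd].
      exists d. intros h Hh Hh0. apply (Hdd h Hh0). now apply ball_0_R.
    - exists (mkposreal delta Hd). intros h Hh Hh0 n.
      apply (proj1 (ball_0_R delta h)) in Hh.
      unfold Rdiv. rewrite Rabs_mult, Rabs_inv.
      assert (Hpos : 0 < Rabs h) by now apply Rabs_pos_lt.
      apply Rmult_le_reg_r with (Rabs h); auto.
      rewrite Rmult_assoc, Rinv_l, Rmult_1_r by lra.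
      replace (Rabs h) with (Rabs (x + h - x)) by now rewrite Rplus_minus_l.
      apply (bounded_variation (u n) (u1 n) (B n)).
      intros y Hy. destruct (Hu n y) as [H1 [_ H3]]; auto.
      eapply Rle_lt_trans; [exact Hy|]. rewrite Rplus_minus_l. exact Hh.
    - intros n. now apply Hu. }
  apply is_derive_Reals. intros eps Heps.
  pose proof (proj1 (filterlim_locally _ _) Hlim (mkposreal eps Heps)) as [d Hdd].
  assert (Hm : 0 < Rmin d delta) by (apply Rmin_pos; auto; apply cond_pos).
  exists (mkposreal _ Hm). intros h Hh0 Hh. simpl in Hh.
  assert (Hhd : Rabs (x + h - x) < delta).
  { replace (x + h - x) with h by ring. eapply Rlt_le_trans; [exact Hh|apply Rmin_r]. }
  assert (E1 : ex_series (fun n => u n (x + h))).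
  { apply (ex_series_dom _ A); auto. intros n. now apply Hu. }
  assert (E2 : ex_series (fun n => u n x)).
  { apply (ex_series_dom _ A); auto. intros n. now apply Hu. }
  rewrite <- Series_minus by auto.
  unfold Rdiv. rewrite <- Series_scal_r.
  apply (Hdd h); auto.
  apply ball_0_R. eapply Rlt_le_trans; [exact Hh|apply Rmin_l].
Qed.

Lemma sumZ_continuous (u : Z -> R -> R) (B : Z -> R) (x : R) :
  summableZ B -> (forall n, continuous (u n) x) -> (forall n y, Rabs (u n y) <= B n) ->
  continuous (fun y => sumZ (fun n => u n y)) x.
Proof.
  intros HB Hc Hb. unfold sumZ.
  apply (continuous_plus (fun y => Series (fun n => u (Z.of_nat n) y))
    (fun y => Series (fun n => u (- Z.of_nat (S n))%Z y))).
  - apply (Series_continuous (fun n => u (Z.of_nat n)) (fun n => B (Z.of_nat n)));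
      auto using summableZ_right. apply filter_forall. auto.
  - apply (Series_continuous (fun n y => u (- Z.of_nat (S n))%Z y)
      (fun n => B (- Z.of_nat (S n))%Z)); auto using summableZ_left.
    apply filter_forall. auto.
Qed.

Lemma sumZ_derive (u u1 : Z -> R -> R) (A B : Z -> R) (x : R) :
  summableZ A -> summableZ B ->
  (forall n y, is_derive (u n) y (u1 n y) /\ Rabs (u n y) <= A n /\ Rabs (u1 n y) <= B n) ->
  is_derive (fun y => sumZ (fun n => u n y)) x (sumZ (fun n => u1 n x)).
Proof.
  intros HA HB Hu. unfold sumZ.
  apply (is_derive_plus (fun y => Series (fun n => u (Z.of_nat n) y))
    (fun y => Series (fun n => u (- Z.of_nat (S n))%Z y))).
  - apply (Series_derive (fun n => u (Z.of_nat n)) (fun n => u1 (Z.of_nat n))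
      (fun n => A (Z.of_nat n)) (fun n => B (Z.of_nat n)) x 1);
      auto using summableZ_right; lra.
  - apply (Series_derive (fun n y => u (- Z.of_nat (S n))%Z y)
      (fun n y => u1 (- Z.of_nat (S n))%Z y) (fun n => A (- Z.of_nat (S n))%Z)
      (fun n => B (- Z.of_nat (S n))%Z) x 1); auto using summableZ_left; lra.
Qed.

(** * Twice continuously differentiable complex functions of a real variable *)

Definition cderiv (F : R -> C) (x : R) (l : C) : Prop :=
  is_derive (fun y => fst (F y)) x (fst l) /\ is_derive (fun y => snd (F y)) x (snd l).

Definition ccont (F : R -> C) (x : R) : Prop :=
  continuous (fun y => fst (F y)) x /\ continuous (fun y => snd (F y)) x.

Definition C2_on (D : R -> Prop) (F F1 F2 : R -> C) : Prop :=
  forall x, D x -> cderiv F x (F1 x) /\ cderiv F1 x (F2 x) /\ ccont F2 x.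

Lemma cderiv_ccont (F : R -> C) (x : R) (l : C) : cderiv F x l -> ccont F x.
Proof.
  intros [H1 H2]. split; apply (ex_derive_continuous (V := R_NormedModule));
    eexists; eassumption.
Qed.

Lemma cderiv_plus (F G : R -> C) (x : R) (f g : C) :
  cderiv F x f -> cderiv G x g -> cderiv (fun y => F y + G y)%C x (f + g)%C.
Proof.
  intros [F1 F2] [G1 G2]. split.
  - apply (is_derive_plus (fun y => fst (F y)) (fun y => fst (G y))); auto.
  - apply (is_derive_plus (fun y => snd (F y)) (fun y => snd (G y))); auto.
Qed.

Lemma cderiv_mult (F G : R -> C) (x : R) (f g : C) :
  cderiv F x f -> cderiv G x g ->
  cderiv (fun y => F y * G y)%C x (f * G x + F x * g)%C.
Proof.
  intros [F1 F2] [G1 G2]. split; simpl.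
  - evar_last.
    + apply (is_derive_minus (fun y => fst (F y) * fst (G y)) (fun y => snd (F y) * snd (G y)));
      apply (is_derive_mult (K := R_AbsRing)); eauto; intros; apply Rmult_comm.
    + unfold minus, plus, opp, mult; simpl. ring.
  - evar_last.
    + apply (is_derive_plus (fun y => fst (F y) * snd (G y)) (fun y => snd (F y) * fst (G y)));
      apply (is_derive_mult (K := R_AbsRing)); eauto; intros; apply Rmult_comm.
    + unfold minus, plus, opp, mult; simpl. ring.
Qed.

Lemma ccont_plus (F G : R -> C) (x : R) :
  ccont F x -> ccont G x -> ccont (fun y => F y + G y)%C x.
Proof.
  intros [F1 F2] [G1 G2]. split.
  - apply (continuous_plus (fun y => fst (F y)) (fun y => fst (G y))); auto.
  - apply (continuous_plus (fun y => snd (F y)) (fun y => snd (G y))); auto.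
Qed.

Lemma ccont_mult (F G : R -> C) (x : R) :
  ccont F x -> ccont G x -> ccont (fun y => F y * G y)%C x.
Proof.
  intros [F1 F2] [G1 G2]. split.
  - apply (continuous_minus (fun y => fst (F y) * fst (G y)) (fun y => snd (F y) * snd (G y)));
    apply (continuous_mult (K := R_AbsRing)); auto.
  - apply (continuous_plus (fun y => fst (F y) * snd (G y)) (fun y => snd (F y) * fst (G y)));
    apply (continuous_mult (K := R_AbsRing)); auto.
Qed.

Lemma C2_on_plus D F F1 F2 G G1 G2 : C2_on D F F1 F2 -> C2_on D G G1 G2 ->
  C2_on D (fun y => F y + G y)%C (fun y => F1 y + G1 y)%C (fun y => F2 y + G2 y)%C.
Proof.
  intros HF HG x Hx. destruct (HF x Hx) as [A1 [A2 A3]], (HG x Hx) as [B1 [B2 B3]].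
  split; [now apply cderiv_plus|]. split; [now apply cderiv_plus|now apply ccont_plus].
Qed.

Lemma C2_on_mult D F F1 F2 G G1 G2 : C2_on D F F1 F2 -> C2_on D G G1 G2 ->
  C2_on D (fun y => F y * G y)%C (fun y => F1 y * G y + F y * G1 y)%C
    (fun y => (F2 y * G y + F1 y * G1 y) + (F1 y * G1 y + F y * G2 y))%C.
Proof.
  intros HF HG x Hx. destruct (HF x Hx) as [A1 [A2 A3]], (HG x Hx) as [B1 [B2 B3]].
  pose proof (cderiv_ccont _ _ _ A1). pose proof (cderiv_ccont _ _ _ A2).
  pose proof (cderiv_ccont _ _ _ B1). pose proof (cderiv_ccont _ _ _ B2).
  split; [now apply cderiv_mult|]. split.
  - apply cderiv_plus; now apply cderiv_mult.
  - apply ccont_plus; apply ccont_plus; now apply ccont_mult.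
Qed.

Lemma C2_on_const D (c : C) : C2_on D (fun _ => c) (fun _ => RtoC 0) (fun _ => RtoC 0).
Proof.
  assert (Hc : forall (c : C) x, cderiv (fun _ => c) x (RtoC 0)).
  { intros c' x. split; apply (is_derive_const (V := R_NormedModule)). }
  intros x _. split; [apply Hc|]. split; [apply Hc|]. apply (cderiv_ccont _ _ _ (Hc (RtoC 0) x)).
Qed.

Lemma C2_on_sub (D D' : R -> Prop) F F1 F2 :
  (forall x, D' x -> D x) -> C2_on D F F1 F2 -> C2_on D' F F1 F2.
Proof. intros H HF x Hx. apply HF; auto. Qed.

Lemma cderiv_unique (F G : R -> C) (x : R) (f g : C) :
  locally x (fun y => F y = G y) -> cderiv F x f -> cderiv G x g -> f = g.
Proof.
  intros HL [F1 F2] [G1 G2].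
  assert (H1 : fst f = fst g).
  { apply (is_derive_ext_loc _ (fun y => fst (G y))) in F1.
    - apply is_derive_unique in F1. apply is_derive_unique in G1. congruence.
    - revert HL. apply filter_imp. now intros y ->. }
  assert (H2 : snd f = snd g).
  { apply (is_derive_ext_loc _ (fun y => snd (G y))) in F2.
    - apply is_derive_unique in F2. apply is_derive_unique in G2. congruence.
    - revert HL. apply filter_imp. now intros y ->. }
  destruct f, g; simpl in *; congruence.
Qed.

Lemma C2_on_unique (D : R -> Prop) F F1 F2 G G1 G2 : open D ->
  (forall x, D x -> F x = G x) -> C2_on D F F1 F2 -> C2_on D G G1 G2 ->
  forall x, D x -> F1 x = G1 x /\ F2 x = G2 x.
Proof.
  intros HD HFG HF HG.
  assert (H1 : forall x, D x -> F1 x = G1 x).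
  { intros x Hx. apply (cderiv_unique F G x); [|now apply HF|now apply HG].
    generalize (HD x Hx). apply filter_imp. auto. }
  intros x Hx. split; auto.
  apply (cderiv_unique F1 G1 x); [|now apply HF|now apply HG].
  generalize (HD x Hx). apply filter_imp. auto.
Qed.

(** Control of the 2-jet at a point: [lambda] bounds the cost of a derivative. In this
    form the product rule adds the costs [lambda] and multiplies the sizes [X]. *)
Definition jet_bound (D : R -> Prop) (x : R) (F : R -> C) (lambda X : R) : Prop :=
  exists F1 F2, C2_on D F F1 F2 /\ Cmod (F x) <= X /\
    Cmod (F1 x) <= lambda * X /\ Cmod (F2 x) <= lambda ^ 2 * X.

Lemma jet_bound_mult D x F G l m X Y : 0 <= l -> 0 <= m ->
  jet_bound D x F l X -> jet_bound D x G m Y ->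
  jet_bound D x (fun y => F y * G y)%C (l + m) (X * Y).
Proof.
  intros Hl Hm [F1 [F2 [HF [A0 [A1 A2]]]]] [G1 [G2 [HG [B0 [B1 B2]]]]].
  do 2 eexists. split; [now apply C2_on_mult; eauto|].
  pose proof (Cmod_ge_0 (F x)). pose proof (Cmod_ge_0 (F1 x)). pose proof (Cmod_ge_0 (F2 x)).
  pose proof (Cmod_ge_0 (G x)). pose proof (Cmod_ge_0 (G1 x)). pose proof (Cmod_ge_0 (G2 x)).
  assert (P : forall a b c d, 0 <= a -> 0 <= b -> a <= c -> b <= d -> a * b <= c * d)
    by (intros; now apply Rmult_le_compat).
  split; [|split].
  - rewrite Cmod_mult. now apply P.
  - eapply Rle_trans; [apply Cmod_triangle|]. rewrite !Cmod_mult.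
    assert (Cmod (F1 x) * Cmod (G x) <= l * X * Y) by now apply P.
    assert (Cmod (F x) * Cmod (G1 x) <= X * (m * Y)) by now apply P. lra.
  - eapply Rle_trans; [apply Cmod_triangle|].
    pose proof (Cmod_triangle (F2 x * G x) (F1 x * G1 x)) as T1.
    pose proof (Cmod_triangle (F1 x * G1 x) (F x * G2 x)) as T2.
    rewrite !Cmod_mult in *.
    assert (Cmod (F2 x) * Cmod (G x) <= l ^ 2 * X * Y) by now apply P.
    assert (Cmod (F1 x) * Cmod (G1 x) <= l * X * (m * Y)) by now apply P.
    assert (Cmod (F x) * Cmod (G2 x) <= X * (m ^ 2 * Y)) by now apply P. lra.
Qed.

Lemma jet_bound_plus D x F G l X Y :
  jet_bound D x F l X -> jet_bound D x G l Y ->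
  jet_bound D x (fun y => F y + G y)%C l (X + Y).
Proof.
  intros [F1 [F2 [HF [A0 [A1 A2]]]]] [G1 [G2 [HG [B0 [B1 B2]]]]].
  do 2 eexists. split; [now apply C2_on_plus; eauto|].
  rewrite !Rmult_plus_distr_l.
  repeat split; (eapply Rle_trans; [apply Cmod_triangle|]); lra.
Qed.

Lemma jet_bound_mono D x F l m X Y : 0 <= l <= m -> X <= Y ->
  jet_bound D x F l X -> jet_bound D x F m Y.
Proof.
  intros Hl HX [F1 [F2 [HF [A0 [A1 A2]]]]]. exists F1, F2. split; auto.
  pose proof (Cmod_ge_0 (F x)).
  assert (l ^ 2 <= m ^ 2) by (apply pow_incr; lra).
  assert (0 <= l ^ 2) by apply pow2_ge_0.
  repeat split; [lra| |].
  - eapply Rle_trans; [exact A1|]. apply Rmult_le_compat; lra.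
  - eapply Rle_trans; [exact A2|]. apply Rmult_le_compat; lra.
Qed.

Lemma jet_bound_const D x (c : C) l : 0 <= l -> jet_bound D x (fun _ => c) l (Cmod c).
Proof.
  intros Hl. do 2 eexists. split; [apply C2_on_const|].
  pose proof (Cmod_ge_0 c). cbv beta. rewrite Cmod_0.
  repeat split; [lra| |]; apply Rmult_le_pos; auto. apply pow2_ge_0.
Qed.

(** * Differentiation of Fourier transforms *)

Lemma is_derive_cos_scal (c s x : R) :
  is_derive (fun y => c * cos (s * y)) x (- s * c * sin (s * x)).
Proof. auto_derive; auto. ring. Qed.

Lemma is_derive_sin_scal (c s x : R) :
  is_derive (fun y => c * sin (s * y)) x (s * c * cos (s * x)).
Proof. auto_derive; auto. ring. Qed.

Lemma Rabs_mult_le_l (a b : R) : Rabs b <= 1 -> Rabs (a * b) <= Rabs a.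
Proof.
  intros H. rewrite Rabs_mult. pose proof (Rabs_pos a). pose proof (Rabs_pos b). nra.
Qed.

(** Multiplication by [n^j], the counterpart on coefficients of [j] derivatives of the
    transform, up to powers of [i]. *)
Definition weighted (j : nat) (a : Z -> R) : Z -> R := fun n => IZR n ^ j * a n.

Lemma cderiv_fourier (a : Z -> R) (x : R) :
  summableZ a -> summableZ (weighted 1 a) ->
  cderiv (fourier a) x (Ci * fourier (weighted 1 a) x)%C.
Proof.
  intros H0 H1. apply summableZ_abs in H0. apply summableZ_abs in H1.
  unfold weighted in *. split; unfold Cmult, Ci, fourier; cbn [fst snd].
  - match goal with |- is_derive _ _ ?l =>
      replace l with (sumZ (fun n => - (IZR n ^ 1) * a n * sin (IZR n * x))) end.
    + apply (sumZ_derive (fun n y => a n * cos (IZR n * y))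
        (fun n y => - (IZR n ^ 1) * a n * sin (IZR n * y)) _ _ x H0 H1).
      intros n y. split; [rewrite pow_1; apply is_derive_cos_scal|]. split.
      * apply Rabs_mult_le_l, abs_cos_le.
      * eapply Rle_trans; [apply Rabs_mult_le_l, abs_sin_le|].
        rewrite Rabs_mult, Rabs_Ropp, <- Rabs_mult. lra.
    + rewrite Rmult_0_l, Rmult_1_l. unfold Rminus. rewrite Rplus_0_l.
      replace (- sumZ (fun n => IZR n ^ 1 * a n * sin (IZR n * x)))
        with ((-1) * sumZ (fun n => IZR n ^ 1 * a n * sin (IZR n * x))) by ring.
      rewrite <- sumZ_scal. apply sumZ_ext; intros; ring.
  - match goal with |- is_derive _ _ ?l =>
      replace l with (sumZ (fun n => IZR n ^ 1 * a n * cos (IZR n * x))) by ring end.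
    apply (sumZ_derive (fun n y => a n * sin (IZR n * y))
      (fun n y => IZR n ^ 1 * a n * cos (IZR n * y)) _ _ x H0 H1).
    intros n y. split; [rewrite pow_1; apply is_derive_sin_scal|]. split; apply Rabs_mult_le_l;
      [apply abs_sin_le|apply abs_cos_le].
Qed.

Lemma ccont_fourier (a : Z -> R) (x : R) : summableZ a -> ccont (fourier a) x.
Proof.
  intros H0. apply summableZ_abs in H0.
  split; simpl.
  - apply (sumZ_continuous (fun n y => a n * cos (IZR n * y)) _ x H0).
    + intros n. apply (ex_derive_continuous (V := R_NormedModule)).
      eexists. apply is_derive_cos_scal.
    + intros n y. apply Rabs_mult_le_l, abs_cos_le.
  - apply (sumZ_continuous (fun n y => a n * sin (IZR n * y)) _ x H0).
    + intros n. apply (ex_derive_continuous (V := R_NormedModule)).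
      eexists. apply is_derive_sin_scal.
    + intros n y. apply Rabs_mult_le_l, abs_sin_le.
Qed.

Lemma summable_first_moment (a : Z -> R) :
  summableZ (weighted 2 a) -> summableZ (weighted 1 a).
Proof.
  intros H. apply (summableZ_dom _ (fun n => Rabs (weighted 2 a n))); [|now apply summableZ_abs].
  intros n. unfold weighted. rewrite !Rabs_mult, pow_1. apply Rmult_le_compat_r; [apply Rabs_pos|].
  rewrite <- RPow_abs, <- abs_IZR.
  assert (E : IZR (Z.abs n) ^ 2 = IZR (Z.abs n * Z.abs n)) by (rewrite mult_IZR; ring).
  rewrite E. apply IZR_le. nia.
Qed.

Lemma C2_on_fourier (D : R -> Prop) (a : Z -> R) :
  summableZ a -> summableZ (weighted 2 a) ->
  C2_on D (fourier a) (fun x => Ci * fourier (weighted 1 a) x)%C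
    (fun x => Ci * (Ci * fourier (weighted 2 a) x))%C.
Proof.
  intros H0 H2 x _. assert (H1 := summable_first_moment a H2).
  assert (E : weighted 1 (weighted 1 a) = weighted 2 a)
    by (extensionality i; unfold weighted; ring).
  split; [now apply cderiv_fourier|].
  assert (Hc : forall y, cderiv (fun _ => Ci) y (RtoC 0)).
  { intros y. split; apply (is_derive_const (V := R_NormedModule)). }
  split.
  - replace (Ci * (Ci * fourier (weighted 2 a) x))%C
      with (RtoC 0 * fourier (weighted 1 a) x
            + Ci * (Ci * fourier (weighted 2 a) x))%C by ring.
    apply (cderiv_mult (fun _ => Ci)); auto.
    rewrite <- E. apply cderiv_fourier; auto. now rewrite E.
  - assert (Hcc : ccont (fun _ => Ci) x) by (apply (cderiv_ccont _ _ _ (Hc x))).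
    apply (ccont_mult (fun _ => Ci)); auto. apply (ccont_mult (fun _ => Ci)); auto.
    now apply ccont_fourier.
Qed.

Lemma Cmod_Ci_mult (z : C) : Cmod (Ci * z)%C = Cmod z.
Proof. rewrite Cmod_mult, Cmod_Ci. ring. Qed.

(** * Differentials and continuity within a set *)

Lemma filterdiff_within {V : NormedModule R_AbsRing} (D : R -> Prop) (f : R -> V) (x : R) (l : V) :
  D x -> is_derive f x l ->
  filterdiff f (within D (locally x)) (fun h : R => scal h l).
Proof.
  intros Hx [HL Hf]. split; auto. intros y Hy.
  assert (Exy : x = y).
  { (* x lies in D, so it lies in every neighbourhood of y *)
    apply (is_filter_lim_unique (F := locally x) x y).
    - intros P HP; exact HP.
    - intros P HP. destruct (Req_dec x y) as [<-|Hne]; auto. exfalso.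
      assert (He : 0 < Rabs (x - y) / 2).
      { assert (0 < Rabs (x - y)) by (apply Rabs_pos_lt; lra). lra. }
      assert (HB : locally y (fun z => Rabs (z - y) < Rabs (x - y) / 2))
        by (exists (mkposreal _ He); intros z Hz; exact Hz).
      pose proof (locally_singleton _ _ (Hy _ HB) Hx). simpl in *. lra. }
  subst y. intros eps. specialize (Hf x (fun P HP => HP) eps).
  unfold within. revert Hf. apply filter_imp. auto.
Qed.

Lemma filterlim_within {U : UniformSpace} (f : R -> U) (D : R -> Prop) (x : R) :
  continuous f x -> filterlim f (within D (locally x)) (locally (f x)).
Proof.
  intros H. apply (filterlim_filter_le_1 (F := locally x) (G := within D (locally x))); auto.
  intros P HP. unfold within. revert HP. apply filter_imp. auto.
Qed.

Lemma C1_on_R (D : R -> Prop) (f f1 : R -> R) :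
  (forall x, D x -> is_derive f x (f1 x)) -> (forall x, D x -> continuous f1 x) ->
  C1_on (V := R_NormedModule) D f f1.
Proof.
  intros Hf Hf1. split.
  - intros x Hx. apply filterdiff_within; auto.
  - intros x Hx. exact (filterlim_within f1 D x (Hf1 x Hx)).
Qed.

Lemma is_derive_C (F : R -> C) (x : R) (l : C) : cderiv F x l ->
  is_derive (V := C_R_NormedModule) F x l.
Proof.
  intros [H1 H2].
  assert (H : filterdiff (fun y => (fst (F y), snd (F y)) : prod_NormedModule _ _ _)
    (locally x) (fun h => (scal h (fst l), scal h (snd l)))).
  { apply (filterdiff_comp'_2 (fun y => fst (F y)) (fun y => snd (F y))
      (fun a b => (a, b) : prod_NormedModule R_AbsRing R_NormedModule R_NormedModule)
      x (fun h => scal h (fst l)) (fun h => scal h (snd l)) (fun a b => (a, b))); auto.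
    apply (filterdiff_ext_lin _ (fun t => t)); [|now intros []].
    apply (filterdiff_ext (fun t => t)); [now intros []|].
    apply filterdiff_id. }
  replace F with (fun y => (fst (F y), snd (F y)))
    by (extensionality y; now destruct (F y)).
  exact H.
Qed.

Lemma C1_on_C (D : R -> Prop) (F F1 : R -> C) :
  (forall x, D x -> cderiv F x (F1 x)) -> (forall x, D x -> ccont F1 x) ->
  C1_on (V := C_R_NormedModule) D F F1.
Proof.
  intros HF HF1. split.
  - intros x Hx. apply filterdiff_within; auto. now apply is_derive_C, HF.
  - intros x Hx. destruct (HF1 x Hx) as [A B].
    apply filterlim_within. apply filterlim_locally. intros eps.
    pose proof (proj1 (filterlim_locally _ _) A eps) as A'.
    pose proof (proj1 (filterlim_locally _ _) B eps) as B'.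
    generalize (filter_and _ _ A' B'). apply filter_imp. now intros y [? ?].
Qed.

(** * Summation by parts *)

Lemma Delta_series_0 (u : nat -> R) : (forall n, 0 <= u n) -> (forall n, 0 <= Delta u n) ->
  ex_series (Delta u) /\ Series (Delta u) <= u 0%nat.
Proof.
  intros H0 H1.
  assert (Hs : forall n, sum_n (Delta u) n <= u 0%nat).
  { intros n. enough (sum_n (Delta u) n = u 0%nat - u (S n) :> R) by (specialize (H0 (S n)); lra).
    symmetry. induction n as [|n IH]; [now rewrite sum_O|].
    rewrite sum_n_Sn_R, <- IH. unfold Delta. ring. }
  assert (E := ex_series_bounded _ _ H1 Hs).
  split; auto. now apply Series_le_of_sums.
Qed.

Lemma Delta_series_1 (u : nat -> R) : (forall n, 0 <= u n) -> (forall n, 0 <= Delta u n) ->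
  ex_series u ->
  ex_series (fun k => INR k * Delta u k) /\ Series (fun k => INR k * Delta u k) <= Series u.
Proof.
  intros H0 H1 Hu.
  assert (Hs : forall n, sum_n (fun k => INR k * Delta u k) n <= Series u).
  { intros n. eapply Rle_trans; [|now apply (sum_n_le_Series u n)].
    enough (sum_n (fun k => INR k * Delta u k) n + INR n * u (S n) <= sum_n u n).
    { pose proof (Rmult_le_pos _ _ (pos_INR n) (H0 (S n))). lra. }
    induction n as [|n IH].
    - rewrite !sum_O. simpl. specialize (H0 0%nat). lra.
    - rewrite !sum_n_Sn_R. unfold Delta at 2. rewrite S_INR. lra. }
  assert (E : ex_series (fun k => INR k * Delta u k)).
  { apply (ex_series_bounded _ (Series u)); auto. intros k. apply Rmult_le_pos; auto using pos_INR. }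
  split; auto. now apply Series_le_of_sums.
Qed.

Lemma Delta_series_2 (u : nat -> R) : (forall n, 0 <= u n) -> (forall n, 0 <= Delta u n) ->
  ex_series (fun k => INR k * u k) ->
  ex_series (fun k => INR k ^ 2 * Delta u k) /\
  Series (fun k => INR k ^ 2 * Delta u k) <= 2 * Series (fun k => INR k * u k).
Proof.
  intros H0 H1 Hu.
  assert (Hs : forall n, sum_n (fun k => INR k ^ 2 * Delta u k) n
                         <= 2 * Series (fun k => INR k * u k)).
  { intros n. apply Rle_trans with (2 * sum_n (fun k => INR k * u k) n).
    2:{ apply Rmult_le_compat_l; [lra|]. apply (sum_n_le_Series (fun k => INR k * u k) n); auto.
        intros k. apply Rmult_le_pos; auto using pos_INR. }
    enough (sum_n (fun k => INR k ^ 2 * Delta u k) n + INR n ^ 2 * u (S n)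
            <= 2 * sum_n (fun k => INR k * u k) n).
    { pose proof (Rmult_le_pos _ _ (pow2_ge_0 (INR n)) (H0 (S n))). lra. }
    induction n as [|n IH].
    - rewrite !sum_O. simpl. lra.
    - rewrite !sum_n_Sn_R. unfold Delta at 2. rewrite S_INR.
      specialize (H0 (S n)). pose proof (pos_INR n). nra. }
  assert (E : ex_series (fun k => INR k ^ 2 * Delta u k)).
  { apply (ex_series_bounded _ (2 * Series (fun k => INR k * u k))); auto.
    intros k. apply Rmult_le_pos; auto using pow2_ge_0. }
  split; auto. now apply Series_le_of_sums.
Qed.

Lemma Delta_shift (u : nat -> R) (L : nat) :
  Delta (fun k => u (L + k)%nat) = (fun k => Delta u (L + k)%nat).
Proof.
  extensionality n. unfold Delta.
  now rewrite Nat.add_succ_r.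
Qed.

(** The value [u m] is at least the sum of the [N] decrements that follow it, of which the
    last is the smallest. *)
Lemma convex_gap (u : nat -> R) (m N : nat) : (forall n, 0 <= u n) ->
  (forall n, 0 <= Delta (Delta u) n) -> INR N * Delta u (m + N)%nat <= u m.
Proof.
  intros H0 H2.
  enough (u (m + N)%nat + INR N * Delta u (m + N)%nat <= u m) by (specialize (H0 (m + N)%nat); lra).
  induction N as [|N IH].
  - rewrite Nat.add_0_r. simpl. lra.
  - rewrite Nat.add_succ_r, S_INR. specialize (H2 (m + N)%nat).
    unfold Delta at 1 in H2. pose proof (pos_INR N).
    assert (E : u (m + N)%nat = u (S (m + N)) + Delta u (m + N)%nat) by (unfold Delta; ring).
    nra.
Qed.

(** * Power series on the unit circle *)

Definition circle_pow (m : nat) (theta : R) : C := (cos (INR m * theta), sin (INR m * theta)).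

Definition circle_series (v : nat -> R) (theta : R) : C := fourier (ext v) theta.

Definition off_one (theta : R) : Prop := cos theta <> 1.

Lemma open_off_one : open off_one.
Proof.
  apply (open_comp cos (fun y => y <> 1)); [|apply open_neq].
  intros x _. apply continuous_cos.
Qed.

Lemma circle_pow_0 (theta : R) : circle_pow 0 theta = RtoC 1.
Proof. unfold circle_pow. simpl INR. rewrite Rmult_0_l, cos_0, sin_0. reflexivity. Qed.

Lemma circle_pow_S (m : nat) (theta : R) : circle_pow (S m) theta = (circle_pow m theta * circle_pow 1 theta)%C.
Proof.
  unfold circle_pow, Cmult. rewrite S_INR. cbn [fst snd]. simpl (INR 1).
  rewrite Rmult_1_l, Rmult_plus_distr_r, Rmult_1_l, cos_plus, sin_plus.
  f_equal; ring.
Qed.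

Lemma circle_pow_fourier (m : nat) :
  circle_pow m = fourier (fun n => if Z.eq_dec n (Z.of_nat m) then 1 else 0).
Proof.
  extensionality theta. unfold circle_pow, fourier. f_equal.
  - rewrite <- (proj2 (sumZ_single (Z.of_nat m) (cos (INR m * theta)))).
    apply sumZ_ext. intros n. destruct (Z.eq_dec n (Z.of_nat m)) as [->|]; [|ring].
    rewrite <- INR_IZR_INZ. ring.
  - rewrite <- (proj2 (sumZ_single (Z.of_nat m) (sin (INR m * theta)))).
    apply sumZ_ext. intros n. destruct (Z.eq_dec n (Z.of_nat m)) as [->|]; [|ring].
    rewrite <- INR_IZR_INZ. ring.
Qed.

Lemma C2_on_circle_pow (D : R -> Prop) (m : nat) : exists Z1 Z2, C2_on D (circle_pow m) Z1 Z2 /\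
  forall x, Cmod (circle_pow m x) <= 1 /\ Cmod (Z1 x) <= INR m /\ Cmod (Z2 x) <= INR m ^ 2.
Proof.
  rewrite circle_pow_fourier.
  set (a := fun n : Z => if Z.eq_dec n (Z.of_nat m) then 1 else 0).
  assert (Hw : forall j, summableZ (weighted j a) /\ l1norm (weighted j a) = INR m ^ j).
  { intros j.
    assert (E : weighted j a = fun n => if Z.eq_dec n (Z.of_nat m) then INR m ^ j else 0).
    { extensionality n. unfold weighted, a.
      destruct (Z.eq_dec n (Z.of_nat m)) as [->|]; [|ring].
      rewrite <- INR_IZR_INZ. ring. }
    rewrite E. split; [apply sumZ_single|]. rewrite l1norm_of_nonneg; [apply sumZ_single|].
    intros n. destruct (Z.eq_dec n (Z.of_nat m)); [|lra]. apply pow_le, pos_INR. }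
  assert (E0 : a = weighted 0 a)
    by (extensionality i; unfold weighted; simpl; ring).
  assert (Ha : summableZ a) by (rewrite E0; apply Hw).
  do 2 eexists. split; [apply C2_on_fourier; [exact Ha|apply Hw]|].
  intros x. cbv beta. rewrite !Cmod_Ci_mult. split; [|split].
  - eapply Rle_trans; [now apply Cmod_fourier_le|]. rewrite E0, (proj2 (Hw 0%nat)). simpl; lra.
  - eapply Rle_trans; [apply Cmod_fourier_le, Hw|]. rewrite (proj2 (Hw 1%nat)), pow_1. lra.
  - eapply Rle_trans; [apply Cmod_fourier_le, Hw|]. rewrite (proj2 (Hw 2%nat)). lra.
Qed.

Lemma jet_bound_circle_pow D x m : jet_bound D x (circle_pow m) (INR m) 1.
Proof.
  destruct (C2_on_circle_pow D m) as [Z1 [Z2 [HZ Hb]]]. exists Z1, Z2. split; auto.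
  rewrite !Rmult_1_r. apply Hb.
Qed.

Lemma weighted_ext (j : nat) (v : nat -> R) : weighted j (ext v) = ext (fun k => INR k ^ j * v k).
Proof.
  extensionality n. unfold weighted, ext.
  destruct (Z_lt_dec n 0); [ring|]. now rewrite INR_IZR_INZ, Z2Nat.id by lia.
Qed.

Lemma l1norm_ext_nonneg (v : nat -> R) : (forall n, 0 <= v n) -> l1norm (ext v) = Series v.
Proof.
  intros H. rewrite l1norm_of_nonneg, sumZ_ext_nat; auto.
  intros n. unfold ext. destruct (Z_lt_dec n 0); [lra|auto].
Qed.

Lemma jet_bound_circle_series D x (v : nat -> R) l X : (forall n, 0 <= v n) ->
  ex_series v -> ex_series (fun k => INR k ^ 2 * v k) ->
  Series v <= X -> Series (fun k => INR k * v k) <= l * X ->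
  Series (fun k => INR k ^ 2 * v k) <= l ^ 2 * X -> jet_bound D x (circle_series v) l X.
Proof.
  intros H0 E0 E2 B0 B1 B2.
  assert (S0 : summableZ (ext v)) by now apply ext_summable, ex_series_abs_of_nonneg.
  assert (P2 : forall n, 0 <= INR n ^ 2 * v n)
    by (intros; apply Rmult_le_pos; auto using pow2_ge_0).
  assert (P1 : forall n, 0 <= INR n ^ 1 * v n)
    by (intros; apply Rmult_le_pos; auto; rewrite pow_1; apply pos_INR).
  assert (S2 : summableZ (weighted 2 (ext v)))
    by (rewrite weighted_ext; now apply ext_summable, ex_series_abs_of_nonneg).
  assert (S1 := summable_first_moment _ S2).
  do 2 eexists. split; [now apply (C2_on_fourier D (ext v))|].
  cbv beta. rewrite !Cmod_Ci_mult. split; [|split].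
  - eapply Rle_trans; [now apply Cmod_fourier_le|]. now rewrite l1norm_ext_nonneg.
  - eapply Rle_trans; [now apply Cmod_fourier_le|].
    rewrite weighted_ext, l1norm_ext_nonneg by auto.
    rewrite (Series_ext _ (fun k => INR k * v k)); auto. intros; now rewrite pow_1.
  - eapply Rle_trans; [now apply Cmod_fourier_le|].
    now rewrite weighted_ext, l1norm_ext_nonneg by auto.
Qed.

Lemma circle_series_step (v : nat -> R) (theta : R) : (forall n, 0 <= v n) -> ex_series v ->
  circle_series v theta = (RtoC (v 0%nat) + circle_pow 1 theta * circle_series (fun k => v (S k)) theta)%C.
Proof.
  intros H0 Hv.
  assert (Hb : forall (g : nat -> R), (forall k, Rabs (g k) <= 1) ->
    ex_series (fun k => v k * g k) /\ ex_series (fun k => v (S k) * g k)).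
  { intros g Hg. assert (Hv' := proj1 (ex_series_incr_1 v) Hv).
    split; [|apply (ex_series_mult_bounded (fun k => v (S k)))];
      auto using ex_series_mult_bounded. }
  assert (Hc : forall k, Rabs (cos (INR k * theta)) <= 1) by (intros; apply abs_cos_le).
  assert (Hs : forall k, Rabs (sin (INR k * theta)) <= 1) by (intros; apply abs_sin_le).
  destruct (Hb _ Hc) as [C0 C1]. destruct (Hb _ Hs) as [S0 S1].
  unfold circle_series. rewrite !fourier_ext. unfold circle_pow, Cmult, Cplus, RtoC.
  cbn [fst snd]. change (INR 1) with 1. rewrite Rmult_1_l.
  set (X := Series (fun k => v (S k) * cos (INR k * theta))).
  set (Y := Series (fun k => v (S k) * sin (INR k * theta))).
  f_equal.
  - rewrite Series_incr_1 by auto. change (INR 0) with 0. rewrite Rmult_0_l, cos_0.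
    rewrite (Series_ext _ (fun k => cos theta * (v (S k) * cos (INR k * theta))
      - sin theta * (v (S k) * sin (INR k * theta)))).
    + rewrite Series_minus, !Series_scal_l by now apply ex_series_scalR. fold X Y. ring.
    + intros k. rewrite S_INR, Rmult_plus_distr_r, Rmult_1_l, cos_plus. ring.
  - rewrite Series_incr_1 by auto. change (INR 0) with 0. rewrite Rmult_0_l, sin_0.
    rewrite (Series_ext _ (fun k => cos theta * (v (S k) * sin (INR k * theta))
      + sin theta * (v (S k) * cos (INR k * theta)))).
    + rewrite Series_plus, !Series_scal_l by now apply ex_series_scalR. fold X Y. ring.
    + intros k. rewrite S_INR, Rmult_plus_distr_r, Rmult_1_l, sin_plus. ring.
Qed.

Lemma circle_series_Delta (v : nat -> R) (theta : R) : (forall n, 0 <= v n) -> ex_series v ->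
  circle_series (Delta v) theta = (circle_series v theta + RtoC (-1) * circle_series (fun k => v (S k)) theta)%C.
Proof.
  intros H0 Hv.
  assert (Hv' := proj1 (ex_series_incr_1 v) Hv).
  unfold circle_series. rewrite <- fourier_scal, <- fourier_plus.
  - f_equal. extensionality n. unfold ext, Delta.
    destruct (Z_lt_dec n 0); ring.
  - now apply ext_summable, ex_series_abs_of_nonneg.
  - apply summableZ_scal. apply ext_summable, ex_series_abs_of_nonneg; auto.
Qed.

(** [1 / (1 - exp (i theta))], whose real part is constant. *)
Definition inv_one_minus_z (theta : R) : C := (1 / 2, sin theta / (2 * (1 - cos theta))).

Lemma inv_one_minus_z_inv (theta : R) : off_one theta -> (inv_one_minus_z theta * (1 - circle_pow 1 theta))%C = RtoC 1.
Proof.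
  intros H. unfold off_one in H. unfold inv_one_minus_z, circle_pow, Cmult, Cminus, Cplus, Copp, RtoC.
  cbn [fst snd]. change (INR 1) with 1. rewrite Rmult_1_l.
  pose proof (sin2_cos2 theta) as Hsc. unfold Rsqr in Hsc.
  set (c := cos theta) in *. set (s := sin theta) in *.
  assert (Hc : 1 - c <> 0) by lra.
  f_equal.
  - apply Rmult_eq_reg_l with (2 * (1 - c)); [|lra].
    replace (2 * (1 - c) * (1 / 2 * (1 + - c) - s / (2 * (1 - c)) * (0 + - s)))
      with ((1 - c) * (1 - c) + s * s) by (field; lra). lra.
  - field. lra.
Qed.

(** [(1 - z) sum v_k z^k = v_0 - z sum (Delta v)_k z^k]. *)
Lemma circle_series_Abel (v : nat -> R) (theta : R) : (forall n, 0 <= v n) -> ex_series v ->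
  off_one theta ->
  circle_series v theta
  = (inv_one_minus_z theta * (RtoC (v 0%nat) + RtoC (-1) * (circle_pow 1 theta * circle_series (Delta v) theta)))%C.
Proof.
  intros H0 Hv Ht.
  pose proof (circle_series_step v theta H0 Hv) as E1.
  rewrite (circle_series_Delta v theta H0 Hv).
  set (X := circle_series v theta) in *. set (Y := circle_series (fun k => v (S k)) theta) in *.
  set (z := circle_pow 1 theta) in *.
  assert (E2 : (RtoC (v 0%nat) + RtoC (-1) * (z * (X + RtoC (-1) * Y)))%C = ((1 - z) * X)%C).
  { replace (RtoC (v 0%nat)) with (X - z * Y)%C by (rewrite E1; ring).
    replace (RtoC (-1)) with (- (1))%C; [ring|]. unfold Copp, RtoC; simpl. f_equal; ring. }
  rewrite E2, Cmult_assoc. unfold z. rewrite inv_one_minus_z_inv by auto. ring.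
Qed.

Lemma sin_sq (x : R) : sin x * sin x = 1 - cos x * cos x.
Proof. pose proof (sin2_cos2 x) as H. unfold Rsqr in H. lra. Qed.

Lemma is_derive_inv_one_minus_z (x : R) : off_one x ->
  is_derive (fun y => sin y / (2 * (1 - cos y))) x (- / (2 * (1 - cos x))) /\
  is_derive (fun y => - / (2 * (1 - cos y))) x (sin x / (2 * (1 - cos x) ^ 2)) /\
  continuous (fun y => sin y / (2 * (1 - cos y) ^ 2)) x.
Proof.
  intros Hx. unfold off_one in Hx. assert (Hc : 1 - cos x <> 0) by lra.
  assert (H2 : 2 * (1 - cos x) <> 0) by lra.
  split; [|split].
  - auto_derive; [lra|]. pose proof (sin_sq x) as Hs.
    set (c := cos x) in *. set (s := sin x) in *.
    apply Rmult_eq_reg_l with (2 * (1 - c) * (1 - c)); [|apply Rmult_integral_contrapositive; split; lra].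
    match goal with |- ?l = _ => replace l with ((1 - c) * c - s * s) by (field; lra) end.
    rewrite Hs. field. lra.
  - auto_derive; [lra|]. field. lra.
  - apply (ex_derive_continuous (V := R_NormedModule)). auto_derive.
    apply Rmult_integral_contrapositive; split; [lra|].
    rewrite Rmult_1_r. apply Rmult_integral_contrapositive; split; lra.
Qed.

Lemma Cmod_imag (y : R) : Cmod (0, y) = Rabs y.
Proof. unfold Cmod; simpl. rewrite <- sqrt_Rsqr_abs. f_equal. unfold Rsqr. ring. Qed.

Lemma jet_bound_inv_one_minus_z (x Lambda : R) : off_one x -> 0 <= Lambda ->
  / (2 * (1 - cos x)) <= Lambda ^ 2 -> jet_bound off_one x inv_one_minus_z (2 * Lambda) Lambda.
Proof.
  intros Hx HL Hb.
  exists (fun y => (0, - / (2 * (1 - cos y)))), (fun y => (0, sin y / (2 * (1 - cos y) ^ 2))).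
  split.
  - intros y Hy. destruct (is_derive_inv_one_minus_z y Hy) as [D1 [D2 D3]].
    split; [|split]; split; simpl; auto; try apply (is_derive_const (V := R_NormedModule));
      try apply continuous_const.
  - assert (Hc : 0 < 1 - cos x) by (unfold off_one in Hx; pose proof (COS_bound x); lra).
    set (p := / (2 * (1 - cos x))) in *.
    assert (Hp : 0 < p) by (apply Rinv_0_lt_compat; lra).
    assert (HL2 : p <= Lambda * Lambda) by (simpl in Hb; lra).
    pose proof (sin_sq x) as Hs.
    split; [|split].
    + apply Rsqr_incr_0_var; auto. unfold Rsqr.
      assert (E : Cmod (inv_one_minus_z x) * Cmod (inv_one_minus_z x) = p).
      { transitivity (Cmod (inv_one_minus_z x) ^ 2); [ring|]. rewrite Cmod_sq. simpl.
        unfold p. apply Rmult_eq_reg_l with (4 * (1 - cos x) * (1 - cos x));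
          [|apply Rmult_integral_contrapositive; split; lra].
        match goal with |- ?l = _ =>
          replace l with ((1 - cos x) * (1 - cos x) + sin x * sin x) by (field; lra) end.
        rewrite Hs. field. lra. }
      lra.
    + rewrite Cmod_imag, Rabs_Ropp, Rabs_pos_eq by lra. fold p. nra.
    + rewrite Cmod_imag.
      (* square of the modulus: sin^2 <= 2 (1 - cos), hence at most 4 p^3 *)
      apply Rsqr_incr_0_var; [|apply Rmult_le_pos; auto; apply pow2_ge_0].
      rewrite <- Rsqr_abs. unfold Rsqr.
      assert (E : sin x / (2 * (1 - cos x) ^ 2) * (sin x / (2 * (1 - cos x) ^ 2))
                  = sin x * sin x * (4 * p * p * p * p)).
      { unfold p. field. lra. }
      assert (Hsp : sin x * sin x * p <= 1).
      { rewrite Hs. unfold p.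
        replace ((1 - cos x * cos x) * / (2 * (1 - cos x))) with ((1 + cos x) / 2)
          by (field; lra). pose proof (COS_bound x). lra. }
      rewrite E.
      assert (Hp3 : p * p * p <= (Lambda * Lambda) * (Lambda * Lambda) * (Lambda * Lambda)).
      { apply Rmult_le_compat; try lra; [nra|]. apply Rmult_le_compat; lra. }
      assert (0 < p * p * p) by (repeat apply Rmult_lt_0_compat; auto).
      replace (sin x * sin x * (4 * p * p * p * p))
        with (4 * (p * p * p) * (sin x * sin x * p)) by ring.
      replace ((2 * Lambda) ^ 2 * Lambda * ((2 * Lambda) ^ 2 * Lambda))
        with (16 * ((Lambda * Lambda) * (Lambda * Lambda) * (Lambda * Lambda))) by ring.
      apply Rle_trans with (4 * (p * p * p) * 1); [apply Rmult_le_compat_l; lra|]. lra.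
Qed.

Lemma C2_on_ext (D : R -> Prop) F G F1 F2 : open D -> (forall x, D x -> F x = G x) ->
  C2_on D F F1 F2 -> C2_on D G F1 F2.
Proof.
  intros HD HFG HF x Hx. destruct (HF x Hx) as [[A1 A2] [A3 A4]]. split; [|now split].
  assert (HL : locally x (fun y => F y = G y)).
  { generalize (HD x Hx). apply filter_imp. auto. }
  split.
  - apply (is_derive_ext_loc (fun y => fst (F y))); auto.
    revert HL. apply filter_imp. now intros y ->.
  - apply (is_derive_ext_loc (fun y => snd (F y))); auto.
    revert HL. apply filter_imp. now intros y ->.
Qed.

Lemma jet_bound_ext (D : R -> Prop) x F G l X : open D -> D x ->
  (forall x, D x -> F x = G x) -> jet_bound D x F l X -> jet_bound D x G l X.
Proof.
  intros HD Hx HFG [F1 [F2 [HF [A0 A1]]]]. exists F1, F2.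
  split; [now apply (C2_on_ext D F)|]. now rewrite <- HFG.
Qed.

Lemma jet_bound_Abel_step (x : R) (G : R -> C) (c l Y n : R) : off_one x ->
  0 <= l -> 0 <= n -> 0 <= c -> / (2 * (1 - cos x)) <= (2 * n) ^ 2 ->
  jet_bound off_one x G l Y ->
  jet_bound off_one x (fun y => inv_one_minus_z y * (RtoC c + RtoC (-1) * (circle_pow 1 y * G y)))%C
    (4 * n + (1 + l)) (2 * n * (c + Y)).
Proof.
  intros Hx Hl Hn Hc Hb HG.
  replace (4 * n) with (2 * (2 * n)) by ring.
  apply (jet_bound_mult off_one x inv_one_minus_z); try lra.
  - apply jet_bound_inv_one_minus_z; auto; lra.
  - apply jet_bound_plus.
    + apply (jet_bound_mono off_one x _ (1 + l) _ (Cmod (RtoC c))); [lra| |].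
      * rewrite Cmod_R, Rabs_pos_eq; lra.
      * apply jet_bound_const. lra.
    + apply (jet_bound_mono off_one x _ (0 + (1 + l)) (1 + l) (Cmod (RtoC (-1)) * (1 * Y)));
        [lra| |].
      * rewrite Cmod_R, Rabs_left by lra. lra.
      * apply (jet_bound_mult off_one x (fun _ => RtoC (-1))); try lra.
        -- apply jet_bound_const; lra.
        -- apply (jet_bound_mult off_one x (circle_pow 1)); try lra; [apply jet_bound_circle_pow|exact HG].
Qed.

(** Three summations by parts: the third differences have a finite second moment, which
    gives the regularity away from 0, and at distance [1/N] each factor
    [1 / (1 - z)] and each derivative costs at most a multiple of [N]. *)
Lemma jet_bound_tail (v : nat -> R) (x a : R) (N : nat) : (1 <= N)%nat -> off_one x ->
  / (2 * (1 - cos x)) <= (2 * INR N) ^ 2 ->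
  (forall n, 0 <= v n) -> (forall n, 0 <= Delta v n) ->
  (forall n, 0 <= Delta (Delta v) n) -> (forall n, 0 <= Delta (Delta (Delta v)) n) ->
  ex_series v -> v 0%nat <= a -> INR N * Delta v 0%nat <= a ->
  INR N ^ 2 * Delta (Delta v) 0%nat <= a ->
  jet_bound off_one x (circle_series v) (16 * INR N) (46 * INR N * a).
Proof.
  intros HN Hx Hb H0 H1 H2 H3 Hv B0 B1 B2.
  assert (Hn : 1 <= INR N) by (apply (le_INR 1); lia).
  set (n := INR N) in *.
  destruct (Delta_series_0 v H0 H1) as [E1 S1].
  destruct (Delta_series_0 _ H1 H2) as [E2 S2].
  destruct (Delta_series_0 _ H2 H3) as [E3 S3].
  destruct (Delta_series_1 _ H1 H2 E1) as [E2k S2k].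
  destruct (Delta_series_1 _ H2 H3 E2) as [E3k S3k].
  destruct (Delta_series_2 _ H2 H3 E2k) as [E3kk S3kk].
  set (d0 := v 0%nat) in *. set (d1 := Delta v 0%nat) in *.
  set (d2 := Delta (Delta v) 0%nat) in *.
  assert (P0 : 0 <= d0) by apply H0. assert (P1 : 0 <= d1) by apply H1.
  assert (P2 : 0 <= d2) by apply H2.
  set (X := d2 + d1 / n + 2 * d0 / n ^ 2).
  assert (Hq1 : 0 <= d1 / n) by (apply Rle_div_r; lra).
  assert (Hn2 : 0 < n ^ 2) by (apply pow_lt; lra).
  assert (Hq0 : 0 <= 2 * d0 / n ^ 2) by (apply Rle_div_r; lra).
  assert (Hjet3 : jet_bound off_one x (circle_series (Delta (Delta (Delta v)))) n X).
  { apply jet_bound_circle_series; auto.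
    - unfold X; lra.
    - assert (n * X = n * d2 + d1 + 2 * d0 / n) by (unfold X; field; lra).
      assert (0 <= n * d2) by (apply Rmult_le_pos; lra).
      assert (0 <= 2 * d0 / n) by (apply Rle_div_r; lra). lra.
    - assert (n ^ 2 * X = n ^ 2 * d2 + n * d1 + 2 * d0) by (unfold X; field; lra).
      assert (0 <= n ^ 2 * d2) by (apply Rmult_le_pos; lra).
      assert (0 <= n * d1) by (apply Rmult_le_pos; lra). lra. }
  apply (jet_bound_Abel_step x _ d2 n X n) in Hjet3; auto; try lra.
  apply (jet_bound_ext off_one x _ (circle_series (Delta (Delta v)))) in Hjet3;
    auto using open_off_one; [|intros y Hy; symmetry; now apply circle_series_Abel].
  apply (jet_bound_Abel_step x _ d1 _ _ n) in Hjet3; auto; try lra.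
  apply (jet_bound_ext off_one x _ (circle_series (Delta v))) in Hjet3;
    auto using open_off_one; [|intros y Hy; symmetry; now apply circle_series_Abel].
  apply (jet_bound_Abel_step x _ d0 _ _ n) in Hjet3; auto; try lra.
  apply (jet_bound_ext off_one x _ (circle_series v)) in Hjet3;
    auto using open_off_one; [|intros y Hy; symmetry; now apply circle_series_Abel].
  revert Hjet3. apply jet_bound_mono; [lra|].
  replace (2 * n * (d0 + 2 * n * (d1 + 2 * n * (d2 + X))))
    with (2 * n * d0 + 4 * n * (n * d1) + 8 * n * (n ^ 2 * d2)
          + 8 * n * (n ^ 2 * d2 + n * d1 + 2 * d0)) by (unfold X; field; lra).
  assert (Q : forall y, y <= a -> n * y <= n * a) by (intros; apply Rmult_le_compat_l; lra).
  pose proof (Q _ B0). pose proof (Q _ B1). pose proof (Q _ B2). lra.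
Qed.

Fixpoint head (v : nat -> R) (L : nat) (theta : R) : C :=
  match L with
  | O => (RtoC (v 0%nat) * circle_pow 0 theta)%C
  | S L' => (head v L' theta + RtoC (v L) * circle_pow L theta)%C
  end.

Lemma circle_series_head (v : nat -> R) (L : nat) (theta : R) : (forall n, 0 <= v n) -> ex_series v ->
  circle_series v theta
  = (head v L theta + circle_pow (S L) theta * circle_series (fun k => v (S L + k)%nat) theta)%C.
Proof.
  intros H0 Hv. induction L as [|L IH].
  - cbn [head]. rewrite (circle_series_step v) by auto. rewrite circle_pow_0. simpl. ring.
  - rewrite IH. cbn [head].
    rewrite (circle_series_step (fun k => v (S L + k)%nat));
      [|auto|now apply (proj1 (ex_series_incr_n v (S L)))].
    replace (fun k => v (S L + S k)%nat) with (fun k => v (S (S L) + k)%nat)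
      by (extensionality i; f_equal; lia).
    rewrite Nat.add_0_r, (circle_pow_S (S L)). ring.
Qed.

Lemma C2_on_head D (v : nat -> R) (L : nat) : (forall n, 0 <= v n) ->
  exists P1 P2, C2_on D (head v L) P1 P2 /\ forall x,
    Cmod (P1 x) <= truncated_mean v L /\ Cmod (P2 x) <= INR L * truncated_mean v L.
Proof.
  intros H0.
  assert (Hz : forall m, exists Q1 Q2,
    C2_on D (fun y => RtoC (v m) * circle_pow m y)%C Q1 Q2 /\ forall x,
    Cmod (Q1 x) <= INR m * v m /\ Cmod (Q2 x) <= INR m ^ 2 * v m).
  { intros m. destruct (C2_on_circle_pow D m) as [Z1 [Z2 [HZ Hb]]].
    do 2 eexists. split; [apply (C2_on_mult D _ _ _ _ _ _ (C2_on_const D (RtoC (v m))) HZ)|].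
    intros x. cbv beta. destruct (Hb x) as [_ [B1 B2]]. rewrite !Cmult_0_l, !Cplus_0_l.
    rewrite !Cmod_mult, !Cmod_R, !Rabs_pos_eq by auto.
    split; rewrite Rmult_comm; now apply Rmult_le_compat_r. }
  induction L as [|L IH].
  - destruct (Hz 0%nat) as [Q1 [Q2 [HQ Hb]]]. exists Q1, Q2. split; auto.
    intros x. destruct (Hb x) as [B1 B2]. rewrite <- sum_n_truncated_mean, sum_O.
    simpl in *. lra.
  - destruct IH as [P1 [P2 [HP HPb]]]. destruct (Hz (S L)) as [Q1 [Q2 [HQ HQb]]].
    do 2 eexists. split; [apply (C2_on_plus D _ _ _ _ _ _ HP HQ)|].
    intros x. cbv beta. destruct (HPb x) as [B1 B2]. destruct (HQb x) as [B3 B4].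
    rewrite <- sum_n_truncated_mean, sum_n_Sn_R, sum_n_truncated_mean.
    assert (HT : 0 <= truncated_mean v L).
    { eapply Rle_trans; [apply Cmod_ge_0|apply B1]. }
    split; (eapply Rle_trans; [apply Cmod_triangle|]); [lra|].
    apply Rle_trans with (INR L * truncated_mean v L + INR (S L) ^ 2 * v (S L)); [lra|].
    rewrite S_INR. lra.
Qed.

Lemma completely_monotone_Delta (t : nat -> R) : completely_monotone t ->
  (forall n, 0 <= t n) /\ (forall n, 0 <= Delta t n) /\
  (forall n, 0 <= Delta (Delta t) n) /\ (forall n, 0 <= Delta (Delta (Delta t)) n).
Proof.
  intros H. split; [exact (H 0%nat)|]. split; [exact (H 1%nat)|].
  split; [exact (H 2%nat)|exact (H 3%nat)].
Qed.

Lemma off_one_interval (x : R) : 0 < x < 2 * PI -> off_one x.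
Proof. intros H. unfold off_one. pose proof (cos_lt_1 x H). lra. Qed.

Lemma inv_one_minus_cos (x : R) (N : nat) : 0 < x <= PI -> (1 <= N)%nat ->
  PI / 2 <= INR N * x -> / (2 * (1 - cos x)) <= (2 * INR N) ^ 2.
Proof.
  intros Hx HN HNx. assert (Hn : 1 <= INR N) by (apply (le_INR 1); lia).
  set (n := INR N) in *. set (y := x / 2).
  pose proof PI_4. pose proof PI2_3_2.
  assert (Hy : 0 < y <= 2) by (unfold y; lra).
  pose proof (sin_cubic_lower y ltac:(lra)) as Hs.
  assert (Hs2 : y / 3 <= sin y).
  { assert (y ^ 3 <= 4 * y) by (simpl; nra). lra. }
  rewrite one_minus_cos. fold y.
  assert (Hny : 3 / 4 <= n * y) by (unfold y; lra).
  assert (Hns : 1 / 4 <= n * sin y) by nra.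
  assert (Hsp : 0 < 2 * (2 * sin y ^ 2)) by (assert (0 < sin y ^ 2) by (apply pow_lt; lra); lra).
  apply Rmult_le_reg_r with (2 * (2 * sin y ^ 2)); auto.
  rewrite Rinv_l by lra.
  replace ((2 * n) ^ 2 * (2 * (2 * sin y ^ 2))) with (16 * ((n * sin y) * (n * sin y))) by ring.
  nra.
Qed.

(** The power series is split at [3 N]: the head is estimated termwise and the tail by
    [jet_bound_tail], whose size parameter [t N] is controlled by the truncated mean.
    The factor 3 leaves room to bound [N Delta t] and [N^2 Delta^2 t] by [t N]. *)
Lemma fourier_derivative_bounds (t : nat -> R) : ex_series t -> completely_monotone t ->
  exists f1 f2, C2_on off_one (fourier (ext t)) f1 f2 /\
  forall theta N, (1 <= N)%nat -> 0 < theta <= PI -> PI / 2 <= INR N * theta ->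
    Cmod (f1 theta) <= 2000 * truncated_mean t (3 * N) /\
    Cmod (f2 theta) <= 40000 * INR N * truncated_mean t (3 * N).
Proof.
  intros Ht Hcm. destruct (completely_monotone_Delta t Hcm) as [H0 [H1 [H2 H3]]].
  assert (Hd : forall n, t (S n) <= t n) by (intros n; specialize (H1 n); unfold Delta in H1; lra).
  assert (Hloc : forall theta N, (1 <= N)%nat -> 0 < theta <= PI -> PI / 2 <= INR N * theta ->
    exists f1 f2, C2_on off_one (fourier (ext t)) f1 f2 /\
    Cmod (f1 theta) <= 2000 * truncated_mean t (3 * N) /\
    Cmod (f2 theta) <= 40000 * INR N * truncated_mean t (3 * N)).
  { intros theta N HN Hth HNt.
    set (L := (3 * N)%nat).
    set (v := fun k => t (S L + k)%nat).
    assert (Hn : 1 <= INR N) by (apply (le_INR 1); lia).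
    assert (Hoff : off_one theta) by (apply off_one_interval; pose proof PI_RGT_0; lra).
    assert (D1 : Delta v = fun k => Delta t (S L + k)%nat) by apply Delta_shift.
    assert (D2 : Delta (Delta v) = fun k => Delta (Delta t) (S L + k)%nat)
      by (rewrite D1; apply Delta_shift).
    assert (D3 : Delta (Delta (Delta v)) = fun k => Delta (Delta (Delta t)) (S L + k)%nat)
      by (rewrite D2; apply Delta_shift).
    assert (Hdd : forall n, Delta t (S n) <= Delta t n)
      by (intros n; specialize (H2 n); unfold Delta at 1 in H2; lra).
    assert (Hddd : forall n, Delta (Delta t) (S n) <= Delta (Delta t) n)
      by (intros n; specialize (H3 n); unfold Delta at 1 in H3; lra).
    assert (B1 : INR N * Delta t (2 * N)%nat <= t N).
    { replace (2 * N)%nat with (N + N)%nat by lia. now apply convex_gap. }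
    assert (B2 : INR N * Delta (Delta t) L <= Delta t (2 * N)%nat).
    { replace L with (2 * N + N)%nat by (unfold L; lia). now apply convex_gap. }
    assert (Hjet : jet_bound off_one theta (circle_series v) (16 * INR N) (46 * INR N * t N)).
    { apply jet_bound_tail; auto.
      - now apply inv_one_minus_cos.
      - intros n. apply H0.
      - intros n. now rewrite D1.
      - intros n. now rewrite D2.
      - intros n. now rewrite D3.
      - now apply (proj1 (ex_series_incr_n t (S L))).
      - apply (decreasing_le t N (S L + 0)); auto. unfold L; lia.
      - rewrite D1. eapply Rle_trans; [|exact B1].
        apply Rmult_le_compat_l; [lra|]. apply (decreasing_le (Delta t)); auto. unfold L; lia.
      - rewrite D2. eapply Rle_trans; [|exact B1].
        replace (INR N ^ 2 * Delta (Delta t) (S L + 0)%nat)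
          with (INR N * (INR N * Delta (Delta t) (S L + 0)%nat)) by ring.
        apply Rmult_le_compat_l; [lra|]. eapply Rle_trans; [|exact B2].
        apply Rmult_le_compat_l; [lra|]. apply (decreasing_le (Delta (Delta t))); auto. lia. }
    assert (H16 : 0 <= 16 * INR N) by lra.
    apply (jet_bound_mult off_one theta (circle_pow (S L)) _ _ _ _ _ (pos_INR _) H16
      (jet_bound_circle_pow off_one theta (S L))) in Hjet.
    destruct Hjet as [G1 [G2 [HG [_ [HG1 HG2]]]]].
    destruct (C2_on_head off_one t L H0) as [P1 [P2 [HP HPb]]].
    exists (fun y => P1 y + G1 y)%C, (fun y => P2 y + G2 y)%C.
    split.
    { apply (C2_on_ext off_one
        (fun y => head t L y + circle_pow (S L) y * circle_series v y)%C); auto using open_off_one.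
      - intros y _. symmetry. now apply circle_series_head.
      - now apply (C2_on_plus off_one (head t L) P1 P2). }
    destruct (HPb theta) as [HP1 HP2].
    assert (HnL : INR L = 3 * INR N) by (unfold L; rewrite mult_INR; simpl; ring).
    rewrite S_INR, HnL in HG1, HG2. rewrite HnL in HP2.
    (* N^2 t_N is at most twice the sum of k t_k up to N, as t decreases *)
    assert (HS : INR N * INR N * t N <= 2 * truncated_mean t L).
    { rewrite <- sum_n_truncated_mean.
      assert (Hsum : forall m, sum_n (fun k => INR k * t N) m = INR m * (INR m + 1) / 2 * t N :> R).
      { induction m as [|m IH]; [rewrite sum_O; simpl; field|].
        rewrite sum_n_Sn_R, IH, S_INR. field. }
      assert (HNsum : sum_n (fun k => INR k * t N) N <= sum_n (fun k => INR k * t k) N).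
      { apply sum_n_le. intros k Hk. apply Rmult_le_compat_l; [apply pos_INR|].
        now apply decreasing_le. }
      rewrite Hsum in HNsum.
      assert (Hmono : forall p, sum_n (fun k => INR k * t k) N
                                <= sum_n (fun k => INR k * t k) (N + p)).
      { induction p as [|p IH]; [rewrite Nat.add_0_r; lra|].
        rewrite Nat.add_succ_r, sum_n_Sn_R.
        pose proof (Rmult_le_pos _ _ (pos_INR (S (N + p))) (H0 (S (N + p)))). lra. }
      specialize (Hmono (2 * N)%nat).
      replace (N + 2 * N)%nat with L in Hmono by (unfold L; lia).
      assert (0 <= INR N * t N) by (apply Rmult_le_pos; auto; lra). lra. }
    set (n := INR N) in *. set (S0 := truncated_mean t L) in *.
    assert (HT : 0 <= t N) by auto.
    assert (HS0 : 0 <= S0).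
    { eapply Rle_trans; [apply Cmod_ge_0|exact HP1]. }
    assert (Hlam : 3 * n + 1 + 16 * n <= 20 * n) by lra.
    assert (HX : 0 <= n * t N) by (apply Rmult_le_pos; lra).
    split; (eapply Rle_trans; [apply Cmod_triangle|]).
    - assert ((3 * n + 1 + 16 * n) * (1 * (46 * n * t N)) <= 20 * n * (46 * (n * t N))).
      { replace (1 * (46 * n * t N)) with (46 * (n * t N)) by ring.
        apply Rmult_le_compat_r; lra. }
      lra.
    - assert (Hl2 : (3 * n + 1 + 16 * n) ^ 2 <= (20 * n) ^ 2) by (apply pow_incr; lra).
      assert ((3 * n + 1 + 16 * n) ^ 2 * (1 * (46 * n * t N)) <= (20 * n) ^ 2 * (46 * (n * t N))).
      { replace (1 * (46 * n * t N)) with (46 * (n * t N)) by ring.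
        apply Rmult_le_compat_r; lra. }
      assert (n * (n * n * t N) <= n * (2 * S0)) by (apply Rmult_le_compat_l; lra).
      assert (0 <= n * S0) by (apply Rmult_le_pos; lra).
      lra. }
  (* The derivatives produced at different scales coincide, by uniqueness. *)
  destruct (Hloc PI 1%nat (le_n 1)) as [f1 [f2 [Hf _]]];
    [pose proof PI_RGT_0; lra|pose proof PI_RGT_0; simpl; lra|].
  exists f1, f2. split; auto. intros theta N HN Hth HNt.
  destruct (Hloc theta N HN Hth HNt) as [g1 [g2 [Hg [B1 B2]]]].
  destruct (C2_on_unique off_one _ _ _ _ _ _ open_off_one (fun x _ => eq_refl) Hf Hg theta)
    as [-> ->]; auto.
  apply off_one_interval. pose proof PI_RGT_0; lra.
Qed.

(** * The comparison function *)

(** One minus the generating function of the law at [exp (- |theta|)]. Its derivative is a sum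
    of positive terms comparable to the truncated mean at [1 / theta], the quantity that
    bounds the derivatives of the Fourier transform. *)
Definition psi (t : nat -> R) (theta : R) : R :=
  Series (fun k => t k * (1 - exp (- (INR k * Rabs theta)))).

Definition dpsi_pos (t : nat -> R) (theta : R) : R :=
  Series (fun k => INR k * t k * exp (- (INR k * theta))).

Definition dpsi (t : nat -> R) (theta : R) : R :=
  if Rlt_dec 0 theta then dpsi_pos t theta else - dpsi_pos t (- theta).

Lemma exp_neg_bounds (x : R) : 0 <= x ->
  0 <= 1 - exp (- x) <= Rmin x 2 /\ x * exp (- x) <= 1 - exp (- x).
Proof.
  intros Hx.
  assert (H1 : 1 + x <= exp x) by apply exp_ineq1_le.
  assert (H2 : 1 + - x <= exp (- x)) by apply exp_ineq1_le.
  assert (H3 : exp (- x) * exp x = 1).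
  { rewrite <- exp_plus, Rplus_opp_l. apply exp_0. }
  pose proof (exp_pos (- x)) as H4.
  assert (H5 : exp (- x) * (1 + x) <= 1) by (rewrite <- H3; apply Rmult_le_compat_l; lra).
  assert (0 <= x * exp (- x)) by (apply Rmult_le_pos; lra).
  split; [split; [lra|apply Rmin_glb; lra]|lra].
Qed.

Lemma psi_term_bound (t : nat -> R) (k : nat) (y : R) : (forall n, 0 <= t n) -> 0 <= y ->
  Rabs (t k * (1 - exp (- (INR k * y)))) <= t k.
Proof.
  intros H0 Hy.
  destruct (exp_neg_bounds (INR k * y)) as [[H1 _] _];
    [apply Rmult_le_pos; auto using pos_INR|].
  pose proof (exp_pos (- (INR k * y))). specialize (H0 k).
  rewrite Rabs_pos_eq; nra.
Qed.

Lemma dpsi_term_bound (t : nat -> R) (k : nat) (x y : R) : (forall n, 0 <= t n) ->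
  0 < x <= y -> Rabs (INR k * t k * exp (- (INR k * y))) <= / x * t k.
Proof.
  intros H0 Hx. pose proof (pos_INR k) as Hk.
  destruct (exp_neg_bounds (INR k * y)) as [[H1 _] H2]; [apply Rmult_le_pos; lra|].
  pose proof (exp_pos (- (INR k * y))) as He. specialize (H0 k).
  set (e := exp (- (INR k * y))) in *.
  assert (H3 : x * (INR k * e) <= 1).
  { assert (0 <= INR k * e) by (apply Rmult_le_pos; lra).
    assert (x * (INR k * e) <= y * (INR k * e)) by (apply Rmult_le_compat_r; lra). lra. }
  rewrite Rabs_pos_eq by (repeat apply Rmult_le_pos; lra).
  replace (INR k * t k * e) with (INR k * e * t k) by ring.
  apply Rmult_le_compat_r; auto.
  apply Rmult_le_reg_l with x; [lra|]. rewrite Rinv_r by lra. exact H3.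
Qed.

Lemma psi_continuous (t : nat -> R) (x : R) : (forall n, 0 <= t n) -> ex_series t ->
  continuous (psi t) x.
Proof.
  intros H0 H1.
  apply (Series_continuous (fun k y => t k * (1 - exp (- (INR k * Rabs y)))) t x H1).
  - intros k. apply (continuous_comp Rabs (fun y => t k * (1 - exp (- (INR k * y))))).
    + apply continuous_Rabs.
    + apply (ex_derive_continuous (V := R_NormedModule)). auto_derive. auto.
  - apply filter_forall. intros y k. apply psi_term_bound; auto. apply Rabs_pos.
Qed.

Lemma psi_derive_pos (t : nat -> R) (x : R) : (forall n, 0 <= t n) -> ex_series t -> 0 < x ->
  is_derive (fun y => Series (fun k => t k * (1 - exp (- (INR k * y))))) x (dpsi_pos t x).
Proof.
  intros H0 H1 Hx.
  apply (Series_derive (fun k y => t k * (1 - exp (- (INR k * y))))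
    (fun k y => INR k * t k * exp (- (INR k * y))) t (fun k => / (x / 2) * t k) x (x / 2)); auto.
  - lra.
  - now apply ex_series_scalR.
  - intros k y Hy. apply Rabs_def2 in Hy. split; [|split].
    + auto_derive; auto. ring.
    + apply psi_term_bound; auto; lra.
    + apply dpsi_term_bound; auto; lra.
Qed.

Lemma dpsi_pos_continuous (t : nat -> R) (x : R) : (forall n, 0 <= t n) -> ex_series t ->
  0 < x -> continuous (dpsi_pos t) x.
Proof.
  intros H0 H1 Hx.
  apply (Series_continuous (fun k y => INR k * t k * exp (- (INR k * y)))
    (fun k => / (x / 2) * t k) x); [now apply ex_series_scalR| |].
  - intros k. apply (ex_derive_continuous (V := R_NormedModule)). auto_derive. auto.
  - assert (Hx2 : 0 < x / 2) by lra. exists (mkposreal _ Hx2).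
    intros y Hy k. assert (Hy' : Rabs (y - x) < x / 2) by exact Hy.
    apply Rabs_def2 in Hy'. apply dpsi_term_bound; auto; lra.
Qed.

Lemma locally_lt (x c : R) : x < c -> locally x (fun y => y < c).
Proof. intros H. exact (open_lt c x H). Qed.

Lemma locally_gt (x c : R) : c < x -> locally x (fun y => c < y).
Proof. intros H. exact (open_gt c x H). Qed.

Lemma psi_C1 (t : nat -> R) : (forall n, 0 <= t n) -> ex_series t ->
  C1_on (V := R_NormedModule) punctured_circle (psi t) (dpsi t).
Proof.
  intros H0 H1. apply C1_on_R; intros x [_ Hx].
  - destruct (Rtotal_order x 0) as [Hn|[He|Hp]]; [|lra|].
    + assert (E : dpsi t x = - dpsi_pos t (- x))
        by (unfold dpsi; destruct (Rlt_dec 0 x); lra).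
      rewrite E.
      apply (is_derive_ext_loc
        (fun y => Series (fun k => t k * (1 - exp (- (INR k * - y)))))).
      * generalize (locally_lt x 0 Hn). apply filter_imp. intros y Hy. unfold psi.
        now rewrite Rabs_left.
      * assert (Hneg : is_derive (fun y : R => - y) x (-1)) by (auto_derive; auto; ring).
        assert (Hx' : 0 < - x) by lra.
        replace (- dpsi_pos t (- x)) with (scal (-1) (dpsi_pos t (- x)))
          by (unfold scal; simpl; unfold mult; simpl; ring).
        exact (is_derive_comp (fun y => Series (fun k => t k * (1 - exp (- (INR k * y)))))
          (fun y => - y) x _ _ (psi_derive_pos t (- x) H0 H1 Hx') Hneg).
    + assert (E : dpsi t x = dpsi_pos t x)
        by (unfold dpsi; destruct (Rlt_dec 0 x); lra).
      rewrite E.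
      apply (is_derive_ext_loc
        (fun y => Series (fun k => t k * (1 - exp (- (INR k * y)))))).
      * generalize (locally_gt x 0 Hp). apply filter_imp. intros y Hy. unfold psi.
        now rewrite Rabs_pos_eq by lra.
      * now apply psi_derive_pos.
  - destruct (Rtotal_order x 0) as [Hn|[He|Hp]]; [|lra|].
    + apply (continuous_ext_loc _ (fun y => - dpsi_pos t (- y))).
      * generalize (locally_lt x 0 Hn). apply filter_imp. intros y Hy. unfold dpsi.
        destruct (Rlt_dec 0 y); lra.
      * apply (continuous_opp (fun y => dpsi_pos t (- y))).
        apply (continuous_comp (fun y => - y) (dpsi_pos t)).
        -- apply (ex_derive_continuous (V := R_NormedModule)). auto_derive. auto.
        -- apply dpsi_pos_continuous; auto; lra.
    + apply (continuous_ext_loc _ (dpsi_pos t)).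
      * generalize (locally_gt x 0 Hp). apply filter_imp. intros y Hy. unfold dpsi.
        destruct (Rlt_dec 0 y); lra.
      * now apply dpsi_pos_continuous.
Qed.

Lemma dpsi_pos_ex (t : nat -> R) (theta : R) : (forall n, 0 <= t n) -> ex_series t ->
  0 < theta -> ex_series (fun k => INR k * t k * exp (- (INR k * theta))).
Proof.
  intros H0 H1 Hth. apply (ex_series_dom _ (fun k => / theta * t k)).
  - intros k. apply dpsi_term_bound; auto; lra.
  - now apply ex_series_scalR.
Qed.

Lemma dpsi_pos_le_psi (t : nat -> R) (theta : R) : (forall n, 0 <= t n) -> ex_series t ->
  0 < theta -> theta * dpsi_pos t theta <= psi t theta.
Proof.
  intros H0 H1 Hth. unfold dpsi_pos, psi. rewrite <- Series_scal_l. apply Series_mono.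
  - intros k. rewrite Rabs_pos_eq by lra.
    replace (theta * (INR k * t k * exp (- (INR k * theta))))
      with (t k * (INR k * theta * exp (- (INR k * theta)))) by ring.
    apply Rmult_le_compat_l; auto. apply exp_neg_bounds.
    apply Rmult_le_pos; [apply pos_INR|lra].
  - apply ex_series_scalR. now apply dpsi_pos_ex.
  - apply (ex_series_dom _ t); auto. intros k. apply psi_term_bound; auto. apply Rabs_pos.
Qed.

Lemma psi_le_min_moment (t : nat -> R) (theta : R) : (forall n, 0 <= t n) -> ex_series t ->
  0 < theta -> psi t theta <= Series (fun k => t k * Rmin (INR k * theta) 2).
Proof.
  intros H0 H1 Hth. unfold psi. apply Series_mono.
  - intros k. rewrite Rabs_pos_eq by lra. apply Rmult_le_compat_l; auto.
    apply exp_neg_bounds. apply Rmult_le_pos; [apply pos_INR|lra].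
  - apply (ex_series_dom _ t); auto. intros k. apply psi_term_bound; auto. apply Rabs_pos.
  - apply (min_moment_le t theta 1); auto; lra.
Qed.

Lemma dpsi_pos_ge_mean (t : nat -> R) (theta : R) (n : nat) (b : R) :
  (forall n, 0 <= t n) -> ex_series t -> 0 < theta -> INR n * theta <= b ->
  exp (- b) * truncated_mean t n <= dpsi_pos t theta.
Proof.
  intros H0 H1 Hth Hb.
  eapply Rle_trans; [|apply (sum_n_le_Series _ n); [|now apply dpsi_pos_ex]].
  - rewrite <- sum_n_truncated_mean.
    replace (exp (- b) * sum_n (fun k => INR k * t k) n)
      with (sum_n (fun k => exp (- b) * (INR k * t k)) n)
      by apply (sum_n_mult_l (exp (- b)) (fun k => INR k * t k)).
    apply sum_n_le. intros k Hk. rewrite Rmult_comm. apply Rmult_le_compat_l.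
    + apply Rmult_le_pos; auto using pos_INR.
    + apply le_INR in Hk.
      assert (INR k * theta <= INR n * theta) by (apply Rmult_le_compat_r; lra).
      destruct (Req_dec b (INR k * theta)) as [->|Hne]; [lra|].
      left. apply exp_increasing. lra.
  - intros k. apply Rmult_le_pos; [apply Rmult_le_pos; auto using pos_INR|].
    left. apply exp_pos.
Qed.

Lemma dpsi_pos_ge_const (t : nat -> R) (theta : R) : (forall n, 0 <= t n) -> ex_series t ->
  0 < theta <= PI -> exp (- 4) * t 1%nat <= dpsi_pos t theta.
Proof.
  intros H0 H1 Hth. pose proof PI_4.
  eapply Rle_trans; [|apply (dpsi_pos_ge_mean t theta 1 4); auto; simpl; lra].
  unfold truncated_mean. rewrite sum_n_n. simpl. replace (Ropp 4) with (-4) by lra. lra.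
Qed.

(** * The hypothesis (H) *)

(** The bound on [theta * F1] by [psi] follows from that on [F1], since
    [theta * psi' <= psi]. *)
Lemma hypothesis_H_of_bounds (t : nat -> R) (nu : Z -> R) (F1 F2 : R -> C) (c M : R) :
  (forall n, 0 <= t n) -> ex_series t -> 0 < c -> 0 < M ->
  C2_on off_one (fourier nu) F1 F2 ->
  (forall theta, 0 < theta <= PI ->
    Cmod (fourier nu theta) <= 1 - c * psi t theta /\
    Cmod (F1 theta) <= M * dpsi_pos t theta /\
    theta * Cmod (F2 theta) <= M * dpsi_pos t theta) ->
  hypothesis_H nu.
Proof.
  intros H0 H1 Hc HM HC2 Hb.
  assert (Hoff : forall x, punctured_circle x -> off_one x).
  { intros x [[Hx1 Hx2] Hx]. pose proof PI_RGT_0.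
    destruct (Rtotal_order x 0) as [Hn|[He|Hp]]; [|lra|].
    - unfold off_one. rewrite <- cos_neg. apply off_one_interval. lra.
    - apply off_one_interval. lra. }
  assert (HC2' := C2_on_sub _ _ _ _ _ Hoff HC2).
  exists F1, F2. split; [|split].
  - apply C1_on_C; intros x Hx; [now apply HC2'|].
    apply (cderiv_ccont F1 x (F2 x)). now apply HC2'.
  - apply C1_on_C; intros x Hx; now apply HC2'.
  - exists (psi t), (dpsi t). split; [|split; [|split; [|split]]].
    + intros x _. unfold psi. now rewrite Rabs_Ropp.
    + intros x _. apply filterlim_within. now apply psi_continuous.
    + unfold psi. apply Series_0. intros k. rewrite Rabs_R0, Rmult_0_r, Ropp_0, exp_0. ring.
    + now apply psi_C1.
    + exists c, M. split; auto. split; auto. intros theta Hth.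
      destruct (Hb theta Hth) as [B0 [B1 B2]].
      assert (E : dpsi t theta = dpsi_pos t theta)
        by (unfold dpsi; destruct (Rlt_dec 0 theta); lra).
      pose proof (dpsi_pos_le_psi t theta H0 H1 (proj1 Hth)) as Hle.
      rewrite E, !Cmod_mult, Cmod_R, Rabs_pos_eq by lra.
      split; [|split; [|split]]; auto.
      apply Rle_trans with (theta * (M * dpsi_pos t theta)).
      * apply Rmult_le_compat_l; lra.
      * apply (Rmult_le_compat_l M) in Hle; lra.
Qed.

Lemma fourier_bounds (t : nat -> R) (K : R) : decreasing_law t -> completely_monotone t ->
  0 < K -> tail_condition t K -> 0 < t 1%nat ->
  exists f1 f2 c M, 0 < c /\ 0 < M /\ C2_on off_one (fourier (ext t)) f1 f2 /\
  forall theta, 0 < theta <= PI ->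
    Cmod (fourier (ext t) theta) <= 1 - c * psi t theta /\
    Cmod (f1 theta) <= M * dpsi_pos t theta /\
    theta * Cmod (f2 theta) <= M * dpsi_pos t theta.
Proof.
  intros Hlaw Hcm HK HT Ht1.
  assert (Ht0 : 0 < t 0%nat).
  { pose proof (proj2 (proj2 (proj2 Hlaw)) 0%nat). lra. }
  destruct (min_moment_le_gap t K Hlaw HK HT Ht0) as [c [Hc Hgap]].
  destruct Hlaw as [H0 [H1 _]].
  destruct (fourier_derivative_bounds t H1 Hcm) as [f1 [f2 [HC2 Hf]]].
  pose proof (exp_pos 18) as He.
  exists f1, f2, c, (240000 * exp 18). split; auto. split; [lra|]. split; auto.
  intros theta Hth.
  destruct (scale_exists theta Hth) as [N [HN [HN1 HN2]]].
  destruct (Hf theta N HN Hth HN1) as [B1 B2].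
  assert (Hn6 : INR N * theta <= 6) by (pose proof PI_4; lra).
  pose proof (dpsi_pos_ge_mean t theta (3 * N) 18 H0 H1 (proj1 Hth)) as Hd.
  rewrite mult_INR in Hd. simpl (INR 3) in Hd. specialize (Hd ltac:(lra)).
  set (m := truncated_mean t (3 * N)) in *.
  assert (Hm : m <= exp 18 * dpsi_pos t theta).
  { apply (Rmult_le_compat_l (exp 18)) in Hd; [|lra].
    rewrite <- Rmult_assoc, <- exp_plus, Rplus_opp_r, exp_0 in Hd. lra. }
  assert (Hm0 : 0 <= m).
  { pose proof (Cmod_ge_0 (f1 theta)). lra. }
  split; [|split].
  - pose proof (psi_le_min_moment t theta H0 H1 (proj1 Hth)) as Hp.
    apply (Rmult_le_compat_l c) in Hp; [|lra]. specialize (Hgap theta Hth). lra.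
  - lra.
  - apply (Rmult_le_compat_l theta) in B2; [|lra].
    assert (INR N * theta * m <= 6 * m) by (apply Rmult_le_compat_r; lra). lra.
Qed.

Lemma fourier_bounds_second_moment (sigma : Z -> R) : is_prob sigma -> summableZ (weighted 2 sigma) ->
  exists s1 s2 V, 0 < V /\ C2_on off_one (fourier sigma) s1 s2 /\
  forall theta, Cmod (fourier sigma theta) <= 1 /\ Cmod (s1 theta) <= V /\
    Cmod (s2 theta) <= V.
Proof.
  intros Hs H2. assert (H1 := summable_first_moment _ H2).
  set (S1 := l1norm (weighted 1 sigma)). set (S2 := l1norm (weighted 2 sigma)).
  assert (P1 : 0 <= S1) by now apply l1norm_nonneg.
  assert (P2 : 0 <= S2) by now apply l1norm_nonneg.
  do 2 eexists. exists (S1 + S2 + 1). split; [lra|].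
  split; [apply C2_on_fourier; [apply Hs|exact H2]|].
  intros theta. cbv beta. rewrite !Cmod_Ci_mult. split; [|split].
  - rewrite <- (l1norm_prob _ Hs). apply Cmod_fourier_le, Hs.
  - pose proof (Cmod_fourier_le _ theta H1). fold S1 in H. lra.
  - pose proof (Cmod_fourier_le _ theta H2). fold S2 in H. lra.
Qed.

(** The transform of [sigma] has bounded derivatives up to order 2, which [psi'] dominates as
    it is bounded below by a positive constant. *)
Lemma hypothesis_H_conv (t : nat -> R) (K : R) (sigma : Z -> R) :
  decreasing_law t -> completely_monotone t ->
  0 < K -> tail_condition t K -> 0 < t 1%nat ->
  is_prob sigma -> summableZ (weighted 2 sigma) -> hypothesis_H (conv (ext t) sigma).
Proof.
  intros Hlaw Hcm HK HT Ht1 Hs H2.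
  destruct (fourier_bounds t K Hlaw Hcm HK HT Ht1) as [f1 [f2 [c [M [Hc [HM [Hf Hfb]]]]]]].
  destruct (fourier_bounds_second_moment sigma Hs H2) as [s1 [s2 [V [HS [Hsg Hsb]]]]].
  pose proof (is_prob_ext t Hlaw) as Hp.
  set (e := exp (- 4) * t 1%nat).
  assert (He : 0 < e) by (apply Rmult_lt_0_compat; auto using exp_pos).
  assert (HSe : 0 < V / e) by (apply Rdiv_lt_0_compat; auto).
  assert (HMS : 0 < M * V) by (apply Rmult_lt_0_compat; auto).
  apply (hypothesis_H_of_bounds t _ _ _ c (M + 8 * (M * V) + 4 * (V / e)) (proj1 Hlaw)
    (proj1 (proj2 Hlaw)) Hc ltac:(lra)
    (C2_on_ext off_one _ (fourier (conv (ext t) sigma)) _ _ open_off_one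
      (fun x _ => eq_sym (fourier_conv (ext t) sigma x (proj1 (proj2 Hp)) (proj1 (proj2 Hs))))
      (C2_on_mult off_one _ _ _ _ _ _ Hf Hsg))).
  intros theta Hth. cbv beta.
  destruct (Hfb theta Hth) as [A0 [A1 A2]]. destruct (Hsb theta) as [B0 [B1 B2]].
  pose proof (dpsi_pos_ge_const t theta (proj1 Hlaw) (proj1 (proj2 Hlaw)) Hth) as Hd.
  fold e in Hd.
  pose proof (Cmod_fourier_le (ext t) theta (proj1 (proj2 Hp))) as C0.
  rewrite (l1norm_prob _ Hp) in C0.
  rewrite fourier_conv by (apply Hp || apply Hs).
  pose proof (Cmod_ge_0 (fourier (ext t) theta)). pose proof (Cmod_ge_0 (fourier sigma theta)).
  pose proof (Cmod_ge_0 (f1 theta)). pose proof (Cmod_ge_0 (s1 theta)).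
  pose proof (Cmod_ge_0 (f2 theta)). pose proof (Cmod_ge_0 (s2 theta)).
  pose proof PI_4.
  set (f := fourier (ext t) theta) in *. set (s := fourier sigma theta) in *.
  set (D := dpsi_pos t theta) in *.
  assert (HSD : V <= V / e * D).
  { replace V with (V / e * e) at 1 by (field; lra). apply Rmult_le_compat_l; lra. }
  assert (HMSD : 0 <= M * V * D) by (apply Rmult_le_pos; lra).
  assert (P : forall a b u v, 0 <= a -> 0 <= b -> a <= u -> b <= v -> a * b <= u * v)
    by (intros; now apply Rmult_le_compat).
  split; [|split].
  - rewrite Cmod_mult. pose proof (P _ _ _ _ (Cmod_ge_0 f) (Cmod_ge_0 s) (Rle_refl _) B0). lra.
  - eapply Rle_trans; [apply Cmod_triangle|]. rewrite !Cmod_mult.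
    assert (Cmod (f1 theta) * Cmod s <= M * D * 1) by now apply P.
    assert (Cmod f * Cmod (s1 theta) <= 1 * V) by now apply P. lra.
  - apply Rle_trans with (theta * Cmod (f2 theta) * Cmod s
      + 2 * (theta * (Cmod (f1 theta) * Cmod (s1 theta)))
      + theta * (Cmod f * Cmod (s2 theta))).
    + pose proof (Cmod_triangle (f2 theta * s + f1 theta * s1 theta)
        (f1 theta * s1 theta + f * s2 theta)) as T.
      pose proof (Cmod_triangle (f2 theta * s) (f1 theta * s1 theta)) as T1.
      pose proof (Cmod_triangle (f1 theta * s1 theta) (f * s2 theta)) as T2.
      rewrite !Cmod_mult in T1, T2.
      apply Rle_trans with (theta * (Cmod (f2 theta) * Cmod s
        + Cmod (f1 theta) * Cmod (s1 theta)
        + (Cmod (f1 theta) * Cmod (s1 theta) + Cmod f * Cmod (s2 theta)))); [|lra].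
      apply Rmult_le_compat_l; lra.
    + assert (theta * Cmod (f2 theta) * Cmod s <= M * D * 1).
      { apply P; auto. apply Rmult_le_pos; lra. }
      assert (Q1 : Cmod (f1 theta) * Cmod (s1 theta) <= M * D * V) by now apply P.
      assert (Q2 : Cmod f * Cmod (s2 theta) <= 1 * V) by now apply P.
      assert (theta * (Cmod (f1 theta) * Cmod (s1 theta)) <= 4 * (M * D * V)).
      { apply P; auto; try lra. now apply Rmult_le_pos. }
      assert (theta * (Cmod f * Cmod (s2 theta)) <= 4 * (1 * V)).
      { apply P; auto; try lra. now apply Rmult_le_pos. }
      lra.
Qed.

Lemma hypothesis_H_mix (t : nat -> R) (K alpha : R) (sigma : Z -> R) :
  decreasing_law t -> completely_monotone t ->
  0 < K -> tail_condition t K -> 0 < t 1%nat ->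
  is_prob sigma -> summableZ (weighted 2 sigma) -> 0 < alpha <= 1 ->
  hypothesis_H (fun n => alpha * ext t n + (1 - alpha) * sigma n).
Proof.
  intros Hlaw Hcm HK HT Ht1 Hs H2 Ha.
  destruct (fourier_bounds t K Hlaw Hcm HK HT Ht1) as [f1 [f2 [c [M [Hc [HM [Hf Hfb]]]]]]].
  destruct (fourier_bounds_second_moment sigma Hs H2) as [s1 [s2 [V [HS [Hsg Hsb]]]]].
  pose proof (is_prob_ext t Hlaw) as Hp.
  set (e := exp (- 4) * t 1%nat).
  assert (He : 0 < e) by (apply Rmult_lt_0_compat; auto using exp_pos).
  assert (HSe : 0 < V / e) by (apply Rdiv_lt_0_compat; auto).
  assert (Hsum : forall x, fourier (fun n => alpha * ext t n + (1 - alpha) * sigma n) x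
    = (RtoC alpha * fourier (ext t) x + RtoC (1 - alpha) * fourier sigma x)%C).
  { intros x. rewrite fourier_plus, !fourier_scal; auto; apply summableZ_scal;
    [apply Hp|apply Hs]. }
  assert (Hac : 0 < alpha * c) by (apply Rmult_lt_0_compat; lra).
  assert (HMa : 0 < M + 4 * (V / e)) by lra.
  apply (hypothesis_H_of_bounds t _ _ _ (alpha * c) (M + 4 * (V / e)) (proj1 Hlaw)
    (proj1 (proj2 Hlaw)) Hac HMa
    (C2_on_ext off_one _ (fourier (fun n => alpha * ext t n + (1 - alpha) * sigma n)) _ _
      open_off_one (fun x _ => eq_sym (Hsum x))
      (C2_on_plus off_one _ _ _ _ _ _
        (C2_on_mult off_one _ _ _ _ _ _ (C2_on_const off_one (RtoC alpha)) Hf)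
        (C2_on_mult off_one _ _ _ _ _ _ (C2_on_const off_one (RtoC (1 - alpha))) Hsg)))).
  intros theta Hth. cbv beta. rewrite Hsum, !Cmult_0_l, !Cplus_0_l.
  destruct (Hfb theta Hth) as [A0 [A1 A2]]. destruct (Hsb theta) as [B0 [B1 B2]].
  pose proof (dpsi_pos_ge_const t theta (proj1 Hlaw) (proj1 (proj2 Hlaw)) Hth) as Hd.
  fold e in Hd. pose proof PI_4.
  set (f := fourier (ext t) theta) in *. set (s := fourier sigma theta) in *.
  set (D := dpsi_pos t theta) in *.
  assert (HSD : V <= V / e * D).
  { replace V with (V / e * e) at 1 by (field; lra). apply Rmult_le_compat_l; lra. }
  assert (HMD : 0 <= M * D) by (apply Rmult_le_pos; lra).
  assert (P : forall a u v b, Cmod u <= a -> Cmod v <= b ->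
    Cmod (RtoC alpha * u + RtoC (1 - alpha) * v)%C <= alpha * a + (1 - alpha) * b).
  { intros a u v b Hu Hv. eapply Rle_trans; [apply Cmod_triangle|].
    rewrite !Cmod_mult, !Cmod_R, !Rabs_pos_eq by lra.
    apply Rplus_le_compat; apply Rmult_le_compat_l; lra. }
  assert (Qm : forall a b, 0 <= a -> 0 <= b -> alpha * a + (1 - alpha) * b <= a + b).
  { intros a b Pa Pb. assert (alpha * a <= 1 * a) by (apply Rmult_le_compat_r; lra).
    assert ((1 - alpha) * b <= 1 * b) by (apply Rmult_le_compat_r; lra). lra. }
  split; [|split].
  - eapply Rle_trans; [apply (P _ _ _ _ A0 B0)|]. lra.
  - eapply Rle_trans; [apply (P _ _ _ _ A1 B1)|].
    eapply Rle_trans; [apply Qm; lra|]. lra.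
  - pose proof (P _ _ _ _ (Rle_refl (Cmod (f2 theta))) B2) as T.
    pose proof (Cmod_ge_0 (f2 theta)) as Hf2.
    pose proof (Qm _ _ Hf2 (Rlt_le _ _ HS)) as T2.
    apply Rle_trans with (theta * (Cmod (f2 theta) + V)).
    + apply Rmult_le_compat_l; lra.
    + assert (theta * V <= 4 * V) by (apply Rmult_le_compat_r; lra). lra.
Qed.

(** * Conclusion *)

Lemma t1_pos_or_dirac0 (t : nat -> R) : decreasing_law t -> 0 < t 1%nat \/ ext t = dirac0.
Proof.
  intros [H0 [H1 [H2 Hd]]]. destruct (Rlt_dec 0 (t 1%nat)) as [H|H]; [now left|right].
  assert (Hz : forall k, t (S k) = 0).
  { intros k. pose proof (decreasing_le t 1 (S k) Hd ltac:(lia)).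
    pose proof (H0 (S k)). pose proof (H0 1%nat). lra. }
  assert (Ht0 : t 0%nat = 1).
  { rewrite Series_incr_1, (Series_0 _ Hz) in H2 by auto. lra. }
  extensionality n. unfold ext, dirac0.
  destruct (Z_lt_dec n 0), (Z.eq_dec n 0) as [->|]; try lia; auto.
  replace (Z.to_nat n) with (S (Z.to_nat n - 1)) by lia. apply Hz.
Qed.

Lemma t1_pos_of_BAR (t : nat -> R) : decreasing_law t -> BAR (ext t) -> 0 < t 1%nat.
Proof.
  intros Hlaw [Hap _]. destruct (t1_pos_or_dirac0 t Hlaw) as [H|H]; auto. exfalso.
  specialize (Hap PI ltac:(pose proof PI_RGT_0; lra)).
  rewrite H, fourier_dirac0, Cmod_R, Rabs_R1 in Hap. lra.
Qed.

Theorem theorem1p4 :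
  forall mu : Z -> R,
    is_prob mu ->
    supported_on_N mu ->
    completely_monotone (fun n : nat => mu (Z.of_nat n)) ->
    (* The unit mass at 0 satisfies all the hypotheses and the tail condition,
       but it is not strictly aperiodic: the equivalence needs this exclusion. *)
    (~ (forall n : Z, mu n = dirac0 n) ->
     (BAR mu <->
      exists K : R, 0 < K /\
        forall n : nat, (1 <= n)%nat ->
          sum_n_m (fun k : nat => INR k * mu (Z.of_nat k)) 1 n <=
          K * INR n * Series (fun k : nat => mu (Z.of_nat (n + k))))) /\
    (BAR mu ->
     (forall sigma : Z -> R,
        is_prob sigma ->
        summableZ (fun n : Z => IZR n ^ 2 * sigma n) ->
        (class_H (conv mu sigma) /\ class_R (conv mu sigma)) /\
        (forall alpha : R, 0 < alpha <= 1 ->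
           class_H (fun n => alpha * mu n + (1 - alpha) * sigma n) /\
           class_R (fun n => alpha * mu n + (1 - alpha) * sigma n))) /\
     class_H mu /\ class_R mu).
Proof.
  intros mu Hprob Hsupp Hcm.
  set (t := fun n : nat => mu (Z.of_nat n)).
  assert (Hmu : mu = ext t) by now apply ext_supported.
  assert (Hlaw : decreasing_law t).
  { destruct Hprob as [P0 [P1 P2]]. split; [|split; [|split]].
    - intros n. apply P0.
    - now apply summableZ_right.
    - now rewrite Hmu, sumZ_ext_nat in P2.
    - intros n. pose proof (Hcm 1%nat n) as H. simpl in H. unfold Delta in H. unfold t. lra. }
  split.
  - intros Hne.
    change (BAR mu <-> exists K, 0 < K /\ tail_condition t K).
    split.
    + rewrite Hmu. now apply tail_of_BAR.
    + intros [K [HK HT]]. rewrite Hmu. apply (BAR_of_tail t K); auto.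
      destruct (t1_pos_or_dirac0 t Hlaw) as [H|H]; auto.
      exfalso. apply Hne. intros n. now rewrite Hmu, H.
  - intros HB. rewrite Hmu in HB.
    pose proof (t1_pos_of_BAR t Hlaw HB) as Ht1.
    destruct (tail_of_BAR t Hlaw HB) as [K [HK HT]].
    pose proof (smoothed_self t K Hlaw HK HT) as Hself.
    assert (Hmain : forall sigma, is_prob sigma -> summableZ (weighted 2 sigma) ->
      (class_H (conv mu sigma) /\ class_R (conv mu sigma)) /\
      (forall alpha, 0 < alpha <= 1 ->
         class_H (fun n => alpha * mu n + (1 - alpha) * sigma n) /\
         class_R (fun n => alpha * mu n + (1 - alpha) * sigma n))).
    { intros sigma Hs H2.
      assert (Hsm : smoothed t sigma).
      { apply (smoothed_first_moment t K); auto.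
        apply (summableZ_dom _ (fun n => Rabs (weighted 1 sigma n))).
        - intros n. unfold weighted. rewrite pow_1, !Rabs_mult, abs_IZR, Rabs_Rabsolu. lra.
        - apply summableZ_abs. now apply summable_first_moment. }
      split.
      - pose proof (is_prob_conv mu sigma Hprob Hs) as Hc. split; split; auto; rewrite Hmu.
        + now apply (hypothesis_H_conv t K).
        + now apply Ritt_conv.
      - intros alpha Ha.
        assert (Hm : is_prob (fun n => alpha * mu n + (1 - alpha) * sigma n))
          by (apply is_prob_mix; auto; lra).
        split; split; auto; rewrite Hmu.
        + now apply (hypothesis_H_mix t K).
        + now apply Ritt_mix. }
    split; [exact Hmain|].
    rewrite <- (conv_dirac0_r mu) by apply Hprob.
    apply (Hmain dirac0).
    + split; [apply dirac0_nonneg|]. split; [apply dirac0_summable|apply sumZ_dirac0].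
    + apply (summableZ_ext (fun n => 0 * dirac0 n)).
      * intros n. unfold weighted, dirac0. destruct (Z.eq_dec n 0) as [->|]; ring.
      * apply summableZ_scal, dirac0_summable.
Qed.
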